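(* Let $(G,S_E)$ be an edge-signed map, and suppose that its medial map $med(G)$, equipped with the induced face-coloring $C_F$ and vertex-signature $S_V$, is a $2$-antipodally symmetric map, realized by $\alpha_2$. If either (a) $\alpha_2$ is color-preserving and sign-reversing, or (b) $\alpha_2$ is color-reversing and sign-preserving, then the link $L(G,S_E)$ is amphichiral.
   Context: Maps. A map $G=(V,E,F)$ is (the image of) an embedding in $\mathbb{S}^2$ of a connected finite planar graph (loops and multiple edges allowed), $F$ being the set of faces. $G^*$ is its geometric dual. An edge-signed map $(G,S_E)$ is a map with a function $S_E:E\to\{+,-\}$. Medial map. $med(G)$ is the 4-regular map with one vertex on each edge of $G$, two vertices being joined when the corresponding edges are consecutive on a face of $G$. Each face of $med(G)$ contains exactly one vertex of $G$ or exactly one vertex of $G^*$; the coloring $C_F$ colors it black in the first case and white in the second. The signature $S_V$ gives each vertex of $med(G)$ the sign $S_E(e)$ of the edge $e$ of $G$ on which it lies. Links. $D(G,S_E)$ is the link diagram on $\mathbb{S}^2$ with shadow $med(G)$ whose crossings are given by $S_V$: for an observer in a black face at a crossing, looking at the crossing (from outside the sphere), a positive crossing is one where the strand on the observer's left passes over the one on the right, a negative crossing is the opposite. $L(G,S_E)$ is the link in $\mathbb{R}^3$ represented by $D(G,S_E)$. Two links in $\mathbb{R}^3$ are equivalent if an orientation-preserving homeomorphism of $\mathbb{R}^3$ maps one onto the other. The mirror image $L^*$ of $L$ is its image under reflection in a plane. $L$ is amphichiral if $L$ is equivalent to $L^*$ (equivalently, if there is an orientation-reversing homeomorphism of $\mathbb{R}^3$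 or $\mathbb{S}^3$ preserving $L$). Antipodal symmetry. $\alpha_2:\mathbb{S}^2\to\mathbb{S}^2$, $x\mapsto -x$. A map $M$ is $2$-antipodally symmetric (realized by $\alpha_2$) if it can be drawn in $\mathbb{S}^2$ so that $\alpha_2(M)=M$; then $\alpha_2$ acts as an automorphism on vertices, edges and faces. For $M=(med(G),C_F,S_V)$, $\alpha_2$ is color-preserving (resp. color-reversing) if $f$ and $\alpha_2(f)$ have the same (resp. different) color for every face $f$, and sign-preserving (resp. sign-reversing) if $v$ and $\alpha_2(v)$ have the same (resp. different) sign for every vertex $v$. *)

(* Defs.v *)
From HB Require Import structures.
From mathcomp Require Import all_boot all_order all_algebra finmap.
From mathcomp Require Import all_classical all_reals all_analysis.
Set Implicit Arguments.
Unset Strict Implicit.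
Unset Printing Implicit Defensive.
Import Order.TTheory GRing.Theory Num.Theory.
Import numFieldNormedType.Exports.
Local Open Scope classical_set_scope.
Local Open Scope ring_scope.

Definition dot (R : realType) n (u v : 'rV[R]_n) : R := (u *m v^T) 0 0.

(* The unit sphere of R^n, of dimension n - 1. *)
Definition sphere (R : realType) n : set 'rV[R]_n := [set u | dot u u = 1].
Arguments sphere R n : clear implicits.

Notation S2 R := (sphere R 3).

Definition components (T : topologicalType) (A : set T) : set (set T) :=
  connected_component A @` A.

Definition homeo (T U : topologicalType) (A : set T) (B : set U) (f : T -> U) :=
  [/\ {within A, continuous f}, set_bij A B f &
      exists f' : U -> T, {within B, continuous f'} /\
        forall x, A x -> f' (f x) = x].

(* In all uses [h] is injective on the closed unit ball around [p], so that the
   radius 1 is immaterial below.  The local degree of [h] at [p] is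
   the degree of u |-> h (p + u) - h p from the unit sphere to R^n \ {0}; a map
   from the sphere to R^n \ {0} has degree 1 iff it is homotopic there to the
   inclusion. *)
Definition local_degree1 (R : realType) n (h : 'rV[R]_n -> 'rV[R]_n)
    (p : 'rV[R]_n) :=
  exists H : R * 'rV[R]_n -> 'rV[R]_n,
    [/\ {within `[0, 1]%classic `*` sphere R n, continuous H},
        forall (t : R) u, 0 <= t <= 1 -> sphere R n u -> H (t, u) != 0,
        forall u, sphere R n u -> H (0, u) = u &
        forall u, sphere R n u -> H (1, u) = h (p + u) - h p].

Definition orientation_preserving (R : realType) n (h : 'rV[R]_n -> 'rV[R]_n) :=
  forall p, local_degree1 h p.

(* Edges are open arcs: they do not contain their ends.  Faces are derived. *)
Record smap (R : realType) := SMap {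
  vertices : set 'rV[R]_3;
  edges : set (set 'rV[R]_3) }.

(* [e] is an open arc with ends [a] and [b]; [a = b] is allowed. *)
Definition open_arc (R : realType) (e : set 'rV[R]_3) (a b : 'rV[R]_3) :=
  exists c : R -> 'rV[R]_3,
    [/\ {within `[0, 1], continuous c}, {in `]0, 1[ &, injective c},
        c @` `]0, 1[ = e, c 0 = a & c 1 = b].

Definition drawing (R : realType) (M : smap R) : set 'rV[R]_3 :=
  vertices M `|` \bigcup_(e in edges M) e.

Definition faces (R : realType) (M : smap R) : set (set 'rV[R]_3) :=
  components (S2 R `\` drawing M).

Definition is_map (R : realType) (M : smap R) :=
  [/\ finite_set (vertices M) /\ vertices M !=set0,
      finite_set (edges M),
      drawing M `<=` S2 R /\ connected (drawing M),
      forall e, edges M e -> e `&` vertices M = set0 /\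
        (exists a b, [/\ vertices M a, vertices M b & open_arc e a b]) &
      forall e e', edges M e -> edges M e' -> e `&` e' !=set0 -> e = e'].

Definition vdegree (R : realType) (M : smap R) (v : 'rV[R]_3) : nat :=
  (#|` fset_set [set e | edges M e /\ exists2 w, w != v & open_arc e v w]| +
   2 * #|` fset_set [set e | edges M e /\ open_arc e v v]|)%N.

(* [G'] is a geometric dual of [G]: one dual vertex inside each face, and each
   dual edge meets the drawing of [G] in one point, on the edge it is dual to.
   The symmetric requirement on the faces of [G'] is what makes the common
   point of an edge and its dual a genuine crossing. *)
Definition is_dual (R : realType) (G G' : smap R) :=
  [/\ is_map G /\ is_map G',
      vertices G `&` drawing G' = set0 /\ vertices G' `&` drawing G = set0,
      (forall f, faces G f -> exists! v, vertices G' v /\ f v) /\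
      (forall f, faces G' f -> exists! v, vertices G v /\ f v),
      (forall e, edges G e -> exists! e', edges G' e' /\ e `&` e' !=set0) /\
      (forall e', edges G' e' -> exists! e, edges G e /\ e `&` e' !=set0) &
      forall e e', edges G e -> edges G' e' -> e `&` e' !=set0 ->
        exists x, e `&` e' = [set x]].

(* The superposition of [G] and its dual cuts the sphere into quadrilaterals
   v - m(e) - v* - m(e'), where m(e) is the crossing of [e] with its dual edge.
   They correspond to the occurrences of two consecutive edges e, e' (with
   common end v) on the boundary of a face (with dual vertex v* ), and the
   crossings on the boundary of the quadrilateral are m(e) and m(e'), which may
   coincide. *)
Definition corners (R : realType) (G G' : smap R) : set (set 'rV[R]_3) :=
  components (S2 R `\` (drawing G `|` drawing G')).

Definition is_medial (R : realType) (G M : smap R) :=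
  exists G' : smap R,
  [/\ is_dual G G',
      is_map M /\ (forall v, vertices M v -> vdegree M v = 4%N),
      vertices M = drawing G `&` drawing G',
      (forall q, corners G G' q -> exists! m, edges M m /\ m `<=` q) /\
      (forall m, edges M m -> exists q, [/\ corners G G' q, m `<=` q &
         forall a b, open_arc m a b -> [set a; b] = vertices M `&` closure q]) &
      forall f, faces M f ->
        exists! v, (vertices G v \/ vertices G' v) /\ f v].

(* The coloring C_F: a face of the medial map of [G] is black iff it contains a
   vertex of [G]; otherwise it contains a vertex of the dual and is white. *)
Definition black (R : realType) (G : smap R) (f : set 'rV[R]_3) :=
  vertices G `&` f !=set0.

(* The signature S_V induced by a signature [S] of the edges of [G] (only the
   values of [S] on [edges G] matter; [true] is the sign +). *)
Definition vsign (R : realType) (G : smap R) (S : set 'rV[R]_3 -> bool)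
    (v : 'rV[R]_3) : bool :=
  `[< exists e, [/\ edges G e, e v & S e] >].

Definition map_image (R : realType) (g : 'rV[R]_3 -> 'rV[R]_3) (M : smap R) :=
  SMap (g @` vertices M) ((fun e => g @` e) @` edges M).

Definition antipode (R : realType) (x : 'rV[R]_3) : 'rV[R]_3 := - x.

Definition antipodal_drawing (R : realType) (M : smap R)
    (g : 'rV[R]_3 -> 'rV[R]_3) :=
  homeo (S2 R) (S2 R) g /\
  map_image (@antipode R) (map_image g M) = map_image g M.

(* In this definition and the next three [g] is an antipodal drawing of [M] in
   which [M] is redrawn by the homeomorphism [g] of the sphere; faces and
   vertices of the drawing have the color or sign of those of [M] they are
   drawn from. *)
Definition color_preserving (R : realType) (G M : smap R)
    (g : 'rV[R]_3 -> 'rV[R]_3) :=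
  forall f f', faces M f -> faces M f' ->
    @antipode R @` (g @` f) = g @` f' -> (black G f <-> black G f').

Definition color_reversing (R : realType) (G M : smap R)
    (g : 'rV[R]_3 -> 'rV[R]_3) :=
  forall f f', faces M f -> faces M f' ->
    @antipode R @` (g @` f) = g @` f' -> (black G f <-> ~ black G f').

Definition sign_preserving (R : realType) (G M : smap R)
    (S : set 'rV[R]_3 -> bool) (g : 'rV[R]_3 -> 'rV[R]_3) :=
  forall v v', vertices M v -> vertices M v' ->
    antipode (g v) = g v' -> vsign G S v = vsign G S v'.

Definition sign_reversing (R : realType) (G M : smap R)
    (S : set 'rV[R]_3 -> bool) (g : 'rV[R]_3 -> 'rV[R]_3) :=
  forall v v', vertices M v -> vertices M v' ->
    antipode (g v) = g v' -> vsign G S v = ~~ vsign G S v'.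

Definition is_link (R : realType) (L : set 'rV[R]_3) :=
  exists n (c : 'I_n -> 'rV[R]_2 -> 'rV[R]_3),
    [/\ forall i, {within sphere R 2, continuous c i},
        forall i j u v, sphere R 2 u -> sphere R 2 v ->
          c i u = c j v -> i = j /\ u = v &
        L = \bigcup_i (c i @` sphere R 2)].

Definition link_equiv (R : realType) (L L' : set 'rV[R]_3) :=
  exists h : 'rV[R]_3 -> 'rV[R]_3,
    [/\ homeo setT setT h, orientation_preserving h & h @` L = L'].

Definition reflection (R : realType) (x : 'rV[R]_3) : 'rV[R]_3 :=
  \row_j (if j == 2 then - x 0 j else x 0 j).

Definition mirror (R : realType) (L : set 'rV[R]_3) := @reflection R @` L.

Definition amphichiral (R : realType) (L : set 'rV[R]_3) :=
  link_equiv L (mirror L).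

Definition disc (R : realType) : set 'rV[R]_2 := [set z | dot z z <= 1].

Definition pt2 (R : realType) (x y : R) : 'rV[R]_2 :=
  \row_j (if j == 0 then x else y).

(* [phi] parametrizes a neighborhood of [v] in the sphere, contained in the
   open hemisphere centered at [v], counterclockwise for an observer outside
   the sphere.  The rows e1, e2, v of the rotation matrix [A] form a
   right-handed orthonormal basis, and z |-> (phi z . e1, phi z . e2) is the
   expression of [phi] in the tangent plane at [v] oriented by (e1, e2). *)
Definition ccw_chart (R : realType) (v : 'rV[R]_3)
    (phi : 'rV[R]_2 -> 'rV[R]_3) :=
  [/\ homeo (@disc R) (phi @` @disc R) phi, phi 0 = v,
      forall z, disc z -> S2 R (phi z) /\ 0 < dot (phi z) v,
      nbhs v [set x | S2 R x -> (phi @` @disc R) x] &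
      exists A : 'M[R]_3, [/\ A *m A^T = 1%:M, \det A = 1, row 2 A = v &
        local_degree1
          (fun z => pt2 (dot (phi z) (row 0 A)) (dot (phi z) (row 1 A))) 0]].

(* The crossing of [L] over the vertex [v].  The chart carries the two axes to
   the strands of the shadow [M], and the quadrants xy > 0 to the black
   corners.  An observer in the quadrant x, y > 0 looking at the origin has the
   x-axis on the left, so that the crossing is positive iff the x-strand, at
   height [a], passes over the y-strand, at height [b]; over means farther
   from the center of the sphere. *)
Definition crossing (R : realType) (G M : smap R) (L : set 'rV[R]_3)
    (v : 'rV[R]_3) (positive : bool) :=
  exists (phi : 'rV[R]_2 -> 'rV[R]_3) (a b : R -> R),
  [/\ ccw_chart v phi,
      forall x y, disc (pt2 x y) ->
        [/\ drawing M (phi (pt2 x y)) <-> x * y = 0,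
            0 < x * y ->
              exists f, [/\ faces M f, black G f & f (phi (pt2 x y))] &
            x * y < 0 ->
              exists f, [/\ faces M f, ~ black G f & f (phi (pt2 x y))]],
      {within `[-1, 1], continuous a} /\ {within `[-1, 1], continuous b},
      forall x : R, -1 <= x <= 1 ->
        [/\ 0 < a x, 0 < b x, L (a x *: phi (pt2 x 0)) &
            L (b x *: phi (pt2 0 x))] &
      (forall r : R, 0 < r -> (L (r *: v) <-> r = a 0 \/ r = b 0)) /\
      (if positive then b 0 < a 0 else a 0 < b 0)].

(* [L] is a link in R^3 represented by the diagram with shadow [M], the medial
   map of [G], on the unit sphere: the radial projection of R^3 \ {0} onto the
   sphere maps [L] onto the drawing of [M], it is one-to-one over the edges,
   and the two strands over a vertex cross as prescribed by its sign. *)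
Definition represents (R : realType) (G M : smap R)
    (S : set 'rV[R]_3 -> bool) (L : set 'rV[R]_3) :=
  [/\ is_link L /\ ~ L 0,
      forall u (r : R), S2 R u -> 0 < r -> L (r *: u) -> drawing M u,
      forall e u, edges M e -> e u -> exists! r : R, 0 < r /\ L (r *: u) &
      forall v, vertices M v -> crossing G M L v (vsign G S v)].

(* Main.v *)
Require Import Defs.
From HB Require Import structures.
From mathcomp Require Import all_boot all_order all_algebra finmap.
From mathcomp Require Import all_classical all_reals all_analysis.
From mathcomp Require Import ring lra.
Set Implicit Arguments.
Unset Strict Implicit.
Unset Printing Implicit Defensive.
Import Order.TTheory GRing.Theory Num.Theory.
Import numFieldNormedType.Exports.
Local Open Scope classical_set_scope.
Local Open Scope ring_scope.

(** The antipodal drawing turns the antipodal map into an involution [sym] of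
    the sphere, conjugate to it by [g], which preserves the medial map and has
    no fixed point.  Let Psi be its radial extension to space.

    The involution reverses the orientation of the sphere, so that Psi
    exchanges left and right at a crossing while it keeps over and under.  When
    colors are preserved, an observer in a black face is moved to a black face,
    where the other strand is on the left: the crossing changes sign.  When
    colors are reversed, the observer has to be moved once more, to a
    neighboring face, and the crossing keeps its sign.  Since the signs are
    reversed in the first case and preserved in the second one, the image of
    the link by Psi has the same diagram as the link, and a homeomorphism of
    space preserving every ray from the origin carries one onto the other.
    Composed with a reflection, this gives the homeomorphism [h] to the mirror
    image; it is [reflection] after [polar sym lam], where [lam (u, r)] is the
    height over [sym u] at which the point of height [r] over [u] is sent.

    There are three things to prove.

    Orientation of [h].  The local degree of [h] does not depend on the point,
    as [h] is injective and the point can be moved to the origin.  There, [sym]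
    is homotopic to the antipodal map because it has no fixed point, and the
    antipodal map followed by the reflection is a half-turn
    ([polar_orientation]).

    Orientation of [sym] at a crossing ([antipodal_no_rotation]).  In
    stereographic coordinates [g] becomes a homeomorphism [G] of the plane.  The
    winding of the image of a small circle around its center does not depend on
    the center, hence is the same at [v] and at [sym v]; but the antipodal map
    is the orientation reversing map z |-> - 1 / conj z.  If [sym] were
    deformable to a rotation in positively oriented charts, the image of a circle would
    have the same winding as its conjugate, so that it would be contractible in
    the punctured plane; by the inverse of [G] the circle itself would be
    ([no_reflection]).  Winding is handled through continuous arguments:
    homotopic loops in the punctured plane have a quotient with a continuous
    argument, and conversely ([homotopic_same_winding],
    [same_winding_homotopic]).  The local form of [sym] at a crossing is a
    homeomorphism preserving the union of the two axes; it preserves or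
    exchanges them ([axes_preserved_or_swapped]), and the colors of the quadrants
    tell which choice would be deformable to a rotation ([rotation_pattern]).

    Matching of the heights ([global_matching]).  Over each point, the heights
    of the link and those of its image are to be matched by an increasing map.
    This is possible locally: trivially away from the vertices, where there is
    at most one height, and at a vertex because the two strands are in the same
    order.  Increasing maps matching the heights form a convex set, so the local
    solutions are averaged with continuous weights. *)

(** * Continuity on a subset *)

(** Equivalent to [{within A, continuous f}]; being a statement on plain
    functions, it composes without subspace topologies. *)
Definition cont_on (T U : topologicalType) (A : set T) (f : T -> U) :=
  forall x, A x -> f @ within A (nbhs x) --> f x.

Lemma cont_onP (T U : topologicalType) (A : set T) (f : T -> U) :
  cont_on A f <-> {within A, continuous f}.
Proof. exact: iff_sym (subspace_continuousP _ _). Qed.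

Section ContOn.
Context {R : realType} {T : topologicalType} (A : set T).

Lemma cont_onW (U : topologicalType) (f : T -> U) (B : set T) :
  A `<=` B -> cont_on B f -> cont_on A f.
Proof. by rewrite !cont_onP; exact: continuous_subspaceW. Qed.

Lemma cont_on_continuous (U : topologicalType) (f : T -> U) :
  continuous f -> cont_on A f.
Proof. by move=> fc; apply/cont_onP/continuous_subspaceT. Qed.

Lemma cont_on_eq (U : topologicalType) (f g : T -> U) :
  (forall x, A x -> f x = g x) -> cont_on A f -> cont_on A g.
Proof.
move=> fg; rewrite !cont_onP; apply: subspace_eq_continuous => x.
by rewrite inE; exact: fg.
Qed.

Lemma cont_on_cst (U : topologicalType) (c : U) : cont_on A (fun=> c).
Proof. by move=> x _; exact: cvg_cst. Qed.

Lemma cont_on_id : cont_on A id.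
Proof. by move=> x _; exact: cvg_within. Qed.

Lemma cont_on_comp (U V : topologicalType) (B : set U) (g : U -> V)
    (f : T -> U) :
  cont_on B g -> cont_on A f -> (forall x, A x -> B (f x)) ->
  cont_on A (fun x => g (f x)).
Proof.
move=> gB fA AB x Ax; apply: cvg_comp (gB _ (AB _ Ax)).
move=> W /= WB; rewrite nbhs_simpl /=.
have := fA x Ax _ WB; rewrite /= !nbhs_simpl /= => h.
near=> y; have Ay : A y by near: y; exact: withinT.
by have := near h y; apply => //; exact: AB.
Unshelve. all: by end_near. Qed.

Lemma cont_onT_comp (U V : topologicalType) (g : U -> V) (f : T -> U) :
  continuous g -> cont_on A f -> cont_on A (fun x => g (f x)).
Proof. by move=> gc fA x Ax; exact: cvg_comp (fA x Ax) (gc _). Qed.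

Lemma cont_on_pair (U V : topologicalType) (f : T -> U) (g : T -> V) :
  cont_on A f -> cont_on A g -> cont_on A (fun x => (f x, g x)).
Proof. by move=> fA gA x Ax; apply: cvg_pair; [exact: fA|exact: gA]. Qed.

Lemma cont_on_fst (U V : topologicalType) (f : T -> U * V) :
  cont_on A f -> cont_on A (fun x => (f x).1).
Proof. by apply: cont_onT_comp => z; exact: cvg_fst. Qed.

Lemma cont_on_snd (U V : topologicalType) (f : T -> U * V) :
  cont_on A f -> cont_on A (fun x => (f x).2).
Proof. by apply: cont_onT_comp => z; exact: cvg_snd. Qed.

Section Normed.
Context {V : normedModType R}.
Implicit Types (f g : T -> V) (k : T -> R).

Lemma cont_onD f g : cont_on A f -> cont_on A g ->
  cont_on A (fun x => f x + g x).
Proof. by move=> fA gA x Ax; apply: cvgD; [exact: fA|exact: gA]. Qed.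

Lemma cont_onN f : cont_on A f -> cont_on A (fun x => - f x).
Proof. by move=> fA x Ax; apply: cvgN; exact: fA. Qed.

Lemma cont_onB f g : cont_on A f -> cont_on A g ->
  cont_on A (fun x => f x - g x).
Proof. by move=> fA gA; apply: cont_onD => //; exact: cont_onN. Qed.

Lemma cont_onZ k f : cont_on A k -> cont_on A f ->
  cont_on A (fun x => k x *: f x).
Proof. by move=> kA fA x Ax; apply: cvgZ; [exact: kA|exact: fA]. Qed.

Lemma cont_on_sum (I : Type) (r : seq I) (F : I -> T -> V) :
  (forall i, cont_on A (F i)) -> cont_on A (fun x => \sum_(i <- r) F i x).
Proof.
move=> FA; elim: r => [|i r IH].
  apply: (@cont_on_eq _ (fun=> 0)) => [x _|]; first by rewrite big_nil.
  exact: cont_on_cst.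
apply: (@cont_on_eq _ (fun x => F i x + \sum_(j <- r) F j x)) => [x _|].
  by rewrite big_cons.
exact: cont_onD.
Qed.
End Normed.

Implicit Types f g : T -> R.

Lemma cont_onM f g : cont_on A f -> cont_on A g ->
  cont_on A (fun x => f x * g x).
Proof. by move=> fA gA x Ax; apply: cvgM; [exact: fA|exact: gA]. Qed.

Lemma cont_onX f n : cont_on A f -> cont_on A (fun x => f x ^+ n).
Proof.
by move=> fA; apply: (cont_onT_comp (@exprn_continuous R n)).
Qed.

Lemma cont_onV f : (forall x, A x -> f x != 0) -> cont_on A f ->
  cont_on A (fun x => (f x)^-1).
Proof. by move=> f0 fA x Ax; apply: cvgV; [exact: f0|exact: fA]. Qed.

Lemma cont_on_min f g : cont_on A f -> cont_on A g ->
  cont_on A (fun x => Num.min (f x) (g x)).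
Proof.
by rewrite !cont_onP => fA gA x; apply: continuous_min; [exact: fA|exact: gA].
Qed.

Lemma cont_on_max f g : cont_on A f -> cont_on A g ->
  cont_on A (fun x => Num.max (f x) (g x)).
Proof.
by rewrite !cont_onP => fA gA x; apply: continuous_max; [exact: fA|exact: gA].
Qed.

Lemma cont_on_sqrt f : cont_on A f -> cont_on A (fun x => Num.sqrt (f x)).
Proof. by apply: cont_onT_comp; exact: sqrt_continuous. Qed.

Lemma cont_on_cos f : cont_on A f -> cont_on A (fun x => cos (f x)).
Proof. by apply: cont_onT_comp; exact: continuous_cos. Qed.

Lemma cont_on_sin f : cont_on A f -> cont_on A (fun x => sin (f x)).
Proof. by apply: cont_onT_comp; exact: continuous_sin. Qed.

Lemma cont_on_atan f : cont_on A f -> cont_on A (fun x => atan (f x)).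
Proof. by apply: cont_onT_comp; exact: continuous_atan. Qed.

Lemma cont_on_coord m n (f : T -> 'M[R]_(m, n)) i j :
  cont_on A f -> cont_on A (fun x => f x i j).
Proof.
by move=> fA x Ax; exact: cvg_comp (fA x Ax) (@coord_continuous R m n i j _).
Qed.

Lemma cont_on_row n (f : T -> 'rV[R]_n) :
  (forall j, cont_on A (fun x => f x 0 j)) -> cont_on A f.
Proof.
move=> fA; apply: (@cont_on_eq _ (fun x => \sum_j f x 0 j *: delta_mx 0 j)).
  by move=> x _; rewrite -row_sum_delta.
apply: cont_on_sum => j; apply: cont_onZ => //; exact: cont_on_cst.
Qed.
End ContOn.

(** * Coordinates in the plane and in space *)

Section Coordinates.
Context {R : realType}.
Implicit Types u v z w : 'rV[R]_2.

Lemma pt2E0 (a b : R) : pt2 a b 0 0 = a. Proof. by rewrite mxE. Qed.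

Lemma pt2E1 (a b : R) : pt2 a b 0 1 = b. Proof. by rewrite mxE. Qed.

Lemma eq_rV2 z w : z 0 0 = w 0 0 -> z 0 1 = w 0 1 -> z = w.
Proof.
move=> h0 h1; apply/rowP => -[[|[|//]] i].
  by rewrite (_ : Ordinal i = 0)//; exact: val_inj.
by rewrite (_ : Ordinal i = 1)//; exact: val_inj.
Qed.

Lemma eq_rV3 (x y : 'rV[R]_3) : x 0 0 = y 0 0 -> x 0 1 = y 0 1 -> x 0 2 = y 0 2 -> x = y.
Proof.
move=> h0 h1 h2; apply/rowP => -[[|[|[|//]]] i].
- by rewrite (_ : Ordinal i = 0)//; exact: val_inj.
- by rewrite (_ : Ordinal i = 1)//; exact: val_inj.
- by rewrite (_ : Ordinal i = 2)//; exact: val_inj.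
Qed.

Lemma pt2_eta z : pt2 (z 0 0) (z 0 1) = z.
Proof. by apply: eq_rV2; rewrite ?pt2E0 ?pt2E1. Qed.

Lemma sum2E (V : nmodType) (F : 'I_2 -> V) : \sum_j F j = F 0 + F 1.
Proof.
rewrite !big_ord_recl big_ord0 addr0; congr (F _ + F _); exact: val_inj.
Qed.

Lemma sum3E (V : nmodType) (F : 'I_3 -> V) : \sum_j F j = F 0 + F 1 + F 2.
Proof.
rewrite !big_ord_recl big_ord0 addr0 addrA.
by congr (F _ + F _ + F _); exact: val_inj.
Qed.

Lemma dot2E u v : dot u v = u 0 0 * v 0 0 + u 0 1 * v 0 1.
Proof. by rewrite /dot !mxE sum2E !mxE. Qed.

Lemma dot3E (x y : 'rV[R]_3) : dot x y = x 0 0 * y 0 0 + x 0 1 * y 0 1 + x 0 2 * y 0 2.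
Proof. by rewrite /dot !mxE sum3E !mxE. Qed.

Section DotGeneral.
Context {n : nat}.
Implicit Types (p q s : 'rV[R]_n).

Lemma dotE p q : dot p q = \sum_j p 0 j * q 0 j.
Proof. by rewrite /dot mxE; apply: eq_bigr => j _; rewrite mxE. Qed.

Lemma dotC p q : dot p q = dot q p.
Proof. by rewrite !dotE; apply: eq_bigr => j _; rewrite mulrC. Qed.

Lemma dotDl p q s : dot (p + q) s = dot p s + dot q s.
Proof. by rewrite /dot mulmxDl mxE. Qed.

Lemma dotZl (k : R) p q : dot (k *: p) q = k * dot p q.
Proof. by rewrite /dot -scalemxAl mxE. Qed.

Lemma dotNl p q : dot (- p) q = - dot p q.
Proof. by rewrite /dot mulNmx mxE. Qed.

Lemma dotDr p q s : dot s (p + q) = dot s p + dot s q.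
Proof. by rewrite dotC dotDl !(dotC s). Qed.

Lemma dotZr (k : R) p q : dot p (k *: q) = k * dot p q.
Proof. by rewrite dotC dotZl dotC. Qed.

Lemma dotNr p q : dot p (- q) = - dot p q.
Proof. by rewrite dotC dotNl dotC. Qed.

Lemma dot_ge0 p : 0 <= dot p p.
Proof. by rewrite dotE; apply: sumr_ge0 => j _; rewrite -expr2 sqr_ge0. Qed.

Lemma dot_eq0 p : (dot p p == 0) = (p == 0).
Proof.
apply/eqP/eqP => [|->]; last by rewrite /dot mul0mx mxE.
rewrite dotE => /eqP; rewrite psumr_eq0; last by move=> j _; rewrite -expr2 sqr_ge0.
move=> /allP h; apply/rowP => j; rewrite mxE.
by have := h j (mem_index_enum _); rewrite /= mulf_eq0 orbb => /eqP.
Qed.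

Lemma dot_gt0 p : (0 < dot p p) = (p != 0).
Proof. by rewrite lt0r dot_eq0 dot_ge0 andbT. Qed.


Lemma sphereN p : sphere R n p -> sphere R n (- p).
Proof. by rewrite /sphere /= dotNl dotNr opprK. Qed.

Lemma sphere_neq0 p : sphere R n p -> p != 0.
Proof. by rewrite /sphere /= -dot_eq0 => ->; rewrite oner_eq0. Qed.

Lemma sphere_ray p q (a b : R) : sphere R n p -> sphere R n q ->
  0 <= a -> 0 <= b -> a *: p = b *: q -> a != 0 -> p = q.
Proof.
move=> Sp Sq a0 b0 e an0.
have ab : a = b.
  have : dot (a *: p) (a *: p) = dot (b *: q) (b *: q) by rewrite e.
  rewrite !dotZl !dotZr Sp Sq !mulr1 -!expr2 => /eqP.
  by rewrite eqrXn2// => /eqP.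
by move/(congr1 (fun t => a^-1 *: t)): e; rewrite -ab !scalerA mulVf// !scale1r.
Qed.
End DotGeneral.

(** ** Complex multiplication in the plane *)

Definition cmul z w : 'rV[R]_2 :=
  pt2 (z 0 0 * w 0 0 - z 0 1 * w 0 1) (z 0 0 * w 0 1 + z 0 1 * w 0 0).

Definition cconj z : 'rV[R]_2 := pt2 (z 0 0) (- z 0 1).

Definition cis (t : R) : 'rV[R]_2 := pt2 (cos t) (sin t).

Definition coordE := (pt2E0, pt2E1, mxE).

Lemma cmulC : commutative cmul.
Proof. by move=> z w; apply: eq_rV2; rewrite /cmul !coordE; ring. Qed.

Lemma cmulA : associative cmul.
Proof. by move=> z w u; apply: eq_rV2; rewrite /cmul !coordE; ring. Qed.

Lemma cmulCA : left_commutative cmul.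
Proof. by move=> z w u; apply: eq_rV2; rewrite /cmul !coordE; ring. Qed.

Lemma cmulZr (k : R) z w : cmul z (k *: w) = k *: cmul z w.
Proof. by apply: eq_rV2; rewrite /cmul !coordE; ring. Qed.

Lemma cmulZl (k : R) z w : cmul (k *: z) w = k *: cmul z w.
Proof. by apply: eq_rV2; rewrite /cmul !coordE; ring. Qed.


Lemma cmulBr z w u : cmul z (w - u) = cmul z w - cmul z u.
Proof. by apply: eq_rV2; rewrite /cmul !coordE; ring. Qed.

Lemma cmul_cis0 z : cmul (cis 0) z = z.
Proof. by apply: eq_rV2; rewrite /cmul /cis !coordE cos0 sin0; ring. Qed.

Lemma cisD (s t : R) : cis (s + t) = cmul (cis s) (cis t).
Proof. by apply: eq_rV2; rewrite /cmul /cis !coordE ?cosD ?sinD; ring. Qed.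

Lemma cisN (t : R) : cis (- t) = cconj (cis t).
Proof. by apply: eq_rV2; rewrite /cconj /cis !coordE ?cosN ?sinN. Qed.

Lemma cmul_cisK (t : R) z : cmul (cis (- t)) (cmul (cis t) z) = z.
Proof. by rewrite cmulA -cisD addNr cmul_cis0. Qed.

Lemma cconjM z w : cconj (cmul z w) = cmul (cconj z) (cconj w).
Proof. by apply: eq_rV2; rewrite /cmul /cconj !coordE; ring. Qed.

Lemma cconjZ (k : R) z : cconj (k *: z) = k *: cconj z.
Proof. by apply: eq_rV2; rewrite /cconj !coordE; ring. Qed.

Lemma cconjK : involutive cconj.
Proof. by move=> z; apply: eq_rV2; rewrite /cconj !coordE ?opprK. Qed.

Lemma cmul_conj z w : cmul (cmul z (cconj w)) w = dot w w *: z.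
Proof. by apply: eq_rV2; rewrite /cmul /cconj dot2E !coordE; ring. Qed.

Lemma dot_cmul z w u : dot (cmul z w) (cmul z u) = dot z z * dot w u.
Proof. by rewrite /cmul !dot2E !coordE; ring. Qed.

Lemma dot_cis (t : R) : dot (cis t) (cis t) = 1.
Proof. by rewrite dot2E /cis !coordE -!expr2 cos2Dsin2. Qed.

Lemma dot_conj z : dot (cconj z) (cconj z) = dot z z.
Proof. by rewrite /cconj !dot2E !coordE; ring. Qed.

Lemma cmul_eq0 z w : (cmul z w == 0) = (z == 0) || (w == 0).
Proof. by rewrite -!dot_eq0 dot_cmul mulf_eq0. Qed.

Lemma cconj_eq0 z : (cconj z == 0) = (z == 0).
Proof. by rewrite -!dot_eq0 dot_conj. Qed.

Lemma cis_neq0 (t : R) : cis t != 0.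
Proof. by rewrite -dot_eq0 dot_cis oner_eq0. Qed.

(** ** Continuity of the operations *)

Context {T : topologicalType} (A : set T).

Lemma cont_on_dot n (f g : T -> 'rV[R]_n) : cont_on A f -> cont_on A g ->
  cont_on A (fun x => dot (f x) (g x)).
Proof.
move=> fA gA; apply: (@cont_on_eq _ _ _ (fun x => \sum_j f x 0 j * g x 0 j)).
  by move=> x _; rewrite dotE.
by apply: cont_on_sum => j; apply: cont_onM; exact: cont_on_coord.
Qed.

Lemma cont_on_pt2 (f g : T -> R) : cont_on A f -> cont_on A g ->
  cont_on A (fun x => pt2 (f x) (g x)).
Proof.
move=> fA gA; apply: cont_on_row => -[[|[|//]] i].
  by apply: (cont_on_eq _ fA) => x _; rewrite mxE.
by apply: (cont_on_eq _ gA) => x _; rewrite mxE.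
Qed.

Lemma cont_on_cmul (f g : T -> 'rV[R]_2) : cont_on A f -> cont_on A g ->
  cont_on A (fun x => cmul (f x) (g x)).
Proof.
move=> fA gA; apply: cont_on_pt2.
  by apply: cont_onB; apply: cont_onM; exact: cont_on_coord.
by apply: cont_onD; apply: cont_onM; exact: cont_on_coord.
Qed.

Lemma cont_on_conj (f : T -> 'rV[R]_2) : cont_on A f ->
  cont_on A (fun x => cconj (f x)).
Proof.
by move=> fA; apply: cont_on_pt2; [|apply: cont_onN]; exact: cont_on_coord.
Qed.

Lemma cont_on_cis (f : T -> R) : cont_on A f ->
  cont_on A (fun x => cis (f x)).
Proof.
by move=> fA; apply: cont_on_pt2; [exact: cont_on_cos|exact: cont_on_sin].
Qed.

Lemma cont_on_mulmx m n (B : 'M[R]_(m, n)) (f : T -> 'rV[R]_m) :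
  cont_on A f -> cont_on A (fun x => f x *m B).
Proof.
move=> fA; apply: cont_on_row => j.
apply: (@cont_on_eq _ _ _ (fun x => \sum_i f x 0 i * B i j)).
  by move=> x _; rewrite mxE.
by apply: cont_on_sum => i; apply: cont_onM; [exact: cont_on_coord|exact: cont_on_cst].
Qed.
End Coordinates.

(** Reduces the continuity of an expression to that of its unknown functions
    and to the nonvanishing of its denominators. *)
Ltac cts := repeat (lazymatch goal with
  | |- cont_on _ (fun=> ?c) => exact: cont_on_cst
  | |- cont_on _ (fun x => x) => exact: cont_on_id
  | |- cont_on _ fst => apply: (cont_on_fst (f := fun p => p))
  | |- cont_on _ snd => apply: (cont_on_snd (f := fun p => p))
  | |- cont_on _ -%R => apply: (cont_onN (f := fun x => x))
  | |- cont_on _ id => exact: cont_on_id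
  | |- cont_on _ (fun x => _ + _) => apply: cont_onD
  | |- cont_on _ (fun x => - _) => apply: cont_onN
  | |- cont_on _ (fun x => _ *: _) => apply: cont_onZ
  | |- cont_on _ (fun x => _ * _) => apply: cont_onM
  | |- cont_on _ (fun x => _ ^+ _) => apply: cont_onX
  | |- cont_on _ (fun x => _^-1) => apply: cont_onV
  | |- cont_on _ (fun x => (_, _)) => apply: cont_on_pair
  | |- cont_on _ (fun x => fst _) => apply: cont_on_fst
  | |- cont_on _ (fun x => snd _) => apply: cont_on_snd
  | |- cont_on _ (fun x => fun_of_matrix _ _ _) => apply: cont_on_coord
  | |- cont_on _ (fun x => _ *m _) => apply: cont_on_mulmx
  | |- cont_on _ (fun x => cos _) => apply: cont_on_cos
  | |- cont_on _ (fun x => sin _) => apply: cont_on_sin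
  | |- cont_on _ (fun x => atan _) => apply: cont_on_atan
  | |- cont_on _ (fun x => Num.sqrt _) => apply: cont_on_sqrt
  | |- cont_on _ (fun x => Order.min _ _) => apply: cont_on_min
  | |- cont_on _ (fun x => Order.max _ _) => apply: cont_on_max
  | |- cont_on _ (fun x => dot _ _) => apply: cont_on_dot
  | |- cont_on _ (fun x => pt2 _ _) => apply: cont_on_pt2
  | |- cont_on _ (fun x => cmul _ _) => apply: cont_on_cmul
  | |- cont_on _ (fun x => cconj _) => apply: cont_on_conj
  | |- cont_on _ (fun x => cis _) => apply: cont_on_cis
  end).


(** * Winding of loops in the punctured plane *)

Definition cylinder (R : realType) n : set (R * 'rV[R]_n) :=
  `[0, 1]%classic `*` sphere R n.
Arguments cylinder R n : clear implicits.

Definition homotopic_in (R : realType) n (B : set 'rV[R]_n)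
    (f g : 'rV[R]_n -> 'rV[R]_n) := exists H : R * 'rV[R]_n -> 'rV[R]_n,
  [/\ cont_on (cylinder R n) H,
      forall (t : R) u, 0 <= t <= 1 -> sphere R n u -> B (H (t, u)),
      forall u, sphere R n u -> H (0, u) = f u &
      forall u, sphere R n u -> H (1, u) = g u].

Section Winding.
Context {R : realType}.
Notation V2 := 'rV[R]_2.
Notation S1 := (sphere R 2).
Implicit Types (f g h F : V2 -> V2) (u z w : V2).

Notation cyl := (cylinder R 2).

Definition loop f := cont_on S1 f /\ forall u, S1 u -> f u != 0.

(** The quotient of [f] by [g] has a continuous argument [th]: the two loops turn
    the same number of times around the origin.  No integer is attached to a
    loop, as only the comparison of loops matters. *)
Definition same_winding f g := exists2 th : V2 -> R, cont_on S1 th &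
  forall u, S1 u -> exists2 r : R, 0 < r & f u = r *: cmul (cis (th u)) (g u).

Notation homotopic := (homotopic_in [set z | z != 0]).

Lemma mx_norm_le_dot n (p : 'rV[R]_n) : `|p| ^+ 2 <= dot p p.
Proof.
have [->|p0] := eqVneq `|p| 0; first by rewrite expr0n /= dot_ge0.
have := @mx_norm_neq0 _ _ _ p p0; rewrite -[mx_norm p]/(`|p|) => -[[i j] /= ->].
rewrite -normrX ger0_norm ?sqr_ge0// dotE (bigD1 j)//= (ord1 i) expr2.
by rewrite lerDl; apply: sumr_ge0 => k _; rewrite -expr2 sqr_ge0.
Qed.

Lemma cont_on_norm (T : topologicalType) (A : set T) (V : normedModType R) (f : T -> V) :
  cont_on A f -> cont_on A (fun x => `|f x|).
Proof. by move=> fc x Ax; apply: cvg_norm; exact: fc. Qed.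

Lemma closed_preimage_cont (T U : topologicalType) (f : T -> U) (D : set U) :
  cont_on setT f -> closed D -> closed (f @^-1` D).
Proof.
move=> fc Dc; have {}fc : continuous f by exact/continuous_subspace_setT/cont_onP.
by apply: (@preimage_closed _ _ f D) => [x _|//]; exact: fc.
Qed.

Lemma closed_sphere n : closed (sphere R n).
Proof.
apply: (@closed_preimage_cont _ _ (fun p : 'rV[R]_n => dot p p) [set 1]).
  by cts.
exact: closed_eq.
Qed.

Lemma compact_sphere n : compact (sphere R n).
Proof.
apply: bounded_closed_compact.
  exists 1; split => // M M1 /= p Sp; apply: le_trans (ltW M1).
  rewrite -(@ler_pXn2r _ 2)// ?nnegrE// expr1n.
  by apply: le_trans (mx_norm_le_dot p) _; rewrite (Sp : dot p p = 1).
exact: closed_sphere.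
Qed.

Lemma same_winding_refl f : same_winding f f.
Proof.
exists (fun=> 0); first by cts.
by move=> u _; exists 1; rewrite // scale1r cmul_cis0.
Qed.

Lemma same_winding_sym f g : same_winding f g -> same_winding g f.
Proof.
move=> [th thc fg]; exists (fun u => - th u); first by cts.
move=> u /fg [r r0 ->]; exists r^-1; first by rewrite invr_gt0.
by rewrite cmulZr scalerA mulVf ?gt_eqF// scale1r cmul_cisK.
Qed.

Lemma same_winding_trans f g h :
  same_winding f g -> same_winding g h -> same_winding f h.
Proof.
move=> [th thc fg] [ph phc gh]; exists (fun u => th u + ph u); first by cts.
move=> u Su; have [r r0 ->] := fg u Su; have [s s0 ->] := gh u Su.
exists (r * s); first exact: mulr_gt0.
by rewrite cmulZr scalerA cisD cmulA.
Qed.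

Lemma same_winding_eq f f' g g' : (forall u, S1 u -> f u = f' u) ->
  (forall u, S1 u -> g u = g' u) -> same_winding f g -> same_winding f' g'.
Proof.
move=> ff gg [th thc fg]; exists th => // u Su; have [r r0 e] := fg u Su.
by exists r; rewrite // -ff// -gg.
Qed.

Lemma same_winding_mul f f' g g' : same_winding f g -> same_winding f' g' ->
  same_winding (fun u => cmul (f u) (f' u)) (fun u => cmul (g u) (g' u)).
Proof.
move=> [th thc fg] [ph phc fg']; exists (fun u => th u + ph u); first by cts.
move=> u Su; have [r r0 ->] := fg u Su; have [s s0 ->] := fg' u Su.
exists (r * s); first exact: mulr_gt0.
rewrite cmulZr cmulZl scalerA cisD -!cmulA (mulrC s); congr (_ *: cmul _ _).
by rewrite cmulCA.
Qed.

Lemma same_winding_conj f g : same_winding f g ->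
  same_winding (fun u => cconj (f u)) (fun u => cconj (g u)).
Proof.
move=> [th thc fg]; exists (fun u => - th u); first by cts.
move=> u /fg [r r0 ->]; exists r => //.
by rewrite cconjZ cconjM cisN.
Qed.

Lemma same_winding_scale (k : V2 -> R) f :
  (forall u, S1 u -> 0 < k u) -> same_winding (fun u => k u *: f u) f.
Proof.
move=> k0; exists (fun=> 0); first by cts.
by move=> u Su; exists (k u); [exact: k0|rewrite cmul_cis0].
Qed.

(** In the right half-plane, the arctangent of the slope is a continuous
    choice of the argument. *)
Lemma same_winding_near f g : loop f -> loop g ->
  (forall u, S1 u -> 0 < dot (f u) (g u)) -> same_winding f g.
Proof.
move=> [fc f0] [gc g0] fg.
pose q u := cmul (f u) (cconj (g u)).
have q00 u : q u 0 0 = dot (f u) (g u).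
  by rewrite /q /cmul /cconj dot2E !coordE; ring.
have qc : cont_on S1 q by rewrite /q; cts.
exists (fun u => atan (q u 0 1 / q u 0 0)).
  by cts => // u Su; rewrite q00 gt_eqF ?fg.
move=> u Su; set s := q u 0 1 / q u 0 0.
have q0 : 0 < q u 0 0 by rewrite q00 fg.
have r0 : 0 < Num.sqrt (1 + s ^+ 2) by rewrite sqrtr_gt0 ltr_pwDl// sqr_ge0.
have qE : q u = (q u 0 0 * Num.sqrt (1 + s ^+ 2)) *: cis (atan s).
  have e : tan (atan s) = s by exact: atanK.
  have c : cos (atan s) = (Num.sqrt (1 + s ^+ 2))^-1 by exact: cos_atan.
  have e1 : sin (atan s) = s * cos (atan s).
    have : sin (atan s) = tan (atan s) * cos (atan s).
      by rewrite /tan divfK// c invr_eq0 gt_eqF.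
    by rewrite e.
  have sq : q u 0 1 = s * q u 0 0 by rewrite /s divfK// gt_eqF.
  have sn : Num.sqrt (1 + s ^+ 2) != 0 by rewrite gt_eqF.
  move: (q u) sq => z sq; apply: eq_rV2; rewrite [RHS]mxE /cis ?pt2E0 ?pt2E1 ?sq ?e1 c.
    by field.
  by field.
have gg : 0 < dot (g u) (g u) by rewrite dot_gt0 g0.
exists (q u 0 0 * Num.sqrt (1 + s ^+ 2) / dot (g u) (g u)).
  by rewrite divr_gt0// mulr_gt0.
apply: (scalerI (lt0r_neq0 gg)); rewrite -cmul_conj -/(q u) {1}qE cmulZl.
by rewrite scalerA [_ * (_ / _)]mulrC divfK// gt_eqF.
Qed.

Lemma cylinder_slice (H : R * V2 -> V2) (t : R) : 0 <= t <= 1 ->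
  cont_on cyl H -> cont_on S1 (fun u => H (t, u)).
Proof.
move=> t01 Hc; apply: (cont_on_comp (f:=fun u => (t, u)) Hc); first by cts.
by move=> u Su; split => //=; rewrite in_itv.
Qed.

(** Nearby times of a homotopy have the same winding by compactness of the
    circle; a two-valued locally constant function on the segment contradicts
    the intermediate value theorem. *)
Lemma homotopic_same_winding f g : homotopic f g -> same_winding f g.
Proof.
move=> [H [Hc H0 Hf Hg]].
have Hl t : 0 <= t <= 1 -> loop (fun u => H (t, u)).
  move=> t01; split; first exact: cylinder_slice.
  by move=> u Su; exact: H0.
suff: same_winding (fun u => H (0, u)) (fun u => H (1, u)).
  exact: same_winding_eq.
pose E t := same_winding (fun u => H (0, u)) (fun u => H (t, u)).
have loc (t0 : R) : 0 <= t0 <= 1 -> \forall t \near t0, 0 <= t <= 1 ->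
    same_winding (fun u => H (t0, u)) (fun u => H (t, u)).
  move=> t01; have /compact_near_coveringP cS := compact_sphere (n := 2).
  have := cS R (nbhs t0)
    (fun t u => 0 <= t <= 1 -> S1 u -> 0 < dot (H (t0, u)) (H (t, u))) _ _.
  have : forall u, S1 u -> \forall u' \near u & t \near t0,
      0 <= t <= 1 -> S1 u' -> 0 < dot (H (t0, u')) (H (t, u')).
    move=> u Su.
    have dc : cont_on cyl
        (fun p : R * V2 => dot (H (t0, p.2)) (H p)).
      cts => //; apply: (cont_on_comp (f:=fun p => (t0, p.2)) Hc); first by cts.
      by move=> [s w] [? ?]; split => //=; rewrite in_itv.
    have pp : 0 < dot (H (t0, u)) (H (t0, u)) by rewrite dot_gt0 H0.
    have tS : cyl (t0, u) by split => //=; rewrite in_itv.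
    have := dc (t0, u) tS _ (lt_nbhsr pp); rewrite /= nbhs_simpl /=.
    rewrite /within /= => -[[U W] /= [Ut Wu] UW].
    exists (W, U) => //= -[w s] /= [Ww Us] s01 Sw.
    by apply: (UW (s, w)); [split|split => //=; rewrite in_itv].
  move=> h /(_ _ h); apply: filterS => t ht t1.
  apply: same_winding_near; [exact: Hl|exact: Hl|].
  by move=> u Su; exact: ht.
have [//|nE1] := pselect (E 1).
pose ch (t : R) : R := if `[< E t >] then 0 else 1.
have chc : {within `[0, 1], continuous ch}.
  apply/subspace_continuousP => t0 t01 W /= W0; have t01' : 0 <= t0 <= 1.
    by move: t01; rewrite /= in_itv.
  rewrite nbhs_simpl /= /within /=; have := loc t0 t01'.
  apply: filterS => t ht t1.
  have {}ht : same_winding (fun u => H (t0, u)) (fun u => H (t, u)).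
    by apply: ht; move: t1; rewrite in_itv.
  change (W (ch t)); have -> : ch t = ch t0; last exact: nbhs_singleton.
  rewrite /ch; congr (if _ then _ else _); apply: asbool_equiv_eq; split => e.
    exact: same_winding_trans e (same_winding_sym ht).
  exact: same_winding_trans e ht.
have ch0 : ch 0 = 0 by rewrite /ch asboolT//; exact: same_winding_refl.
have ch1 : ch 1 = 1 by rewrite /ch asboolF.
have [] := @IVT R ch 0 1 2^-1 ler01 chc.
  rewrite ch0 ch1 minEle maxEle ler01; apply/andP; split; lra.
by move=> c _; rewrite /ch; case: ifP => _; lra.
Qed.

(** The homotopy turns [f] and [g] by complementary fractions of the argument of
    the quotient, so that at each time both have the same direction and their
    mean does not vanish. *)
Lemma same_winding_homotopic f g : loop f -> loop g -> same_winding f g ->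
  homotopic f g.
Proof.
move=> [fc f0] [gc g0] [th thc fg].
exists (fun p : R * V2 => (1 - p.1) *: cmul (cis (- (p.1 * th p.2))) (f p.2) +
  p.1 *: cmul (cis ((1 - p.1) * th p.2)) (g p.2)); split.
- have sndS (p : R * V2) : cyl p -> S1 p.2 by case.
  by cts; [apply: (cont_on_comp (f:=snd) thc) | apply: (cont_on_comp (f:=snd) fc)
    | apply: (cont_on_comp (f:=snd) thc) | apply: (cont_on_comp (f:=snd) gc)] => //; cts.
- move=> t u /andP[t0 t1] Su /=; have [r r0 ->] := fg u Su.
  rewrite cmulZr cmulA -cisD scalerA.
  rewrite (_ : - (t * th u) + th u = (1 - t) * th u); last by ring.
  rewrite -scalerDl scaler_eq0 cmul_eq0 (negbTE (cis_neq0 _)) (negbTE (g0 _ Su)).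
  by rewrite !orbF gt_eqF//; nra.
- by move=> u Su /=; rewrite subr0 mul0r oppr0 cmul_cis0 scale1r scale0r addr0.
- move=> u Su /=; have [r r0 ->] := fg u Su.
  by rewrite subrr mul0r cmul_cis0 scale0r scale1r add0r.
Qed.

Lemma homotopic_comp (B B' : set V2) f g F : cont_on B F ->
  (forall z, B z -> B' (F z)) -> homotopic_in B f g ->
  homotopic_in B' (fun u => F (f u)) (fun u => F (g u)).
Proof.
move=> Fc FB [H [Hc HB H0 H1]]; exists (fun p => F (H p)); split.
- by apply: (cont_on_comp (f:=H) Fc) => // -[t u] [/=]; rewrite in_itv; exact: HB.
- by move=> t u t01 Su; apply: FB; exact: HB.
- by move=> u Su; rewrite H0.
- by move=> u Su; rewrite H1.
Qed.

Lemma circle_cis u : S1 u -> exists2 t : R, -pi <= t <= pi & u = cis t.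
Proof.
rewrite /sphere /= dot2E => Su.
have u1 : -1 <= u 0 0 <= 1 by apply/andP; split; nra.
have ac := acosK u1; have pi1 : 0 <= acos (u 0 0) <= pi.
  by rewrite acos_ge0// acos_lepi.
have sE : u 0 1 ^+ 2 = sin (acos (u 0 0)) ^+ 2.
  by have := cos2Dsin2 (acos (u 0 0)); rewrite ac; nra.
move: sE => /eqP; rewrite eqf_sqr => /orP[] /eqP e.
  exists (acos (u 0 0)); first by apply/andP; split; case/andP: pi1 => ? ?; lra.
  by apply: eq_rV2; rewrite /cis !coordE ?e.
exists (- acos (u 0 0)); first by apply/andP; split; case/andP: pi1 => ? ?; lra.
by apply: eq_rV2; rewrite /cis !coordE ?cosN ?sinN ?e.
Qed.

Lemma cis_circle (t : R) : S1 (cis t).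
Proof. exact: dot_cis. Qed.

(** An argument on the whole circle would take the same value at two opposite
    points, by the intermediate value theorem. *)
Lemma winding_id_neq_cst (c : V2) : c != 0 -> ~ same_winding id (fun=> c).
Proof.
move=> c0 [th thc h].
pose k (t : R) := th (cis (t + pi)) - th (cis t).
have kc : {within `[0, pi], continuous k}.
  apply/cont_onP; rewrite /k; cts;
    (apply: (cont_on_comp (f:=fun t => cis _) thc); [by cts|by move=> *; exact: cis_circle]).
have kpi : k pi = - k 0.
  rewrite /k add0r opprB; congr (th _ - _).
  by rewrite /cis cosD sinD sinpi cospi cos0 sin0; congr pt2; ring.
have [] := @IVT R k 0 pi 0 (pi_ge0 _) kc.
  rewrite kpi minEle maxEle; case: ifPn => ?; apply/andP; split; lra.
move=> t _ /eqP; rewrite subr_eq0 => /eqP e.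
have [r r0 e1] := h _ (cis_circle (t + pi)).
have [s s0 e2] := h _ (cis_circle t).
rewrite e in e1.
have : dot (cis (t + pi)) (cis t) = - 1.
  rewrite dot2E /cis !coordE cosD sinD sinpi cospi.
  by transitivity (- (cos t ^+ 2 + sin t ^+ 2)); [ring|rewrite cos2Dsin2].
rewrite {1}e1 {2}e2 dotZl dotZr dot_cmul dot_cis mul1r => e3.
have : 0 < r * (s * dot c c) by rewrite !mulr_gt0// dot_gt0.
by rewrite e3; lra.
Qed.

Lemma segment_same_sign (f : R -> R) (a b : R) : a <= b ->
  cont_on `[a, b]%classic f -> (forall t, a <= t <= b -> f t != 0) ->
  0 < f a * f b.
Proof.
move=> ab /cont_onP fc f0; rewrite ltNge; apply/negP => neg.
have [] := @IVT R f a b 0 ab fc.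
  by rewrite minEle maxEle; case: ifPn => ?; apply/andP; split; nra.
by move=> c; rewrite in_itv /= => /f0/eqP.
Qed.

(** If [f] winds like its conjugate, then the square of [f] has a continuous
    argument; half of it is an argument of [f] up to a sign, which is constant
    since the circle is connected. *)
Lemma winding_conj_cst f : loop f -> same_winding f (fun u => cconj (f u)) ->
  exists2 c, c != 0 & same_winding f (fun=> c).
Proof.
move=> [fc f0] [th thc h].
pose q u := cmul (cis (- (th u / 2))) (f u).
have qc : cont_on S1 q by rewrite /q; cts.
have fq u : f u = cmul (cis (th u / 2)) (q u).
  by rewrite /q cmulA -cisD subrr cmul_cis0.
have q1 u : S1 u -> q u 0 1 = 0.
  move=> Su; have [r r0 e] := h u Su.
  have e1 : q u = r *: cconj (q u).
    rewrite {1}/q e cmulZr cmulA -cisD /q cconjM cisN cconjK.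
    by congr (_ *: cmul (cis _) _); field.
  move: (q u) e1 => z /(congr1 (fun z : V2 => z 0 1)); rewrite mxE pt2E1 => e1.
  have /eqP : (1 + r) * z 0 1 = 0 by rewrite mulrDl {1}e1; ring.
  by rewrite mulf_eq0 => /orP[/eqP ?|/eqP //]; lra.
have q0 u : S1 u -> q u 0 0 != 0.
  move=> Su; apply/eqP => e; have /eqP := f0 u Su; apply.
  have -> : f u = cmul (cis (th u / 2)) (q u) by [].
  suff -> : q u = 0 by apply/eqP; rewrite cmul_eq0 eqxx orbT.
  by apply: eq_rV2; rewrite [RHS]mxE; [exact: e|exact: q1].
have sgn u : S1 u -> 0 < q (cis (- pi)) 0 0 * q u 0 0.
  move=> /circle_cis [t /andP[t1 t2] ->].
  apply: (@segment_same_sign (fun s => q (cis s) 0 0)) => //.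
    cts; apply: (cont_on_comp (f:=fun t => cis t) qc); first by cts.
    by move=> *; exact: cis_circle.
  by move=> s _ /=; apply: (q0 (cis s)); exact: cis_circle.
have := q0 _ (cis_circle (- pi)); set k := q (cis (- pi)) 0 0 => k0.
exists (pt2 k 0).
  apply/eqP => /(congr1 (fun z : V2 => z 0 0)); rewrite pt2E0 [RHS]mxE => /eqP.
  exact/negP.
exists (fun u => th u / 2); first by cts.
move=> u Su; exists (q u 0 0 / k).
  rewrite (_ : _ / _ = k * q u 0 0 * (k ^-1) ^+ 2); last by field.
  by rewrite mulr_gt0 ?sgn// exprn_even_gt0//= invr_eq0.
rewrite {1}fq -cmulZr; congr cmul; move: (q u) (q1 u Su) => z z1.
by apply: eq_rV2; rewrite [RHS]mxE ?pt2E0 ?pt2E1 ?z1; field.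
Qed.
End Winding.

(** * Orientation of plane homeomorphisms *)

Section Planar.
Context {R : realType}.
Notation V2 := 'rV[R]_2.
Notation S1 := (sphere R 2).
Notation cyl := (cylinder R 2).
Notation homotopic := (homotopic_in [set z | z != 0]).
Implicit Types (u z w : V2).

(** Euclidean balls, whereas the norm of row vectors is the supremum norm. *)
Definition bdisc (e : R) : set V2 := [set z | dot z z <= e ^+ 2].

Lemma nbhs0_bdisc (P : set V2) : nbhs (0 : V2) P ->
  exists2 e : R, 0 < e <= 1 & bdisc e `<=` P.
Proof.
move=> /nbhs_ballP[d /= d0 dP]; pose e := Num.min (d / 2) 1.
have e0 : 0 < e by rewrite lt_min divr_gt0//= ltr01.
exists e; first by rewrite e0 ge_min lexx orbT.
move=> z ze; apply: dP; rewrite -ball_normE /= sub0r normrN.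
have ze' : `|z| <= e.
  rewrite -(@ler_pXn2r _ 2)// ?nnegrE ?normr_ge0 ?(ltW e0)//.
  exact: le_trans (mx_norm_le_dot z) ze.
apply: le_lt_trans ze' _.
by rewrite gt_min; apply/orP; left; lra.
Qed.

Lemma bdiscZ (e : R) u : 0 <= e -> S1 u -> bdisc e (e *: u).
Proof.
by move=> e0 Su; rewrite /bdisc /= dotZl dotZr Su mulr1 expr2.
Qed.

Lemma bdisc_le (e d : R) : 0 <= e <= d -> bdisc e `<=` bdisc d.
Proof.
move=> /andP[e0 ed] z /le_trans; apply; rewrite ler_pXn2r ?nnegrE//.
exact: le_trans e0 ed.
Qed.

Lemma disc_bdisc : bdisc 1 = @disc R.
Proof. by rewrite /bdisc /disc expr1n. Qed.

Lemma bdisc_convex (e : R) z w (t : R) : bdisc e z -> bdisc e w ->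
  0 <= t <= 1 -> bdisc e ((1 - t) *: z + t *: w).
Proof.
rewrite /bdisc /= !dot2E => zz ww /andP[t0 t1].
rewrite !mxE.
have h (a b : R) : ((1 - t) * a + t * b) * ((1 - t) * a + t * b) <=
  (1 - t) * (a * a) + t * (b * b).
  rewrite -subr_ge0 (_ : _ - _ = t * (1 - t) * (a - b) ^+ 2); last by ring.
  by rewrite mulr_ge0 ?sqr_ge0// mulr_ge0// subr_ge0.
have := lerD (h (z 0 0) (w 0 0)) (h (z 0 1) (w 0 1)).
move=> /le_trans; apply.
have h1 := ler_wpM2l t0 ww.
have h2 : (1 - t) * (z 0 0 * z 0 0 + z 0 1 * z 0 1) <= (1 - t) * e ^+ 2.
  by apply: ler_wpM2l => //; rewrite subr_ge0.
by lra.
Qed.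

Lemma same_winding_cst (c d : V2) : c != 0 -> d != 0 ->
  same_winding (fun=> c) (fun=> d).
Proof.
have polar (a : V2) : a != 0 -> exists t : R, a = Num.sqrt (dot a a) *: cis t.
  move=> a0; have s0 : 0 < Num.sqrt (dot a a) by rewrite sqrtr_gt0 dot_gt0.
  have ss : dot a a = Num.sqrt (dot a a) ^+ 2 by rewrite sqr_sqrtr ?dot_ge0.
  move: s0 ss; move: (Num.sqrt _) => s s0 ss.
  have [|t _ e] := @circle_cis R (s^-1 *: a).
    by rewrite /sphere /= dotZl dotZr ss; field; rewrite gt_eqF.
  by exists t; rewrite -e scalerA divff ?gt_eqF// scale1r.
move=> c0 d0; have [s cE] := polar c c0; have [t dE] := polar d d0.
exists (fun=> s - t); first by cts.
move=> u _; exists (Num.sqrt (dot c c) / Num.sqrt (dot d d)).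
  by rewrite divr_gt0// sqrtr_gt0 dot_gt0.
rewrite {1}cE {3}dE cmulZr scalerA divfK ?gt_eqF// ?sqrtr_gt0 ?dot_gt0//.
by rewrite -cisD subrK.
Qed.

(** The antipodal map of the sphere in stereographic coordinates: it is
    z |-> - 1 / conj z, so that it reverses the orientation. *)
Definition anti_inversion z : V2 := - (dot z z)^-1 *: z.

Lemma anti_inversionB z c : z != 0 -> c != 0 ->
  anti_inversion z - anti_inversion c =
  (dot z z * dot c c)^-1 *: cmul (cmul z c) (cconj (z - c)).
Proof.
rewrite -!dot_gt0 => z0 c0.
have zn : dot z z != 0 by rewrite gt_eqF.
have cn : dot c c != 0 by rewrite gt_eqF.
apply: (scalerI (_ : dot z z * dot c c != 0)); first by rewrite mulf_neq0.
rewrite scalerA divff ?mulf_neq0// scale1r /anti_inversion scalerBr !scalerA.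
have -> : dot z z * dot c c * - (dot z z)^-1 = - dot c c by field.
have -> : dot z z * dot c c * - (dot c c)^-1 = - dot z z by field.
rewrite !dot2E; apply: eq_rV2; rewrite /cmul /cconj !coordE; ring.
Qed.

(** The homeomorphism [G] of the plane conjugates the orientation reversing map
    [anti_inversion] to a map sending the parametrized disc [Phi] into
    [Phi'] by the change of parameters [tau].  The parametrizations have the same
    orientation, so [tau] should reverse the orientation; being deformable to the
    rotation [kap], it does not.  Orientations are read on the loops [F], [F'],
    the images of the circle seen from the image of its center. *)
Section NoReflection.
Variables (G Gi Phi Phi' tau : V2 -> V2) (kap : V2) (e0 : R).
Hypotheses (Gc : continuous G) (Gic : continuous Gi).
Hypotheses (GK : cancel G Gi) (GiK : cancel Gi G).
Hypotheses (Phic : cont_on (@disc R) Phi) (Phic' : cont_on (@disc R) Phi').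
Hypothesis Phi_inj : forall z w, disc z -> disc w -> Phi z = Phi w -> z = w.
Hypothesis Phi_inj' : forall z w, disc z -> disc w -> Phi' z = Phi' w -> z = w.
Hypothesis PhiW : same_winding (fun u => Phi u - Phi 0) cconj.
Hypothesis PhiW' : same_winding (fun u => Phi' u - Phi' 0) cconj.
Hypotheses (GPhi0 : G (Phi 0) != 0) (kap1 : S1 kap) (e01 : 0 < e0 <= 1).
Hypothesis tauc : cont_on (bdisc e0) tau.
Hypothesis tau0 : tau 0 = 0.
Hypothesis tau_disc : forall z, bdisc e0 z -> disc (tau z).
Hypothesis tau_kap : forall z (t : R), bdisc e0 z -> z != 0 -> 0 <= t <= 1 ->
  (1 - t) *: tau z + t *: cmul kap z != 0.
Hypothesis tau_anti : forall z, bdisc e0 z ->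
  G (Phi' (tau z)) = anti_inversion (G (Phi z)).

Let disc0 : @disc R 0.
Proof. by rewrite /disc /= /dot mul0mx mxE ler01. Qed.

Let S1disc u : S1 u -> disc u.
Proof. by rewrite /sphere /disc /= => ->. Qed.

Let D : set V2 := [set z | disc z /\ z != 0].

Let F u := G (Phi u) - G (Phi 0).
Let F' u := G (Phi' u) - G (Phi' 0).

Let Fc : cont_on D F.
Proof.
rewrite /F; cts; apply: (cont_onT_comp (f:=Phi) Gc).
by apply: cont_onW Phic => z [].
Qed.

Let Fc' : cont_on D F'.
Proof.
rewrite /F'; cts; apply: (cont_onT_comp (f:=Phi') Gc).
by apply: cont_onW Phic' => z [].
Qed.

Let F0 z : D z -> F z != 0.
Proof.
move=> [dz /eqP z0]; rewrite subr_eq0; apply/eqP => /(can_inj GK) h.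
exact/z0/Phi_inj.
Qed.

Let F0' z : D z -> F' z != 0.
Proof.
move=> [dz /eqP z0]; rewrite subr_eq0; apply/eqP => /(can_inj GK) h.
exact/z0/Phi_inj'.
Qed.

Let sndS (p : R * V2) : cyl p -> S1 p.2. Proof. by case. Qed.

Let in01 (p : R * V2) : cyl p -> 0 <= p.1 <= 1.
Proof. by case; rewrite /= in_itv. Qed.

(* [Phi] and [Phi'] give homotopic circles around their centers, and the center
   can be moved along the segment from [Phi' 0] to [Phi 0] *)
Let path_winding : same_winding F' F.
Proof.
pose P u := Phi u - Phi 0; pose P' u := Phi' u - Phi' 0.
have Pc : cont_on S1 P.
  by rewrite /P; cts; apply: cont_onW Phic => u /S1disc.
have Pc' : cont_on S1 P'.
  by rewrite /P'; cts; apply: cont_onW Phic' => u /S1disc.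
have P0 u : S1 u -> P u != 0.
  move=> Su; rewrite subr_eq0; apply/eqP => /(Phi_inj (S1disc Su) disc0) u0.
  by have := sphere_neq0 Su; rewrite u0 eqxx.
have P0' u : S1 u -> P' u != 0.
  move=> Su; rewrite subr_eq0; apply/eqP => /(Phi_inj' (S1disc Su) disc0) u0.
  by have := sphere_neq0 Su; rewrite u0 eqxx.
apply: (@same_winding_trans _ _ (fun u => G (P' u + Phi 0) - G (Phi 0))).
  apply: homotopic_same_winding.
  exists (fun p => G (Phi' 0 + p.1 *: (Phi 0 - Phi' 0) + P' p.2) -
                   G (Phi' 0 + p.1 *: (Phi 0 - Phi' 0))); split.
  - cts.
      refine (cont_onT_comp Gc _); cts.
      by apply: (cont_on_comp (f:=snd) Pc') => //; cts.
    by refine (cont_onT_comp Gc _); cts.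
  - move=> t u _ Su /=; rewrite subr_eq0; apply/eqP => /(can_inj GK) /eqP.
    by rewrite -[X in _ == X]addr0 (inj_eq (addrI _)) (negbTE (P0' u Su)).
  - by move=> u _ /=; rewrite scale0r addr0 /P' /F' (addrC (Phi' 0)) subrK.
  - by move=> u _ /=; rewrite scale1r addrC (addrC (Phi' 0)) subrK (addrC (P' u)) addrC.
apply: (@same_winding_eq _ (fun u => G (P' u + Phi 0) - G (Phi 0)) _
  (fun u => G (P u + Phi 0) - G (Phi 0))) => // [u _|].
  by rewrite /P /F subrK.
apply: homotopic_same_winding.
apply: (homotopic_comp (F:=fun z => G (z + Phi 0) - G (Phi 0)) (B:=[set z | z != 0])).
- by cts; refine (cont_onT_comp Gc _); cts.
- move=> z /= z0; rewrite subr_eq0; apply/eqP => /(can_inj GK) /eqP.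
  by rewrite -[X in _ == X]add0r (inj_eq (addIr _)) (negbTE z0).
apply: same_winding_homotopic => //.
exact: same_winding_trans PhiW' (same_winding_sym PhiW).
Qed.

Section Radius.
Variable e : R.
Hypothesis ee : 0 < e <= e0.

Let e_gt0 : 0 < e. Proof. by case/andP: ee. Qed.
Let e_le1 : e <= 1.
Proof. by case/andP: ee => _ /le_trans; apply; case/andP: e01. Qed.

Let beu u : S1 u -> bdisc e0 (e *: u).
Proof.
move=> Su; apply: (@bdisc_le e); last by apply: bdiscZ; rewrite // ltW.
by rewrite ltW//; case/andP: ee.
Qed.

Let Dk (k : R) u : S1 u -> 0 < k <= 1 -> D (k *: u).
Proof.
move=> Su /andP[k0 k1]; split; last first.
  by rewrite scaler_eq0 gt_eqF//= (negbTE (sphere_neq0 Su)).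
by rewrite /disc /= dotZl dotZr Su; nra.
Qed.

(* deform [tau] to the rotation by [kap], then turn it back *)
Let tau_winding : same_winding (fun u => F' (tau (e *: u))) F'.
Proof.
have [e_0 e_1] : 0 < e /\ e <= 1 by [].
have [th _ kapE] := circle_cis kap1.
apply: (@same_winding_trans _ _ (fun u => F' (cmul kap (e *: u)))).
  apply: homotopic_same_winding; apply: (homotopic_comp (F:=F') (B:=D)) => //.
  exists (fun p => (1 - p.1) *: tau (e *: p.2) + p.1 *: cmul kap (e *: p.2)); split.
  - cts; apply: (cont_on_comp (f:=fun p : R * V2 => e *: p.2) tauc); first by cts.
    by move=> p /sndS; exact: beu.
  - move=> t u t01 Su /=; split; last first.
      apply: tau_kap => //; first exact: beu.
      by rewrite scaler_eq0 gt_eqF//= (negbTE (sphere_neq0 Su)).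
    rewrite -disc_bdisc; apply: bdisc_convex => //; rewrite disc_bdisc.
      exact/tau_disc/beu.
    by rewrite /disc /= dot_cmul kap1 mul1r dotZl dotZr Su; nra.
  - by move=> u _ /=; rewrite subr0 scale1r scale0r addr0.
  - by move=> u _ /=; rewrite subrr scale1r scale0r add0r.
apply: homotopic_same_winding; apply: (homotopic_comp (F:=F') (B:=D) (g:=id)) => //.
exists (fun p => ((1 - p.1) * e + p.1) *: cmul (cis ((1 - p.1) * th)) p.2); split.
- by cts.
- move=> t u /andP[t0 t1] Su /=; apply: Dk; last by apply/andP; split; nra.
  by rewrite /sphere /= dot_cmul dot_cis Su mulr1.
- by move=> u _ /=; rewrite subr0 !mul1r addr0 -kapE cmulZr.
- by move=> u _ /=; rewrite subrr !mul0r add0r cmul_cis0 scale1r.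
Qed.

Let scale_winding : same_winding F (fun u => F (e *: u)).
Proof.
have [e_0 e_1] : 0 < e /\ e <= 1 by [].
apply: homotopic_same_winding; apply: (homotopic_comp (F:=F) (B:=D) (f:=id)) => //.
exists (fun p => ((1 - p.1) + p.1 * e) *: p.2); split.
- by cts.
- by move=> t u /andP[t0 t1] Su /=; apply: Dk => //; apply/andP; split; nra.
- by move=> u _ /=; rewrite subr0 mul0r addr0 scale1r.
- by move=> u _ /=; rewrite subrr mul1r add0r.
Qed.

Hypothesis near_c : forall z, bdisc e z -> 0 < dot (G (Phi z)) (G (Phi 0)).

(* near the center, [anti_inversion] multiplies the conjugate of a displacement
   by a number close to a constant *)
Let anti_winding : same_winding (fun u => F' (tau (e *: u)))
  (fun u => cconj (F (e *: u))).
Proof.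
have c0 : 0 < dot (G (Phi 0)) (G (Phi 0)) by rewrite dot_gt0.
have z0 u : S1 u -> G (Phi (e *: u)) != 0.
  move=> Su; apply/eqP => h.
  have := near_c (bdiscZ (ltW e_gt0) Su); rewrite h.
  by rewrite /dot mul0mx mxE ltxx.
have PhiEc : cont_on S1 (fun u => G (Phi (e *: u))).
  refine (cont_onT_comp Gc _).
  apply: (cont_on_comp (f:=fun u => e *: u) Phic); first by cts.
  by move=> u Su; have [|] := @Dk e u Su _; rewrite ?e_gt0.
have b0 : bdisc e0 0.
  by rewrite /bdisc /= /dot mul0mx mxE sqr_ge0.
apply: (@same_winding_trans _ _
    (fun u => cmul (cmul (G (Phi (e *: u))) (G (Phi 0))) (cconj (F (e *: u))))).
  apply: (@same_winding_eq _ (fun u => (dot (G (Phi (e *: u))) (G (Phi (e *: u))) *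
    dot (G (Phi 0)) (G (Phi 0)))^-1 *:
    cmul (cmul (G (Phi (e *: u))) (G (Phi 0))) (cconj (F (e *: u)))) _
    (fun u => cmul (cmul (G (Phi (e *: u))) (G (Phi 0))) (cconj (F (e *: u))))) => //.
    move=> u Su; rewrite -anti_inversionB//; last exact: z0.
    by rewrite -(tau_anti (beu Su)) -(tau_anti b0) tau0.
  apply: same_winding_scale => u Su.
  by rewrite invr_gt0 mulr_gt0// dot_gt0 z0.
apply: (@same_winding_eq _
    (fun u => cmul (cmul (G (Phi (e *: u))) (G (Phi 0))) (cconj (F (e *: u)))) _
    (fun u => cmul (pt2 1 0) (cconj (F (e *: u))))) => //.
  by move=> u _; apply: eq_rV2; rewrite [LHS]pt2E0 || rewrite [LHS]pt2E1;
    rewrite pt2E0 pt2E1; ring.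
apply: same_winding_mul; last exact: same_winding_refl.
apply: (@same_winding_trans _ _ (fun=> cmul (G (Phi 0)) (G (Phi 0)))).
  apply: same_winding_near.
  - by split; [cts|move=> u Su; rewrite cmul_eq0 negb_or z0].
  - by split; [cts|move=> u Su; rewrite cmul_eq0 negb_or GPhi0].
  - move=> u Su; rewrite ![cmul _ (G (Phi 0))]cmulC dot_cmul mulr_gt0//.
    by apply: near_c; apply: bdiscZ; rewrite // ltW.
apply: same_winding_cst; first by rewrite cmul_eq0 negb_or GPhi0.
by apply/eqP => /(congr1 (fun z : V2 => z 0 0)); rewrite pt2E0 mxE => /eqP; rewrite oner_eq0.
Qed.

(** The image of the circle winds like its conjugate, hence is contractible in the
    punctured plane; transported by the inverse of [G], the contraction would
    give a continuous argument on the circle. *)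
Lemma no_reflection_radius : False.
Proof.
have De u : S1 u -> D (e *: u) by move=> Su; apply: Dk; rewrite // e_gt0.
have lC : loop (fun u => F (e *: u)).
  split; last by move=> u /De; exact: F0.
  by apply: (cont_on_comp (f:=fun u => e *: u) Fc) => //; cts.
have lF : loop F.
  split; last by move=> u Su; apply: F0; split; [exact: S1disc|exact: sphere_neq0].
  by apply: cont_onW Fc => u Su; split; [exact: S1disc|exact: sphere_neq0].
have /(winding_conj_cst lC) [c c0 Cc] : same_winding (fun u => F (e *: u))
    (fun u => cconj (F (e *: u))).
  apply: same_winding_trans anti_winding.
  apply: same_winding_trans (same_winding_sym tau_winding).
  apply: same_winding_trans (same_winding_sym path_winding).
  exact: same_winding_sym scale_winding.
have : homotopic F (fun=> c).
  apply: same_winding_homotopic => //.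
    by split => //; cts.
  exact: same_winding_trans scale_winding Cc.
have Fi0 z : z != 0 -> Gi (z + G (Phi 0)) - Phi 0 != 0.
  move=> z0; rewrite subr_eq0; apply/eqP => /(congr1 G); rewrite GiK => /eqP.
  by rewrite -[X in _ == X]add0r (inj_eq (addIr _)) (negbTE z0).
move=> /(homotopic_comp (F:=fun z => Gi (z + G (Phi 0)) - Phi 0)
  (B':=[set z | z != 0])) /=.
move=> /(_ _ Fi0) /homotopic_same_winding FW.
have : same_winding id (fun=> cconj (Gi (c + G (Phi 0)) - Phi 0)).
  apply: (@same_winding_eq _ (fun u => cconj (cconj u)) _
    (fun=> cconj (Gi (c + G (Phi 0)) - Phi 0))) => // [u _|].
    exact: cconjK.
  apply: same_winding_conj; apply: same_winding_trans (same_winding_sym PhiW) _.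
  apply: same_winding_eq (FW _) => // [u _|].
    by rewrite /F subrK GK.
  by cts; refine (cont_onT_comp Gic _); cts.
by apply: winding_id_neq_cst; rewrite cconj_eq0 Fi0.
Qed.
End Radius.

Lemma no_reflection : False.
Proof.
have b0 : @disc R 0 by [].
have fc : cont_on (@disc R) (fun z => dot (G (Phi z)) (G (Phi 0))).
  by cts; apply: (cont_onT_comp (f:=Phi) Gc).
have c0 : 0 < dot (G (Phi 0)) (G (Phi 0)) by rewrite dot_gt0.
have := fc 0 b0 _ (lt_nbhsr c0); rewrite /= nbhs_simpl /= => /nbhs0_bdisc.
move=> [e1 /andP[e10 e11] h].
have [e00 e0_1] := andP e01.
have m0 : 0 < Num.min e0 e1 by rewrite lt_min e00 e10.
have me0 : Num.min e0 e1 <= e0 by rewrite ge_min lexx.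
have me1 : Num.min e0 e1 <= e1 by rewrite ge_min lexx orbT.
apply: (@no_reflection_radius (Num.min e0 e1)); first by rewrite m0.
move=> z ze; apply: h.
  by apply: bdisc_le ze; rewrite (ltW m0).
rewrite -disc_bdisc; apply: bdisc_le ze.
by rewrite (ltW m0) (le_trans me0).
Qed.
End NoReflection.
End Planar.

(** * Orthonormal frames *)

Section Frames.
Context {R : realType}.
Notation V3 := 'rV[R]_3.
Implicit Types (A B K : 'M[R]_3) (x y n : V3).

Lemma ord3P (P : 'I_3 -> Prop) : P 0 -> P 1 -> P 2 -> forall i, P i.
Proof.
move=> P0 P1 P2 -[[|[|[|//]]] i].
- by rewrite (_ : Ordinal i = 0)//; exact: val_inj.
- by rewrite (_ : Ordinal i = 1)//; exact: val_inj.
- by rewrite (_ : Ordinal i = 2)//; exact: val_inj.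
Qed.

Lemma det3E A : \det A =
  A 0 0 * (A 1 1 * A 2 2 - A 1 2 * A 2 1)
  - A 0 1 * (A 1 0 * A 2 2 - A 1 2 * A 2 0)
  + A 0 2 * (A 1 0 * A 2 1 - A 1 1 * A 2 0).
Proof.
rewrite (expand_det_row _ 0) sum3E /cofactor.
rewrite !(expand_det_row _ 0) !sum2E /cofactor !det_mx11 !mxE /=.
have l1 : lift (0 : 'I_3) (0 : 'I_2) = 1 by exact: val_inj.
have l2 : lift (0 : 'I_3) (1 : 'I_2) = 2 by exact: val_inj.
have l3 : lift (1 : 'I_3) (0 : 'I_2) = 0 by exact: val_inj.
have l4 : lift (1 : 'I_3) (1 : 'I_2) = 2 by exact: val_inj.
have l5 : lift (2 : 'I_3) (0 : 'I_2) = 0 by exact: val_inj.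
have l6 : lift (2 : 'I_3) (1 : 'I_2) = 1 by exact: val_inj.
have l7 : lift (0 : 'I_2) (0 : 'I_1) = 1 by exact: val_inj.
have l8 : lift (1 : 'I_2) (0 : 'I_1) = 0 by exact: val_inj.
rewrite ?l7 ?l8 ?l1 ?l2 ?l3 ?l4 ?l5 ?l6 /=.
ring.
Qed.

Definition mx3 (a b c d e f g h k : R) : 'M[R]_3 := \matrix_(i, j)
  (if i == 0 then if j == 0 then a else if j == 1 then b else c
   else if i == 1 then if j == 0 then d else if j == 1 then e else f
   else if j == 0 then g else if j == 1 then h else k).

Lemma mulmxT_dot A B i j : (A *m B^T) i j = dot (row i A) (row j B).
Proof. by rewrite mxE dotE; apply: eq_bigr => k _; rewrite !mxE. Qed.

Lemma coordT_dot A x j : (x *m A^T) 0 j = dot x (row j A).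
Proof. by rewrite mxE dotE; apply: eq_bigr => k _; rewrite !mxE. Qed.

(** The change of frame between two right-handed orthonormal frames such that a
    common vector comes last in the one and first in the other. *)
Definition cyc_rot (a b : R) := mx3 0 0 1 a b 0 (- b) a 0.

Definition rot (a b : R) := mx3 a b 0 (- b) a 0 0 0 1.

Lemma cyc_rot_orth (a b : R) : a ^+ 2 + b ^+ 2 = 1 ->
  cyc_rot a b *m (cyc_rot a b)^T = 1%:M.
Proof.
move=> ab; apply/matrixP => i j.
by elim/ord3P: i; elim/ord3P: j; rewrite !mxE sum3E !mxE /=; lra.
Qed.

Lemma rot_orth (a b : R) : a ^+ 2 + b ^+ 2 = 1 ->
  rot a b *m (rot a b)^T = 1%:M.
Proof.
move=> ab; apply/matrixP => i j.
by elim/ord3P: i; elim/ord3P: j; rewrite !mxE sum3E !mxE /=; lra.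
Qed.

Lemma cyc_rot_det (a b : R) : a ^+ 2 + b ^+ 2 = 1 -> \det (cyc_rot a b) = 1.
Proof. by move=> ab; rewrite det3E !mxE /=; lra. Qed.

Lemma rot_det (a b : R) : a ^+ 2 + b ^+ 2 = 1 -> \det (rot a b) = 1.
Proof. by move=> ab; rewrite det3E !mxE /=; lra. Qed.

Lemma orth_mul K A : K *m K^T = 1%:M -> A *m A^T = 1%:M ->
  (K *m A) *m (K *m A)^T = 1%:M.
Proof. by move=> KK AA; rewrite trmx_mul mulmxA -(mulmxA K) AA mulmx1. Qed.

Lemma row_orth_sphere A i : A *m A^T = 1%:M -> sphere R 3 (row i A).
Proof. by move=> AA; rewrite /sphere /= -mulmxT_dot AA mxE eqxx. Qed.

Lemma orth_row_dot A i j : A *m A^T = 1%:M -> i != j ->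
  dot (row i A) (row j A) = 0.
Proof. by move=> AA ij; rewrite -mulmxT_dot AA mxE (negbTE ij). Qed.

(** In the plane orthogonal to the common vector, the other two vectors are
    related by a plane rotation, determined by its first row. *)
Lemma frame_change A E : A *m A^T = 1%:M -> E *m E^T = 1%:M ->
  \det A = 1 -> \det E = 1 -> row 0 A = row 2 E ->
  exists2 k : R * R, k.1 ^+ 2 + k.2 ^+ 2 = 1 & A = cyc_rot k.1 k.2 *m E.
Proof.
move=> AA EE dA dE AE; pose C := A *m E^T.
have EtE : E^T *m E = 1%:M by apply: mulmx1C.
have CE : A = C *m E by rewrite -mulmxA EtE mulmx1.
have CC : C *m C^T = 1%:M.
  by rewrite trmx_mul trmxK mulmxA -(mulmxA A) EtE mulmx1.
have dC : \det C = 1 by rewrite det_mulmx det_tr dA dE mulr1.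
have c00 : C 0 0 = 0 by rewrite mulmxT_dot AE orth_row_dot.
have c01 : C 0 1 = 0 by rewrite mulmxT_dot AE orth_row_dot.
have c02 : C 0 2 = 1 by rewrite mulmxT_dot AE; exact: row_orth_sphere.
have c12 : C 1 2 = 0 by rewrite mulmxT_dot -AE orth_row_dot.
have c22 : C 2 2 = 0 by rewrite mulmxT_dot -AE orth_row_dot.
move: dC; rewrite det3E c00 c01 c02 c12 c22 => dC.
have e1 : C 1 0 ^+ 2 + C 1 1 ^+ 2 = 1.
  have : (C *m C^T) 1 1 = 1 by rewrite CC mxE.
  by rewrite mulmxT_dot dot3E ![row _ C _ _]mxE c12 => <-; ring.
have e2 : C 2 0 ^+ 2 + C 2 1 ^+ 2 = 1.
  have : (C *m C^T) 2 2 = 1 by rewrite CC mxE.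
  by rewrite mulmxT_dot dot3E ![row _ C _ _]mxE c22 => <-; ring.
have e3 : (C 2 1 - C 1 0) ^+ 2 + (C 2 0 + C 1 1) ^+ 2 = 0.
  transitivity ((C 1 0 ^+ 2 + C 1 1 ^+ 2) + (C 2 0 ^+ 2 + C 2 1 ^+ 2)
    - 2 * (C 1 0 * C 2 1 - C 1 1 * C 2 0)); first by ring.
  by rewrite e1 e2; lra.
have /eqP := e3; rewrite paddr_eq0 ?sqr_ge0// !sqrf_eq0 subr_eq0 addr_eq0.
move=> /andP[/eqP d1 /eqP d2].
exists (C 1 0, C 1 1) => //=; rewrite CE; congr (_ *m _).
apply/matrixP => i j.
by elim/ord3P: i; elim/ord3P: j; rewrite [RHS]mxE /=.
Qed.

(** Away from the south pole, transport the standard frame from the north pole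
    along the great circle to [n]. *)
Lemma frame_exists n : sphere R 3 n ->
  exists2 B : 'M[R]_3, B *m B^T = 1%:M & row 2 B = n.
Proof.
rewrite /sphere /= dot3E => nn.
have [z1|z1] := eqVneq (1 + n 0 2) 0.
  have n2 : n 0 2 = -1 by lra.
  have n0 : n 0 0 = 0.
    by apply/eqP; rewrite -sqrf_eq0; apply/eqP; move: nn; rewrite n2; nra.
  have n1 : n 0 1 = 0.
    by apply/eqP; rewrite -sqrf_eq0; apply/eqP; move: nn; rewrite n2; nra.
  exists (mx3 1 0 0 0 1 0 0 0 (-1)).
    apply/matrixP => i j.
    by elim/ord3P: i; elim/ord3P: j; rewrite !mxE sum3E !mxE /=; ring.
  by apply: eq_rV3; rewrite !mxE /= ?n0 ?n1 ?n2.
move: nn z1; set a := n 0 0; set b := n 0 1; set c := n 0 2 => nn z1.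
exists (mx3 (1 - a ^+ 2 * (1 + c)^-1) (- (a * b) * (1 + c)^-1) (- a)
            (- (a * b) * (1 + c)^-1) (1 - b ^+ 2 * (1 + c)^-1) (- b) a b c).
  apply/matrixP => i j.
  have h1 : (1 + c)^-1 * (1 + c) = 1 by rewrite mulVf.
  move: ((1 + c)^-1) h1 => k h1.
  have h2 : k * (a ^+ 2 + b ^+ 2) = 1 - c.
    have -> : a ^+ 2 + b ^+ 2 = (1 + c) * (1 - c) by lra.
    by rewrite mulrA h1 mul1r.
  have h3 : k * k * (a ^+ 2 + b ^+ 2) = 2 * k - 1.
    by rewrite -mulrA h2; lra.
  have haa := congr1 (fun t => a * a * t) h3.
  have hab := congr1 (fun t => a * b * t) h3.
  have hbb := congr1 (fun t => b * b * t) h3.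
  have ha := congr1 (fun t => a * t) h2.
  have hb := congr1 (fun t => b * t) h2.
  rewrite /= in haa hab hbb ha hb.
  by elim/ord3P: i; elim/ord3P: j; rewrite !mxE sum3E !mxE /=; lra.
by apply: eq_rV3; rewrite !mxE.
Qed.
End Frames.

(** * Orientation of sphere homeomorphisms *)

Section Stereographic.
Context {R : realType}.
Notation V2 := 'rV[R]_2.
Notation V3 := 'rV[R]_3.
Notation S1 := (sphere R 2).
Notation S2 := (sphere R 3).
Implicit Types (A B E : 'M[R]_3) (x y v w : V3) (z u : V2).

Definition pt3 (a b c : R) : V3 :=
  \row_j (if j == 0 then a else if j == 1 then b else c).

(** Stereographic projection from the last vector of the frame [A], in the
    coordinates given by the first two. *)
Definition stereo A x : V2 :=
  (1 - dot x (row 2 A))^-1 *: pt2 (dot x (row 0 A)) (dot x (row 1 A)).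

Definition stereo_inv A z : V3 :=
  (dot z z + 1)^-1 *: (pt3 (2 * z 0 0) (2 * z 0 1) (dot z z - 1) *m A).

Section OneFrame.
Variable A : 'M[R]_3.
Hypothesis AA : A *m A^T = 1%:M.

Lemma frame_expand x : x = dot x (row 0 A) *: row 0 A +
  dot x (row 1 A) *: row 1 A + dot x (row 2 A) *: row 2 A.
Proof.
have AtA : A^T *m A = 1%:M by apply: mulmx1C.
rewrite -{1}[x]mulmx1 -AtA mulmxA mulmx_sum_row sum3E.
by rewrite !coordT_dot.
Qed.

Lemma frame_pt3 (a b c : R) : pt3 a b c *m A = a *: row 0 A + b *: row 1 A + c *: row 2 A.
Proof. by rewrite mulmx_sum_row sum3E !mxE. Qed.

Let r00 : dot (row 0 A) (row 0 A) = 1. Proof. exact: row_orth_sphere. Qed.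
Let r11 : dot (row 1 A) (row 1 A) = 1. Proof. exact: row_orth_sphere. Qed.
Let r22 : dot (row 2 A) (row 2 A) = 1. Proof. exact: row_orth_sphere. Qed.
Let r01 : dot (row 0 A) (row 1 A) = 0. Proof. exact: orth_row_dot. Qed.
Let r02 : dot (row 0 A) (row 2 A) = 0. Proof. exact: orth_row_dot. Qed.
Let r12 : dot (row 1 A) (row 2 A) = 0. Proof. exact: orth_row_dot. Qed.
Let r10 : dot (row 1 A) (row 0 A) = 0. Proof. exact: orth_row_dot. Qed.
Let r20 : dot (row 2 A) (row 0 A) = 0. Proof. exact: orth_row_dot. Qed.
Let r21 : dot (row 2 A) (row 1 A) = 0. Proof. exact: orth_row_dot. Qed.

Lemma frame_dot x : dot x x =
  dot x (row 0 A) ^+ 2 + dot x (row 1 A) ^+ 2 + dot x (row 2 A) ^+ 2.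
Proof.
rewrite {1 2}(frame_expand x) !(dotDl, dotDr, dotZl, dotZr).
by rewrite r00 r01 r02 r10 r11 r12 r20 r21 r22; ring.
Qed.

Lemma frame_inj x y : (forall i, dot x (row i A) = dot y (row i A)) -> x = y.
Proof. by move=> h; rewrite (frame_expand x) (frame_expand y) !h. Qed.

Lemma stereo_pole x : S2 x -> x != row 2 A -> dot x (row 2 A) < 1.
Proof.
rewrite /sphere /= => Sx; apply: contraNT; rewrite -leNgt => h.
have := frame_dot x; rewrite Sx; set a := dot x _; set b := dot x _.
have a2 := sqr_ge0 a; have b2 := sqr_ge0 b => e.
have e2 : dot x (row 2 A) = 1 by nra.
have a0 : a = 0 by apply/eqP; rewrite -sqrf_eq0; apply/eqP; nra.
have b0 : b = 0 by apply/eqP; rewrite -sqrf_eq0; apply/eqP; nra.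
by rewrite (frame_expand x) -/a -/b a0 b0 e2 !scale0r !add0r scale1r.
Qed.

Lemma dot_stereo x : S2 x -> x != row 2 A ->
  dot (stereo A x) (stereo A x) = (1 + dot x (row 2 A)) / (1 - dot x (row 2 A)).
Proof.
move=> Sx /(stereo_pole Sx) h; have := frame_dot x; rewrite (Sx : dot x x = 1).
move=> e; rewrite /stereo dotZl dotZr dot2E !pt2E0 !pt2E1.
have e' : dot x (row 0 A) * dot x (row 0 A) + dot x (row 1 A) * dot x (row 1 A)
   = (1 - dot x (row 2 A)) * (1 + dot x (row 2 A)) by lra.
by rewrite e'; field; rewrite subr_eq0 gt_eqF.
Qed.

Lemma dotS_gt0 z : 0 < dot z z + 1.
Proof. by rewrite ltr_wpDl// dot_ge0. Qed.

Lemma stereo_inv_coord z : [/\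
  dot (stereo_inv A z) (row 0 A) = (dot z z + 1)^-1 * (2 * z 0 0),
  dot (stereo_inv A z) (row 1 A) = (dot z z + 1)^-1 * (2 * z 0 1) &
  dot (stereo_inv A z) (row 2 A) = (dot z z + 1)^-1 * (dot z z - 1)].
Proof.
rewrite /stereo_inv frame_pt3 !dotZl !dotDl !dotZl.
by rewrite r00 r01 r02 r10 r11 r12 r20 r21 r22; split; ring.
Qed.

Lemma stereo_inv_sphere z : S2 (stereo_inv A z).
Proof.
have [h0 h1 h2] := stereo_inv_coord z; have := dotS_gt0 z => s0.
rewrite /sphere /= frame_dot h0 h1 h2.
have dE : dot z z = z 0 0 * z 0 0 + z 0 1 * z 0 1 by exact: dot2E.
move: s0; rewrite dE => s0; field; by rewrite gt_eqF.
Qed.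

Lemma stereo_inv_pole z : stereo_inv A z != row 2 A.
Proof.
apply/eqP => h; have [_ _] := stereo_inv_coord z; rewrite h r22.
have s0 := dotS_gt0 z => e.
have := congr1 (fun t => (dot z z + 1) * t) e; rewrite /= mulVKf ?gt_eqF//; lra.
Qed.

Lemma stereo_invK z : stereo A (stereo_inv A z) = z.
Proof.
have [h0 h1 h2] := stereo_inv_coord z; have s0 := dotS_gt0 z.
have sn : dot z z + 1 != 0 by rewrite gt_eqF.
have e : (1 - (dot z z + 1)^-1 * (dot z z - 1))^-1 = (dot z z + 1) / 2.
  field; rewrite sn /=.
  by rewrite (_ : _ - _ = 2 :> R)//; ring.
rewrite /stereo h0 h1 h2 e; move: sn; set s := dot z z + 1 => sn.
by apply: eq_rV2; rewrite [LHS]mxE ?pt2E0 ?pt2E1; field.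
Qed.

Lemma stereoK x : S2 x -> x != row 2 A -> stereo_inv A (stereo A x) = x.
Proof.
move=> Sx xN; have h := stereo_pole Sx xN; have e := dot_stereo Sx xN.
have [h0 h1 h2] := stereo_inv_coord (stereo A x).
have nz : 1 - dot x (row 2 A) != 0 by rewrite subr_eq0 gt_eqF.
have k : (dot (stereo A x) (stereo A x) + 1)^-1 = (1 - dot x (row 2 A)) / 2.
  rewrite e; field; rewrite nz /=; rewrite (_ : _ + _ = 2 :> R)//; ring.
apply: frame_inj => i; elim/ord3P: i.
- by rewrite h0 k /stereo mxE pt2E0; field.
- by rewrite h1 k /stereo mxE pt2E1; field.
- by rewrite h2 k e; field.
Qed.

Lemma stereo_neq0 x : S2 x -> x != row 2 A -> x != - row 2 A -> stereo A x != 0.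
Proof.
move=> Sx xN xN'; rewrite -dot_eq0 dot_stereo//.
have h := stereo_pole Sx xN.
have h' : dot (- x) (row 2 A) < 1.
  by apply: stereo_pole; [exact: sphereN|rewrite eqr_oppLR].
rewrite dotNl in h'; rewrite gt_eqF// divr_gt0//; lra.
Qed.

Lemma stereoN x : S2 x -> x != row 2 A -> x != - row 2 A ->
  stereo A (- x) = anti_inversion (stereo A x).
Proof.
move=> Sx xN xN'; rewrite /anti_inversion dot_stereo//.
have h := stereo_pole Sx xN.
have h' : dot (- x) (row 2 A) < 1.
  by apply: stereo_pole; [exact: sphereN|rewrite eqr_oppLR].
rewrite dotNl in h'.
have n1 : 1 - dot x (row 2 A) != 0 by rewrite gt_eqF//; lra.
have n2 : 1 + dot x (row 2 A) != 0 by rewrite gt_eqF//; lra.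
rewrite /stereo !dotNl opprK; apply: eq_rV2; rewrite [LHS]mxE [RHS]mxE.
  by rewrite [in RHS]mxE !pt2E0; field; rewrite n1.
by rewrite [in RHS]mxE !pt2E1; field; rewrite n1.
Qed.

Lemma cont_on_stereo : cont_on [set x | S2 x /\ x != row 2 A] (stereo A).
Proof.
rewrite /stereo; cts => x [Sx xN]; have := stereo_pole Sx xN.
by rewrite subr_eq0 => h; rewrite gt_eqF.
Qed.

Lemma continuous_stereo_inv : continuous (stereo_inv A).
Proof.
apply/continuous_subspace_setT/cont_onP; rewrite /stereo_inv; cts.
  by move=> z _; rewrite gt_eqF// dotS_gt0.
apply: cont_on_row => j; elim/ord3P: j.
- by apply: (@cont_on_eq _ _ _ (fun z : V2 => 2 * z 0 0)); [move=> ? _; rewrite mxE|cts].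
- by apply: (@cont_on_eq _ _ _ (fun z : V2 => 2 * z 0 1)); [move=> ? _; rewrite mxE|cts].
- by apply: (@cont_on_eq _ _ _ (fun z : V2 => dot z z - 1)); [move=> ? _; rewrite mxE|cts].
Qed.
End OneFrame.

(** Stereographic projection from a point of the equator of [v] reverses the
    orientation of the tangent plane at [v]: in an adapted frame, it differs
    near [v] from the exchange of the two tangent coordinates by terms of the
    second order, and these do not cancel the linear part anywhere on the open
    hemisphere. *)
Lemma chart_winding A v phi : A *m A^T = 1%:M -> \det A = 1 -> row 0 A = v ->
  ccw_chart v phi ->
  same_winding (fun u => stereo A (phi u) - stereo A (phi 0)) cconj.
Proof.
move=> AA dA Av [[phic phib _] phi0 phiS _ [E [EE dE Ev deg]]].
have [[a b] /= ab AE] := frame_change AA EE dA dE (etrans Av (esym Ev)).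
have S1disc u : S1 u -> disc u by rewrite /sphere /disc /= => ->.
have phiS1 : cont_on S1 phi by apply: cont_onW S1disc _; exact/cont_onP.
pose T u : V2 := pt2 (dot (phi u) (row 0 E)) (dot (phi u) (row 1 E)).
have vS : S2 v by rewrite -Ev; exact: row_orth_sphere.
have T0 : T 0 = 0.
  rewrite /T phi0 -Ev ![dot (row 2 E) _]orth_row_dot//.
  by apply: eq_rV2; rewrite ?pt2E0 ?pt2E1 mxE.
have [H [Hc Hn Hf Hg]] := deg.
have Tn u : S1 u -> T u != 0.
  move=> Su; have := Hn 1 u; rewrite Hg// add0r -/(T u) -/(T 0) T0 subr0.
  by apply; rewrite ?ler01 ?lexx.
have Tid : same_winding T id.
  apply: same_winding_sym; apply: homotopic_same_winding; exists H; split => //.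
    exact/cont_onP.
  by move=> u Su; rewrite Hg// add0r -/(T u) -/(T 0) T0 subr0.
have row1 : row 1 A = a *: row 0 E + b *: row 1 E.
  rewrite AE row_mul mulmx_sum_row sum3E !mxE /= scale0r addr0 //.
have row2 : row 2 A = - b *: row 0 E + a *: row 1 E.
  rewrite AE row_mul mulmx_sum_row sum3E !mxE /= scale0r addr0 //.
pose Q u : V2 := pt2 (dot (phi u) (row 1 A)) (dot (phi u) (row 2 A)).
have QT u : Q u = cmul (pt2 a (- b)) (T u).
  rewrite /Q /T row1 row2; apply: eq_rV2;
    by rewrite /cmul !(pt2E0, pt2E1) !(dotDr, dotZr); ring.
have k0 : pt2 a (- b) != 0.
  by rewrite -dot_eq0 dot2E !(pt2E0, pt2E1) mulrNN -!expr2 ab oner_eq0.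
have i0 : pt2 0 1 != 0 :> V2.
  by rewrite -dot_eq0 dot2E !(pt2E0, pt2E1) mul0r add0r mulr1 oner_eq0.
have o0 : pt2 1 0 != 0 :> V2.
  by rewrite -dot_eq0 dot2E !(pt2E0, pt2E1) mul0r addr0 mulr1 oner_eq0.
have Qid : same_winding Q id.
  apply: (@same_winding_eq _ (fun u => cmul (pt2 a (- b)) (T u)) _
    (fun u => cmul (pt2 1 0) u)) => [u _|u _|].
  - by rewrite QT.
  - by apply: eq_rV2; rewrite /cmul ?pt2E0 ?pt2E1; ring.
  - by apply: same_winding_mul => //; exact: same_winding_cst.
have Qn u : S1 u -> Q u != 0.
  by move=> Su; rewrite QT cmul_eq0 negb_or k0 Tn.
have Qc : cont_on S1 Q by rewrite /Q; cts.
apply: (@same_winding_trans _ _ (fun u => cmul (pt2 0 1) (cconj (Q u)))); last first.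
  apply: (@same_winding_eq _ (fun u => cmul (pt2 0 1) (cconj (Q u))) _
    (fun u => cmul (pt2 1 0) (cconj u))) => [//|u _|].
    by apply: eq_rV2; rewrite /cmul ?pt2E0 ?pt2E1; ring.
  apply: same_winding_mul; first exact: same_winding_cst.
  exact: same_winding_conj Qid.
have st0 : stereo A (phi 0) = pt2 1 0.
  have r00 : dot (row 0 A) (row 0 A) = 1 by exact: row_orth_sphere.
  rewrite phi0 -Av /stereo r00 (orth_row_dot AA (isT : 0 != 2 :> 'I_3)).
  rewrite (orth_row_dot AA (isT : 0 != 1 :> 'I_3)).
  by apply: eq_rV2; rewrite mxE ?pt2E0 ?pt2E1 subr0 invr1 mul1r.
have row0v u : S1 u -> 0 < dot (phi u) (row 0 A).
  by move=> /S1disc/phiS [_]; rewrite Av.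
have pole u : S1 u -> dot (phi u) (row 2 A) < 1.
  move=> Su; apply: stereo_pole => //; first by have [] := phiS u (S1disc u Su).
  apply/eqP => h; have := row0v u Su; rewrite h orth_row_dot// ltxx //.
have eqs u : S1 u -> dot (phi u) (row 0 A) ^+ 2 + dot (phi u) (row 1 A) ^+ 2 +
    dot (phi u) (row 2 A) ^+ 2 = 1.
  by move=> /S1disc/phiS [Su _]; rewrite -frame_dot.
apply: homotopic_same_winding.
exists (fun p => (p.1 + (1 - p.1) / (1 - dot (phi p.2) (row 2 A))) *:
  pt2 ((1 - p.1) * (dot (phi p.2) (row 0 A) - 1) + dot (phi p.2) (row 2 A))
      (dot (phi p.2) (row 1 A))); split.
- have sndS (p : R * V2) : cylinder R 2 p -> S1 p.2 by case.
  have pc : cont_on (cylinder R 2) (fun p => phi p.2).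
    by apply: (cont_on_comp (f:=snd) phiS1) => //; cts.
  by cts => // p /sndS /pole; rewrite subr_eq0 => h; rewrite gt_eqF.
- move=> t u /andP[t0 t1] Su /=.
  have := eqs u Su; have := row0v u Su; have := pole u Su; have := Qn u Su.
  rewrite -dot_gt0 /Q dot2E !(pt2E0, pt2E1).
  set c := dot _ (row 0 A); set s := dot _ (row 1 A); set r := dot _ (row 2 A).
  move=> q r1 c0 e; rewrite scaler_eq0 negb_or; apply/andP; split.
    have : 0 < (1 - r)^-1 by rewrite invr_gt0 subr_gt0.
    by move: ((1 - r)^-1) => k k0'; rewrite gt_eqF//; nra.
  rewrite -dot_gt0 dot2E !(pt2E0, pt2E1) lt0r addr_ge0 -?expr2 ?sqr_ge0// andbT.
  rewrite paddr_eq0 ?sqr_ge0// !sqrf_eq0; apply/negP => /andP[/eqP h /eqP s0].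
  have r2 : 0 < r ^+ 2 by move: q; rewrite s0; nra.
  have rc : r = (1 - t) * (1 - c) by lra.
  have c1 : c < 1 by nra.
  have r0 : 0 <= r by rewrite rc mulr_ge0//; lra.
  have : r <= 1 - c by rewrite rc; nra.
  by move: e; rewrite s0; nra.
- move=> u Su /=; have := pole u Su.
  rewrite st0 /stereo subr0 add0r mul1r.
  set r := dot _ (row 2 A) => r1; have rn : 1 - r != 0 by rewrite gt_eqF// subr_gt0.
  by apply: eq_rV2; rewrite !mxE /=; field.
- move=> u Su /=; rewrite subrr !mul0r add0r addr0 scale1r.
  by apply: eq_rV2; rewrite /cmul /cconj /Q !(pt2E0, pt2E1); ring.
Qed.
End Stereographic.

Section Spherical.
Context {R : realType}.
Notation V2 := 'rV[R]_2.
Notation V3 := 'rV[R]_3.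
Notation S1 := (sphere R 2).
Notation S2 := (sphere R 3).

Lemma homeo_inverse (T U : topologicalType) (A : set T) (B : set U)
    (f : T -> U) : homeo A B f ->
  exists f' : U -> T, [/\ cont_on B f', forall x, A x -> f' (f x) = x,
    forall y, B y -> A (f' y) & forall y, B y -> f (f' y) = y].
Proof.
move=> [_ [fAB _ fsurj] [f' [f'c f'K]]]; exists f'; split => //.
- exact/cont_onP.
- by move=> y /fsurj [x Ax <-]; rewrite f'K.
- by move=> y /fsurj [x Ax <-]; rewrite f'K.
Qed.

(** With [w = sym v], the change of charts [tau] is the local form of the
    involution.  Positively oriented charts at [v] and [w] are compared in one
    plane by projecting from a point on the equators of both, and their images
    by [g] are projected from the image of that point. *)
Lemma antipodal_no_rotation (g : V3 -> V3) (v w : V3) (phi phi' : V2 -> V3)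
    (tau : V2 -> V2) (kap : V2) (e0 : R) :
  homeo S2 S2 g -> S2 w -> - g v = g w ->
  ccw_chart v phi -> ccw_chart w phi' ->
  S1 kap -> 0 < e0 <= 1 -> cont_on (bdisc e0) tau -> tau 0 = 0 ->
  (forall z, bdisc e0 z -> disc (tau z)) ->
  (forall z (t : R), bdisc e0 z -> z != 0 -> 0 <= t <= 1 ->
     (1 - t) *: tau z + t *: cmul kap z != 0) ->
  (forall z, bdisc e0 z -> g (phi' (tau z)) = - g (phi z)) -> False.
Proof.
move=> gh Sw gvw chv chw kap1 e01 tauc tau0 taud tauk taug.
have [gi [gic giK giS gK]] := homeo_inverse gh.
have [/cont_onP gc [gS _ _] _] := gh; have {}gS x : S2 x -> S2 (g x) by exact: gS.
have g_inj x y : S2 x -> S2 y -> g x = g y -> x = y.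
  by move=> Sx Sy /(congr1 gi); rewrite !giK.
have [ph_h phi0 phiS _ [E [EE dE Ev _]]] := chv.
have [ph_h' phi0' phiS' _ _] := chw.
have Sv : S2 v by rewrite -Ev; exact: row_orth_sphere.
(* a point [row 2 A] on the equators of both [v] and [w] *)
have [a [b [ab wab]]] : exists a b : R,
    a ^+ 2 + b ^+ 2 = 1 /\ - b * dot w (row 0 E) + a * dot w (row 1 E) = 0.
  pose q := pt2 (dot w (row 0 E)) (dot w (row 1 E)).
  have [q0|q0] := eqVneq q 0.
    exists 1, 0; split; first by rewrite expr1n expr0n addr0.
    have := congr1 (fun z : V2 => z 0 1) q0; rewrite pt2E1 mxE => ->; ring.
  have := q0; rewrite -dot_gt0 => /[dup] s0; rewrite -sqrtr_gt0.
  have := sqr_sqrtr (ltW s0); rewrite {2}/q dot2E !(pt2E0, pt2E1).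
  move: (Num.sqrt _) => r rr r0; have rn : r != 0 by rewrite gt_eqF.
  exists (dot w (row 0 E) / r), (dot w (row 1 E) / r); split; last by field.
  rewrite !expr_div_n -mulrDl (expr2 (dot w (row 0 E))) (expr2 (dot w (row 1 E))).
  by rewrite -rr divff// expf_neq0.
pose A := cyc_rot a b *m E.
have AA : A *m A^T = 1%:M by apply: orth_mul => //; exact: cyc_rot_orth.
have dA : \det A = 1 by rewrite det_mulmx cyc_rot_det// dE mulr1.
have A0 : row 0 A = v.
  by rewrite /A row_mul mulmx_sum_row sum3E !mxE /= !scale0r !add0r scale1r.
have A2 : row 2 A = - b *: row 0 E + a *: row 1 E.
  by rewrite /A row_mul mulmx_sum_row sum3E !mxE /= scale0r addr0.
have wA2 : dot w (row 2 A) = 0 by rewrite A2 dotDr !dotZr.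
have vA2 : dot v (row 2 A) = 0 by rewrite -A0 orth_row_dot.
pose c1 := dot w (row 0 A); pose c2 := dot w (row 1 A).
have cc : c1 ^+ 2 + c2 ^+ 2 = 1.
  by have := frame_dot AA w; rewrite (Sw : dot w w = 1) wA2 -/c1 -/c2 => ->; ring.
pose A' := rot c1 c2 *m A.
have AA' : A' *m A'^T = 1%:M by apply: orth_mul => //; exact: rot_orth.
have dA' : \det A' = 1 by rewrite det_mulmx rot_det// dA mulr1.
have A'0 : row 0 A' = c1 *: row 0 A + c2 *: row 1 A.
  by rewrite /A' row_mul mulmx_sum_row sum3E !mxE /= scale0r addr0.
have A'1 : row 1 A' = - c2 *: row 0 A + c1 *: row 1 A.
  by rewrite /A' row_mul mulmx_sum_row sum3E !mxE /= scale0r addr0.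
have A'2 : row 2 A' = row 2 A.
  by rewrite /A' row_mul mulmx_sum_row sum3E !mxE /= !scale0r !add0r scale1r.
have A'w : row 0 A' = w.
  by rewrite A'0 [RHS](frame_expand AA) wA2 scale0r addr0.
have stA' x : stereo A x = cmul (pt2 c1 c2) (stereo A' x).
  rewrite /stereo A'0 A'1 A'2 cmulZr; congr (_ *: _).
  apply: eq_rV2; rewrite /cmul !(pt2E0, pt2E1) !(dotDr, dotZr).
    by rewrite -[LHS]mul1r -cc; ring.
  by rewrite -[LHS]mul1r -cc; ring.
pose N := row 2 A; have SN : S2 N by exact: row_orth_sphere.
have [B BB B2] := frame_exists (gS N SN).
have PhiW := chart_winding AA dA A0 chv.
have PhiW' : same_winding (fun u => stereo A (phi' u) - stereo A (phi' 0)) cconj.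
  apply: (@same_winding_eq _
    (fun u => cmul (pt2 c1 c2) (stereo A' (phi' u) - stereo A' (phi' 0))) _
    (fun u => cmul (pt2 1 0) (cconj u))) => [u _|u _|].
  - by rewrite !stA' -cmulBr.
  - by apply: eq_rV2; rewrite /cmul ?pt2E0 ?pt2E1; ring.
  - apply: same_winding_mul; last exact: (chart_winding AA' dA' A'w chw).
    apply: same_winding_cst; rewrite -dot_eq0 dot2E !(pt2E0, pt2E1) -!expr2.
      by rewrite cc oner_eq0.
    by rewrite expr1n expr0n addr0 oner_eq0.
have vN : v != N by apply/eqP => e; move: vA2; rewrite -/N -e (Sv : dot v v = 1) => /eqP; rewrite oner_eq0.
have wN : w != N by apply/eqP => e; move: wA2; rewrite -/N -e (Sw : dot w w = 1) => /eqP; rewrite oner_eq0.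
pose D x := S2 x /\ x != N.
pose D' x := S2 x /\ x != g N.
have Dg x : D x -> D' (g x).
  move=> [Sx /eqP xN]; split; first exact: gS.
  by apply/eqP => /(g_inj _ _ Sx SN).
have Dgi x : D' x -> D (gi x).
  move=> [Sx /eqP xN]; split; first exact: giS.
  by apply/eqP => /(congr1 g); rewrite gK.
have Dst z : D (stereo_inv A z).
  by split; [exact: stereo_inv_sphere|exact: stereo_inv_pole].
have Dst' z : D' (stereo_inv B z).
  by split; [exact: stereo_inv_sphere|rewrite -B2; exact: stereo_inv_pole].
have stc : cont_on D (stereo A) by exact: cont_on_stereo.
have stc' : cont_on D' (stereo B) by rewrite /D' -B2; exact: cont_on_stereo.
have phiD z : disc z -> D (phi z).
  move=> dz; have [Sz hz] := phiS z dz; split => //; apply/eqP => e.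
  by move: hz; rewrite e dotC (vA2 : dot v N = 0) ltxx.
have phiD' z : disc z -> D (phi' z).
  move=> dz; have [Sz hz] := phiS' z dz; split => //; apply/eqP => e.
  by move: hz; rewrite e dotC (wA2 : dot w N = 0) ltxx.
have stK x : D x -> stereo_inv A (stereo A x) = x.
  by move=> [Sx xN]; exact: stereoK.
have stK' x : D' x -> stereo_inv B (stereo B x) = x.
  by move=> [Sx xN]; apply: stereoK => //; rewrite B2.
pose G z := stereo B (g (stereo_inv A z)).
pose Gi z := stereo A (gi (stereo_inv B z)).
have DS : D `<=` S2 by move=> x [].
have DS' : D' `<=` S2 by move=> x [].
have Gst x : D x -> G (stereo A x) = stereo B (g x) by move=> Dx; rewrite /G stK.
have disc0 : @disc R 0 by rewrite /disc /= /dot mul0mx mxE ler01.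
have gvw' : g w = - g v by [].
have wvN : g v != - g N.
  apply/eqP => e; move: wN => /eqP; apply; apply: g_inj => //.
  by rewrite gvw' e opprK.
have phi_inj z z' : disc z -> disc z' -> phi z = phi z' -> z = z'.
  by have [_ [_ inj _] _] := ph_h; move=> dz dz'; apply: inj; rewrite inE.
have phi_inj' z z' : disc z -> disc z' -> phi' z = phi' z' -> z = z'.
  by have [_ [_ inj _] _] := ph_h'; move=> dz dz'; apply: inj; rewrite inE.
have phic : cont_on (@disc R) phi by have [? _ _] := ph_h; exact/cont_onP.
have phic' : cont_on (@disc R) phi' by have [? _ _] := ph_h'; exact/cont_onP.
have e0disc z : bdisc e0 z -> disc z.
  by rewrite -disc_bdisc; apply: bdisc_le; case/andP: e01 => /ltW -> ->.
(* [g (phi z)] is never the antipode of the pole, as [phi' (tau z)] is not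
   the pole *)
have anti z : bdisc e0 z -> G (stereo A (phi' (tau z))) =
    anti_inversion (G (stereo A (phi z))).
  move=> ze; have [Dz Dz'] := (phiD z (e0disc z ze), phiD' _ (taud z ze)).
  rewrite !Gst// taug//; apply: stereoN => //; first exact/gS/DS.
    by rewrite B2; have [] := Dg _ Dz.
  by rewrite B2 -eqr_oppLR -taug//; have [] := Dg _ Dz'.
apply: (@no_reflection R G Gi (fun z => stereo A (phi z))
  (fun z => stereo A (phi' z)) tau kap e0) => //.
- apply/continuous_subspace_setT/cont_onP.
  apply: (cont_on_comp (f:=fun z => g (stereo_inv A z)) stc').
    apply: (cont_on_comp (f:=stereo_inv A) gc).
      exact/cont_on_continuous/continuous_stereo_inv.
    by move=> z _; exact/DS.
  by move=> z _; exact/Dg.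
- apply/continuous_subspace_setT/cont_onP.
  apply: (cont_on_comp (f:=fun z => gi (stereo_inv B z)) stc).
    apply: (cont_on_comp (f:=stereo_inv B) gic).
      exact/cont_on_continuous/continuous_stereo_inv.
    by move=> z _; exact/DS'.
  by move=> z _; exact/Dgi.
- move=> z; rewrite /G /Gi stK' ?giK ?stereo_invK//; last exact/Dg.
  exact/DS.
- move=> z; rewrite /G /Gi stK ?gK ?stereo_invK//; last exact/Dgi.
  exact/DS'.
- exact: (cont_on_comp (f:=phi) stc).
- exact: (cont_on_comp (f:=phi') stc).
- move=> z z' dz dz' /(congr1 (stereo_inv A)); rewrite !stK; [|exact: phiD..].
  exact: phi_inj.
- move=> z z' dz dz' /(congr1 (stereo_inv A)); rewrite !stK; [|exact: phiD'..].
  exact: phi_inj'.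
- rewrite Gst; last exact: phiD.
  by rewrite phi0; apply: stereo_neq0; rewrite ?B2//; [exact: gS|have [] := Dg v].
Qed.
End Spherical.

(** * Local homeomorphisms preserving the pair of axes *)

Section Quadrants.
Context {R : realType}.
Notation V2 := 'rV[R]_2.
Implicit Types (z w : V2) (tau : V2 -> V2).

Section OneMap.
Variables (e : R).
Hypothesis e0 : 0 < e.

Lemma bdisc_same_sign (f : V2 -> R) z w : cont_on (bdisc e) f ->
  bdisc e z -> bdisc e w ->
  (forall t : R, 0 <= t <= 1 -> f ((1 - t) *: z + t *: w) != 0) ->
  0 < f z * f w.
Proof.
move=> fc ze we h.
have := @segment_same_sign R (fun t => f ((1 - t) *: z + t *: w)) 0 1 ler01.
rewrite subr0 subrr !scale1r !scale0r addr0 add0r; apply => //.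
apply: (cont_on_comp (f:=fun t : R => (1 - t) *: z + t *: w) fc); first by cts.
by move=> t; rewrite /= in_itv => t01; exact: bdisc_convex.
Qed.

Definition axes_map tau :=
  [/\ cont_on (bdisc e) tau, tau 0 = 0,
      forall z w, bdisc e z -> bdisc e w -> tau z = tau w -> z = w &
      forall z, bdisc e z -> (tau z 0 0 * tau z 0 1 == 0) = (z 0 0 * z 0 1 == 0)].

Definition swap z : V2 := pt2 (z 0 1) (z 0 0).

Lemma axes_map_swap tau : axes_map tau -> axes_map (fun z => swap (tau z)).
Proof.
move=> [tc t0 ti ta]; split.
- by rewrite /swap; cts.
- by rewrite t0; apply: eq_rV2; rewrite [RHS]mxE ?pt2E0 ?pt2E1 mxE.
- move=> z w ze we h; apply: ti => //; apply: eq_rV2.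
    by have := congr1 (fun z : V2 => z 0 1) h; rewrite !pt2E1.
  by have := congr1 (fun z : V2 => z 0 0) h; rewrite !pt2E0.
- by move=> z ze; rewrite pt2E0 pt2E1 mulrC ta.
Qed.

Lemma bdisc0 : bdisc e (0 : V2).
Proof. by rewrite /bdisc /= /dot mul0mx mxE sqr_ge0. Qed.

Lemma bdisc_shrink z (t : R) : bdisc e z -> 0 <= t <= 1 -> bdisc e (t *: z).
Proof.
move=> ze t01; have := bdisc_convex bdisc0 ze t01.
by rewrite scaler0 add0r.
Qed.

Section Axes.
Variable tau : V2 -> V2.
Hypothesis taux : axes_map tau.

Let X z := tau z 0 0.
Let Y z := tau z 0 1.
(* On the axes, where [X] or [Y] vanishes, [f] is positive at the points sent
   to the first axis, negative at those sent to the second one. *)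
Let f z := X z ^+ 2 - Y z ^+ 2.

Let Xc : cont_on (bdisc e) X.
Proof. by have [? _ _ _] := taux; rewrite /X; cts. Qed.
Let Yc : cont_on (bdisc e) Y.
Proof. by have [? _ _ _] := taux; rewrite /Y; cts. Qed.

Let XY0 z : bdisc e z -> (X z * Y z == 0) = (z 0 0 * z 0 1 == 0).
Proof. by have [_ _ _ h] := taux; exact: h. Qed.

Let XYn z : bdisc e z -> z != 0 -> (X z != 0) || (Y z != 0).
Proof.
have [_ t0 ti _] := taux; move=> ze; apply: contraNT; rewrite negb_or !negbK.
move=> /andP[/eqP x0 /eqP y0]; apply/eqP/ti; rewrite // ?t0; first exact: bdisc0.
by apply: eq_rV2; rewrite mxE.
Qed.

Lemma axes_map_sqr_neq z : bdisc e z -> z != 0 -> z 0 0 * z 0 1 = 0 -> f z != 0.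
Proof.
move=> ze z0 zz; have := XYn ze z0; have := XY0 ze; rewrite zz eqxx mulf_eq0.
move=> /orP[]/eqP h; rewrite /f h ?eqxx ?orbF /= => hn.
  by rewrite expr0n sub0r oppr_eq0 sqrf_eq0.
by rewrite expr0n subr0 sqrf_eq0.
Qed.

Let f_pos z : bdisc e z -> z 0 0 * z 0 1 = 0 -> 0 < f z -> X z != 0 /\ Y z = 0.
Proof.
move=> ze zz fz; have := XY0 ze; rewrite zz eqxx mulf_eq0 => /orP[]/eqP h.
  by move: fz; rewrite /f h expr0n sub0r oppr_gt0 ltNge sqr_ge0.
by split => //; apply/eqP => x0; move: fz; rewrite /f h x0 subrr ltxx.
Qed.

Let f_ray z (t : R) : bdisc e z -> z 0 0 * z 0 1 = 0 -> 0 < f z ->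
  0 < t <= 1 -> 0 < f (t *: z).
Proof.
move=> ze zz fz /andP[t0 t1].
have z0 : z != 0.
  apply/eqP => h; have [/eqP + _] := f_pos ze zz fz; apply.
  by have [_ t_0 _ _] := taux; rewrite /X h t_0 mxE.
have tze : bdisc e (t *: z) by apply: bdisc_shrink; rewrite ?(ltW t0).
suff : 0 < f (t *: z) * f z by rewrite pmulr_lgt0.
apply: bdisc_same_sign => //; first by rewrite /f; cts.
move=> s /andP[s0 s1]; rewrite scalerA -scalerDl.
have k0 : 0 < (1 - s) * t + s by nra.
apply: axes_map_sqr_neq.
- by apply: bdisc_shrink => //; apply/andP; split; nra.
- by rewrite scaler_eq0 gt_eqF.
- by rewrite !mxE mulrACA zz mulr0.
Qed.

(* Two perpendicular half-axes are not sent to the same half-axis: their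
   images would overlap near the origin. *)
Let no_overlap z w : bdisc e z -> bdisc e w -> z 0 1 = 0 -> w 0 0 = 0 ->
  0 < f z -> 0 < f w -> X z * X w <= 0.
Proof.
move=> ze we z1 w0 fz fw; rewrite leNgt; apply/negP => xx.
have [zz ww] : z 0 0 * z 0 1 = 0 /\ w 0 0 * w 0 1 = 0.
  by rewrite z1 w0 mulr0 mul0r.
have [xz yz] := f_pos ze zz fz; have [xw yw] := f_pos we ww fw.
have [_ t0 ti _] := taux.
have X0 : X 0 = 0 by rewrite /X t0 mxE.
have zn : z 0 0 != 0.
  apply/eqP => h; move/eqP: xz; apply.
  by rewrite (_ : z = 0) ?X0//; apply: eq_rV2; rewrite mxE.
have wn : w 0 1 != 0.
  apply/eqP => h; move/eqP: xw; apply.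
  by rewrite (_ : w = 0) ?X0//; apply: eq_rV2; rewrite mxE.
have ray p q : bdisc e p -> bdisc e q -> p 0 0 * p 0 1 = 0 ->
    q 0 0 * q 0 1 = 0 -> 0 < f p -> 0 < f q -> 0 < X p * X q ->
    `|X p| <= `|X q| -> exists2 t : R, t != 0 & p = t *: q.
  move=> pe qe pp qq fp fq xpq le.
  have cc : {within `[0, 1], continuous (fun t : R => X (t *: q))}.
    apply/cont_onP; apply: (cont_on_comp (f:=fun t : R => t *: q) Xc); first by cts.
    by move=> t; rewrite /= in_itv => ?; exact: bdisc_shrink.
  have [] := @IVT R (fun t => X (t *: q)) 0 1 (X p) ler01 cc.
    rewrite scale0r scale1r X0 minEle maxEle.
    move: le; have [xp|xp] := lerP 0 (X p).
      have xq : 0 <= X q by nra.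
      by rewrite (ger0_norm xp) (ger0_norm xq) xq => ->; rewrite xp.
    have xq : X q < 0 by nra.
    rewrite (ltr0_norm xp) (ltr0_norm xq) (lt_geF xq) lerN2 => ->.
    by rewrite ltW.
  move=> t; rewrite in_itv /= => /andP[t_0 t_1] h.
  have tn : t != 0.
    apply/eqP => t00; have [/eqP xp _] := f_pos pe pp fp; apply: xp.
    by rewrite -h t00 scale0r.
  have tt : 0 < t <= 1 by rewrite lt0r tn t_0.
  exists t => //; apply: ti => //; first by apply: bdisc_shrink; rewrite ?t_0.
  have tq : bdisc e (t *: q) by apply: bdisc_shrink; rewrite ?t_0.
  have tqq : (t *: q) 0 0 * (t *: q) 0 1 = 0 by rewrite !mxE mulrACA qq mulr0.
  have [_ y1] := f_pos tq tqq (f_ray qe qq fq tt).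
  have [_ y2] := f_pos pe pp fp.
  by apply: eq_rV2; [exact: esym h|rewrite -/(Y p) -/(Y (t *: q)) y1 y2].
have [le|/ltW le] := lerP `|X z| `|X w|.
  have [t _ /(congr1 (fun z : V2 => z 0 0))] := ray z w ze we zz ww fz fw xx le.
  by rewrite mxE w0 mulr0 => /eqP; rewrite (negbTE zn).
rewrite mulrC in xx.
have [t _ /(congr1 (fun z : V2 => z 0 1))] := ray w z we ze ww zz fw fz xx le.
by rewrite mxE z1 mulr0 => /eqP; rewrite (negbTE wn).
Qed.

(** The quadrant between two perpendicular half-axes sent to the first axis would
    be sent to one side of the second axis, so that both half-axes would be sent
    to the same half-axis. *)
Lemma adjacent_half_axes z w : bdisc e z -> bdisc e w ->
  z 0 1 = 0 -> w 0 0 = 0 -> 0 < f z -> 0 < f w -> False.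
Proof.
move=> ze we z1 w0 fz fw.
have [zz ww] : z 0 0 * z 0 1 = 0 /\ w 0 0 * w 0 1 = 0.
  by rewrite z1 w0 mulr0 mul0r.
have := no_overlap ze we z1 w0 fz fw; rewrite leNgt => /negP; apply.
apply: bdisc_same_sign => // t /andP[t0 t1].
have [xz yz] := f_pos ze zz fz; have [xw yw] := f_pos we ww fw.
have [->|tn0] := eqVneq t 0; first by rewrite subr0 scale1r scale0r addr0.
have [->|tn1] := eqVneq t 1; first by rewrite subrr scale1r scale0r add0r.
have [_ tau0 _ _] := taux; have X0 : X 0 = 0 by rewrite /X tau0 mxE.
have zn : z 0 0 != 0.
  apply/eqP => h; move/eqP: xz; apply.
  by rewrite (_ : z = 0) ?X0//; apply: eq_rV2; rewrite mxE.
have wn : w 0 1 != 0.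
  apply/eqP => h; move/eqP: xw; apply.
  by rewrite (_ : w = 0) ?X0//; apply: eq_rV2; rewrite mxE.
have qe : bdisc e ((1 - t) *: z + t *: w) by apply: bdisc_convex; rewrite ?t0.
have := XY0 qe; rewrite !mxE z1 w0 !mulr0 addr0 add0r.
rewrite [in RHS]mulf_eq0 !(mulf_eq0 _ (z 0 0)) !(mulf_eq0 _ (w 0 1)).
rewrite subr_eq0 (eq_sym 1) (negbTE tn1) (negbTE tn0) (negbTE zn) (negbTE wn).
by rewrite mulf_eq0 => /norP[].
Qed.
End Axes.

(** Consecutive half-axes are sent to different axes. *)
Lemma axes_preserved_or_swapped tau : axes_map tau ->
  (forall z, bdisc e z -> (tau z 0 0 == 0) = (z 0 0 == 0) /\
                          (tau z 0 1 == 0) = (z 0 1 == 0)) \/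
  (forall z, bdisc e z -> (tau z 0 0 == 0) = (z 0 1 == 0) /\
                          (tau z 0 1 == 0) = (z 0 0 == 0)).
Proof.
move=> tx.
pose f tau z : R := tau z 0 0 ^+ 2 - tau z 0 1 ^+ 2.
pose p : V2 := pt2 e 0; pose q : V2 := pt2 0 e.
have pe : bdisc e p by rewrite /bdisc /= dot2E !(pt2E0, pt2E1) mulr0 addr0 expr2.
have qe : bdisc e q by rewrite /bdisc /= dot2E !(pt2E0, pt2E1) mulr0 add0r expr2.
have pn : p != 0.
  by apply/eqP => /(congr1 (fun z : V2 => z 0 0)) /eqP; rewrite pt2E0 mxE gt_eqF.
have qn : q != 0.
  by apply/eqP => /(congr1 (fun z : V2 => z 0 1)) /eqP; rewrite pt2E1 mxE gt_eqF.
have core sg : axes_map sg -> 0 < f sg p ->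
    forall z, bdisc e z -> (sg z 0 0 == 0) = (z 0 0 == 0) /\
                           (sg z 0 1 == 0) = (z 0 1 == 0).
  move=> sx fp.
  have fn z : bdisc e z -> z != 0 -> z 0 0 * z 0 1 = 0 -> f sg z != 0.
    by exact: axes_map_sqr_neq.
  have sw := axes_map_swap sx.
  have fsw z : f (fun z => swap (sg z)) z = - f sg z.
    by rewrite /f pt2E0 pt2E1 opprB.
  have fy z : bdisc e z -> z != 0 -> z 0 0 = 0 -> f sg z < 0.
    move=> ze z0 zz; rewrite lt_neqAle fn//; last by rewrite zz mul0r.
    rewrite leNgt; apply/negP => fz.
    exact: (adjacent_half_axes sx pe ze (pt2E1 _ _) zz fp fz).
  have fx z : bdisc e z -> z != 0 -> z 0 1 = 0 -> 0 < f sg z.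
    move=> ze z0 zz; rewrite lt_neqAle eq_sym fn//; last by rewrite zz mulr0.
    rewrite leNgt; apply/negP => fz.
    apply: (adjacent_half_axes sw ze qe zz (pt2E0 _ _)).
      by rewrite -/(f (fun z => swap (sg z)) z) fsw oppr_gt0.
    by rewrite -/(f (fun z => swap (sg z)) q) fsw oppr_gt0 fy// pt2E0.
  move=> z ze; have [_ s0 _ sa] := sx; have := sa z ze.
  have [->|z0] := eqVneq z 0; first by rewrite s0 !mxE eqxx.
  have [z00|z00] := eqVneq (z 0 0) 0.
    rewrite z00 mul0r eqxx mulf_eq0 => /orP[]/eqP h.
      have := fy z ze z0 z00; rewrite /f h expr0n sub0r oppr_lt0 exprn_even_gt0//=.
      move=> /negbTE ->; rewrite eqxx; split => //; apply/esym/negbTE.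
      by apply: contra z0 => /eqP z01; apply/eqP/eq_rV2; rewrite mxE.
    by have := fy z ze z0 z00; rewrite /f h expr0n subr0 ltNge sqr_ge0.
  have [z01|z01] := eqVneq (z 0 1) 0.
    rewrite z01 mulr0 eqxx mulf_eq0 => /orP[]/eqP h.
      by have := fx z ze z0 z01; rewrite /f h expr0n sub0r oppr_gt0 ltNge sqr_ge0.
    have := fx z ze z0 z01; rewrite /f h expr0n subr0 exprn_even_gt0//=.
    by move=> /negbTE ->; rewrite eqxx.
  rewrite !mulf_eq0 (negbTE z00) (negbTE z01) /=.
  by move=> /norP[/negbTE -> /negbTE ->].
have : f tau p != 0 by apply: (axes_map_sqr_neq tx) => //; rewrite pt2E1 mulr0.
rewrite neq_lt => /orP[fp|fp]; last by left; exact: core.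
have fq : 0 < f (fun z => swap (tau z)) p.
  by rewrite /f !pt2E0 !pt2E1 -opprB oppr_gt0.
right=> z ze; have := core _ (axes_map_swap tx) fq z ze.
by rewrite !pt2E0 !pt2E1 => -[-> ->].
Qed.

Definition axes_signs (c : R) tau := forall z, bdisc e z ->
  (0 < z 0 0 * z 0 1 -> 0 < c * (tau z 0 0 * tau z 0 1)) /\
  (z 0 0 * z 0 1 < 0 -> c * (tau z 0 0 * tau z 0 1) < 0).

(** Each coordinate of [tau] has a constant sign on each side of the axis where it
    vanishes, and the quadrants tell that the two signs agree up to a half-turn. *)
Lemma quadrants_rotated tau : axes_map tau -> axes_signs 1 tau ->
  (forall z, bdisc e z -> (tau z 0 0 == 0) = (z 0 0 == 0) /\
                          (tau z 0 1 == 0) = (z 0 1 == 0)) ->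
  exists2 s : R, s * s = 1 & forall z, bdisc e z ->
    (z 0 0 != 0 -> 0 < s * tau z 0 0 * z 0 0) /\
    (z 0 1 != 0 -> 0 < s * tau z 0 1 * z 0 1).
Proof.
move=> [tc _ _ _] sg ax; pose d := e / 2.
have d0 : 0 < d by rewrite divr_gt0.
have dd (a b : R) : a * a = 1 -> b * b = 1 -> bdisc e (pt2 (a * d) (b * d)).
  move=> aa bb; rewrite /bdisc /= dot2E !(pt2E0, pt2E1).
  rewrite !(mulrACA _ d) aa bb !mul1r /d; have := sqr_ge0 e; nra.
have m1 : -1 * -1 = 1 :> R by rewrite mulrNN mulr1.
have p1 : 1 * 1 = 1 :> R by rewrite mulr1.
have same i z w : bdisc e z -> bdisc e w -> 0 < z 0 i * w 0 i ->
    0 < tau z 0 i * tau w 0 i.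
  move=> ze we zw; apply: (@bdisc_same_sign (fun z => tau z 0 i)) => //.
    by cts.
  move=> t t01; have := ax _ (bdisc_convex ze we t01).
  suff n0 : ((1 - t) *: z + t *: w) 0 i != 0.
    case: (eqVneq i 0) n0 => [->|i0]; first by move=> n0 [-> _].
    suff -> : i = 1 by move=> n0 [_ ->].
    by case: i i0 {zw} => -[|[|//]] // ? _; apply: val_inj.
  rewrite !mxE; move: (z 0 i) (w 0 i) zw => a b ab.
  case/andP: t01 => t0 t1; apply/eqP => h.
  have : (1 - t) * (a * a) + t * (a * b) = 0.
    by transitivity (a * ((1 - t) * a + t * b)); [ring|rewrite h mulr0].
  have aa : 0 < a * a by rewrite -expr2 exprn_even_gt0//=; apply/eqP => a0; move: ab; rewrite a0 mul0r ltxx.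
  have h1 : 0 <= (1 - t) * (a * a) by rewrite mulr_ge0 ?subr_ge0// ltW.
  have [->|tn] := eqVneq t 0; first by rewrite subr0 mul1r mul0r addr0; lra.
  have h2 : 0 < t * (a * b) by rewrite mulr_gt0// lt0r tn.
  lra.
pose a := pt2 (1 * d) (1 * d); pose b := pt2 (1 * d) (-1 * d).
pose c := pt2 (-1 * d) (1 * d).
have [ae be ce] : [/\ bdisc e a, bdisc e b & bdisc e c] by split; exact: dd.
have [a1 _] := sg a ae; have [_ b1] := sg b be; have [_ c1] := sg c ce.
move: a1 b1 c1; rewrite !(pt2E0, pt2E1) !mul1r => a1 b1 c1.
have {}a1 : 0 < tau a 0 0 * tau a 0 1 by apply: a1; nra.
have {}b1 : tau b 0 0 * tau b 0 1 < 0 by apply: b1; nra.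
have {}c1 : tau c 0 0 * tau c 0 1 < 0 by apply: c1; nra.
have ab : 0 < tau a 0 0 * tau b 0 0 by apply: same; rewrite // !pt2E0; nra.
have ac : 0 < tau a 0 1 * tau c 0 1 by apply: same; rewrite // !pt2E1; nra.
have key (s x y k : R) : 0 < s * x -> 0 < x * y -> 0 < k -> 0 < s * y * k.
  move=> sx xy k0; rewrite pmulr_lgt0//.
  have : 0 < (s * y) * (x * x).
    by rewrite (_ : _ * _ = (s * x) * (x * y)); [exact: mulr_gt0|ring].
  rewrite pmulr_lgt0// -expr2 exprn_even_gt0//=.
  by apply/eqP => x0; move: sx; rewrite x0 mulr0 ltxx.
have main (s : R) : s * s = 1 -> 0 < s * tau a 0 0 -> forall z, bdisc e z ->
    (z 0 0 != 0 -> 0 < s * tau z 0 0 * z 0 0) /\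
    (z 0 1 != 0 -> 0 < s * tau z 0 1 * z 0 1).
  move=> ss sa z ze.
  have sa1 : 0 < s * tau a 0 1 by have := key s _ _ 1 sa a1 ltr01; rewrite mulr1.
  have sb : 0 < s * tau b 0 0 by have := key s _ _ 1 sa ab ltr01; rewrite mulr1.
  have sc : 0 < s * tau c 0 1 by have := key s _ _ 1 sa1 ac ltr01; rewrite mulr1.
  have b1' : 0 < tau b 0 0 * - tau b 0 1 by rewrite mulrN oppr_gt0.
  have c1' : 0 < tau c 0 1 * - tau c 0 0 by rewrite mulrN oppr_gt0 mulrC.
  have sb1 : 0 < - s * tau b 0 1.
    by have := key s _ _ 1 sb b1' ltr01; rewrite mulr1 mulrN mulNr.
  have sc1 : 0 < - s * tau c 0 0.
    by have := key s _ _ 1 sc c1' ltr01; rewrite mulr1 mulrN mulNr.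
  split; rewrite neq_lt => /orP[zs|zs].
  - have zc : 0 < tau c 0 0 * tau z 0 0.
      by apply: same; rewrite // !pt2E0; nra.
    have := key _ _ _ (- z 0 0) sc1 zc; rewrite oppr_gt0 => /(_ zs).
    by rewrite !mulNr mulrN opprK.
  - have za : 0 < tau a 0 0 * tau z 0 0.
      by apply: same; rewrite // !pt2E0; nra.
    exact: key sa za zs.
  - have zb : 0 < tau b 0 1 * tau z 0 1.
      by apply: same; rewrite // !pt2E1; nra.
    have := key _ _ _ (- z 0 1) sb1 zb; rewrite oppr_gt0 => /(_ zs).
    by rewrite !mulNr mulrN opprK.
  - have za : 0 < tau a 0 1 * tau z 0 1.
      by apply: same; rewrite // !pt2E1; nra.
    exact: key sa1 za zs.
have : tau a 0 0 != 0 by apply/eqP => x0; move: ab; rewrite x0 mul0r ltxx.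
rewrite neq_lt => /orP[an|ap].
  exists (-1) => //; apply: main => //; rewrite mulN1r oppr_gt0 //.
by exists 1 => //; apply: main; rewrite ?mul1r.
Qed.

(** When the axes are preserved, [tau] is compared with the identity or the
    half-turn, and when they are exchanged, with one of the two quarter-turns: the
    images of each point by [tau] and by this rotation are in the same quadrant. *)
Lemma rotation_pattern tau : axes_map tau ->
  (axes_signs 1 tau /\ forall z, bdisc e z ->
     (tau z 0 0 == 0) = (z 0 0 == 0) /\ (tau z 0 1 == 0) = (z 0 1 == 0)) \/
  (axes_signs (-1) tau /\ forall z, bdisc e z ->
     (tau z 0 0 == 0) = (z 0 1 == 0) /\ (tau z 0 1 == 0) = (z 0 0 == 0)) ->
  exists2 kap : V2, sphere R 2 kap &
    forall z (t : R), bdisc e z -> z != 0 -> 0 <= t <= 1 ->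
      (1 - t) *: tau z + t *: cmul kap z != 0.
Proof.
have comb (s x y t : R) : s * s = 1 -> 0 < s * x * y -> 0 <= t <= 1 ->
    (1 - t) * x + t * (s * y) != 0.
  move=> ss sxy /andP[t0 t1]; apply/eqP => h.
  have : (1 - t) * (s * x * y) + t * (y * y) = 0.
    transitivity (s * y * ((1 - t) * x + t * (s * y))); last by rewrite h mulr0.
    transitivity ((1 - t) * (s * x * y) + t * (s * s) * (y * y)); last by ring.
    by rewrite ss mulr1.
  have yy : 0 < y * y.
    by rewrite -expr2 exprn_even_gt0//=; apply/eqP => y0; move: sxy; rewrite y0 mulr0 ltxx.
  have h1 : 0 <= (1 - t) * (s * x * y) by rewrite mulr_ge0 ?subr_ge0// ltW.
  have [->|tn] := eqVneq t 0; first by rewrite subr0 mul1r mul0r addr0; lra.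
  have h2 : 0 < t * (y * y) by rewrite mulr_gt0// lt0r tn.
  lra.
have nz z : z != 0 -> z 0 0 != 0 \/ z 0 1 != 0.
  move=> z0; have [z00|] := eqVneq (z 0 0) 0; last by left.
  right; apply: contra z0 => /eqP z01; apply/eqP/eq_rV2; by rewrite mxE.
move=> tx [[sg ax]|[sg ax]].
  have [s ss h] := quadrants_rotated tx sg ax.
  exists (pt2 s 0); first by rewrite /sphere /= dot2E !(pt2E0, pt2E1) ss mulr0 addr0.
  move=> z t ze /nz nzz t01; have [h0 h1] := h z ze.
  apply/eqP => hh; case: nzz => n.
    have := congr1 (fun z : V2 => z 0 0) hh.
    rewrite [LHS]mxE [X in X + _]mxE [X in _ + X]mxE pt2E0 !(pt2E0, pt2E1) mul0r subr0 [RHS]mxE.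
    by apply/eqP/comb => //; exact: h0.
  have := congr1 (fun z : V2 => z 0 1) hh.
  rewrite [LHS]mxE [X in X + _]mxE [X in _ + X]mxE pt2E1 !(pt2E0, pt2E1) mul0r addr0 [RHS]mxE.
  by apply/eqP/comb => //; exact: h1.
pose sw z : V2 := pt2 (tau z 0 1) (- tau z 0 0).
have swx : axes_map sw.
  have [tc t0 ti ta] := tx; split.
  - by rewrite /sw; cts.
  - by rewrite /sw t0; apply: eq_rV2; rewrite [RHS]mxE ?pt2E0 ?pt2E1 mxE ?oppr0.
  - move=> z w ze we hh; apply: ti => //; apply: eq_rV2.
      by have := congr1 (fun z : V2 => z 0 1) hh; rewrite /sw !pt2E1 => /oppr_inj.
    by have := congr1 (fun z : V2 => z 0 0) hh; rewrite !pt2E0.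
  - by move=> z ze; rewrite pt2E0 pt2E1 mulrN oppr_eq0 mulrC ta.
have [||s ss h] := quadrants_rotated swx.
- move=> z ze; have [h1 h2] := sg z ze; rewrite pt2E0 pt2E1.
  by split => [/h1|/h2]; rewrite mulN1r mul1r mulrN (mulrC (tau z 0 1)).
- by move=> z ze; have [h1 h2] := ax z ze; rewrite pt2E0 pt2E1 oppr_eq0 h1 h2.
exists (pt2 0 s); first by rewrite /sphere /= dot2E !(pt2E0, pt2E1) ss mulr0 add0r.
move=> z t ze /nz nzz t01; have := h z ze; rewrite pt2E0 pt2E1 => -[h0 h1].
apply/eqP => hh; case: nzz => n.
  have := congr1 (fun z : V2 => z 0 1) hh.
  rewrite [LHS]mxE [X in X + _]mxE [X in _ + X]mxE pt2E1 !(pt2E0, pt2E1) mul0r add0r [RHS]mxE.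
  by apply/eqP/comb => //; exact: h0.
have := congr1 (fun z : V2 => z 0 0) hh.
rewrite [LHS]mxE [X in X + _]mxE [X in _ + X]mxE pt2E0 !(pt2E0, pt2E1) mul0r sub0r -mulNr [RHS]mxE.
apply/eqP/comb => //; first by rewrite mulrNN.
by have := h1 n; rewrite mulrN !mulNr.
Qed.
End OneMap.
End Quadrants.

(** * Matching links with the same diagram along rays *)

Section Matching.
Context {R : realType}.
Notation V3 := 'rV[R]_3.
Notation S2 := (sphere R 3).
Implicit Types (P : V3 -> R -> Prop) (u : V3) (r s : R).

(** By compactness of the interval of heights, a closed functional relation is
    a continuous function on a closed set, which extends by Tietze's theorem. *)
Lemma height_function (K : set (V3 * R)) (c C : R) : c <= C -> closed K ->
  (forall p, K p -> c <= p.2 <= C) ->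
  (forall u r r', K (u, r) -> K (u, r') -> r = r') ->
  exists f : V3 -> R, [/\ continuous f, forall u, c <= f u <= C &
    forall u r, K (u, r) -> f u = r].
Proof.
move=> cC Kcl Kb Kf.
pose X : set V3 := [set u | exists r, K (u, r)].
have [f0 f0P] : exists f0 : V3 -> R, forall u r, K (u, r) -> f0 u = r.
  have /choice [f0 h] : forall u, exists r, X u -> K (u, r).
    by move=> u; have [[r]|nX] := pselect (X u); [exists r|exists 0].
  exists f0 => u r ur; apply: (Kf u); last exact: ur.
  by apply: h; exists r.
have itv_cov := (compact_near_coveringP _).1 (@segment_compact R c C).
have K_in u r : K (u, r) -> `[c, C]%classic r.
  by move=> /Kb; rewrite /= in_itv.
have nK u r : ~ K (u, r) -> \forall r' \near r & u' \near u, ~ K (u', r').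
  move=> h; have /open_nbhs_nbhs : open_nbhs (u, r) (~` K).
    by split => //; rewrite openC.
  by move=> [[U V] /= [Uu Vr] UV]; exists (V, U) => //= -[r' u'] /= [Vr' Uu'];
    apply: (UV (u', r')).
have Xcl : closed X.
  rewrite -openC openE => u /= nX.
  have := itv_cov V3 (nbhs u) (fun u r => ~ K (u, r)) _.
  have : forall r, `[c, C]%classic r ->
      \forall r' \near r & u' \near u, ~ K (u', r').
    by move=> r _; apply: nK => Kur; apply: nX; exists r.
  move=> h /(_ _ h); apply: filterS => u' hu' [r Kr].
  exact: (hu' r (K_in _ _ Kr)).
have f0c : cont_on X f0.
  move=> u [r0 Ku] W; rewrite /= (f0P _ _ Ku) => Wr0.
  rewrite nbhs_simpl /= /within /=.
  have := itv_cov V3 (nbhs u) (fun u r => K (u, r) -> W r) _.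
  have : forall r, `[c, C]%classic r ->
      \forall r' \near r & u' \near u, K (u', r') -> W r'.
    move=> r _; have [rr|rr] := pselect (r = r0).
      exists (W, setT) => /=; first by split; [rewrite rr|exact: filterT].
      by move=> [r' u'] /= [].
    have /nK : ~ K (u, r) by move=> Kr; apply: rr; exact: Kf Kr Ku.
    by apply: filterS => p h /h.
  move=> h /(_ _ h); apply: filterS => u' hu' [r Kr].
  change (W (f0 u')); rewrite (f0P _ _ Kr).
  exact: (hu' r (K_in _ _ Kr)).
(* Tietze's theorem gives an extension bounded by [M], which is then clipped *)
pose M := `|c| + `|C| + 1.
have M0 : 0 < M by rewrite ltr_wpDl// addr_ge0.
have f0M u : X u -> `|f0 u| <= M.
  move=> [r Kr]; rewrite (f0P _ _ Kr); have /= /andP[h1 h2] := Kb _ Kr.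
  have := ler_norm C; have := ler_norm (- c); rewrite normrN.
  have := normr_ge0 C; have := normr_ge0 c.
  by rewrite /M ler_norml; move=> *; apply/andP; split; lra.
have [g [fg gc _]] := @continuous_bounded_extension V3 R
  (@pseudometric_normal R V3) X Xcl f0 M M0 ((cont_onP _ _).1 f0c) f0M.
exists (fun u => Num.max c (Num.min (g u) C)); split.
- apply/continuous_subspace_setT/cont_onP; cts.
  exact: (cont_on_continuous gc).
- by move=> u; rewrite le_max lexx/= ge_max cC/= ge_min lexx orbT.
- move=> u r Kr; have /= /andP[h1 h2] := Kb _ Kr.
  rewrite -fg ?inE; last by exists r.
  by rewrite (f0P _ _ Kr) (min_idPl h2) (max_idPr h1).
Qed.

(** The piecewise linear map fixing 0 and sending [p < q] to [p' < q'], of slope 1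
    above [q]. *)
Definition pl (p q p' q' r : R) := p' / p * Num.min r p +
  (q' - p') / (q - p) * (Num.min (Num.max r p) q - p) + (Num.max r q - q).

Section PiecewiseLinear.
Variables (p q p' q' : R).
Hypotheses (p0 : 0 < p) (pq : p < q) (p'0 : 0 < p') (pq' : p' < q').

Let k1 : 0 < p' / p. Proof. exact: divr_gt0. Qed.
Let k2 : 0 < (q' - p') / (q - p). Proof. by rewrite divr_gt0 ?subr_gt0. Qed.

Lemma pl0 : pl p q p' q' 0 = 0.
Proof.
rewrite /pl (min_idPl (ltW p0)) (max_idPr (ltW p0)) (min_idPl (ltW pq)).
by rewrite (max_idPr (ltW (lt_trans p0 pq))) !subrr !mulr0 !addr0.
Qed.

Lemma pl_lower : pl p q p' q' p = p'.
Proof.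
rewrite /pl minxx maxxx (min_idPl (ltW pq)) (max_idPr (ltW pq)) !subrr mulr0.
by rewrite !addr0 divfK// gt_eqF.
Qed.

Lemma pl_upper : pl p q p' q' q = q'.
Proof.
rewrite /pl (min_idPr (ltW pq)) (max_idPl (ltW pq)) minxx maxxx subrr addr0.
by rewrite !divfK ?gt_eqF ?subr_gt0//; ring.
Qed.

Lemma pl_lt r s : r < s -> pl p q p' q' r < pl p q p' q' s.
Proof.
move=> rs; rewrite /pl; move: (p' / p) k1 ((q' - p') / (q - p)) k2 => a a0 b b0.
have hA : Num.min r p <= Num.min s p by rewrite le_min !ge_min (ltW rs) lexx orbT.
have hM : Num.max r p <= Num.max s p by rewrite ge_max !le_max (ltW rs) lexx orbT.
have hB : Num.min (Num.max r p) q <= Num.min (Num.max s p) q.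
  by rewrite le_min !ge_min hM lexx orbT.
have hC : Num.max r q <= Num.max s q by rewrite ge_max !le_max (ltW rs) lexx orbT.
have hA1 := ler_wpM2l (ltW a0) hA; have hB1 := ler_wpM2l (ltW b0) hB.
rewrite !mulrBr.
case: (boolP (r < p)) => [h1|]; last rewrite -leNgt => h1.
  have hA2 : a * Num.min r p < a * Num.min s p.
    by rewrite ltr_pM2l// (min_idPl (ltW h1)) lt_min rs.
  by lra.
case: (boolP (r < q)) => [h2|]; last rewrite -leNgt => h2.
  have hB2 : b * Num.min (Num.max r p) q < b * Num.min (Num.max s p) q.
    by rewrite ltr_pM2l// (max_idPl h1) (min_idPl (ltW h2)) lt_min lt_max rs.
  by lra.
have hC2 : Num.max r q < Num.max s q by rewrite (max_idPl h2) lt_max rs.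
by lra.
Qed.

Lemma pl_unbounded s : exists r r', pl p q p' q' r <= s <= pl p q p' q' r'.
Proof.
have a0 : 0 < p / p' by rewrite divr_gt0.
exists (Num.min 0 (p / p' * s)), (Num.max q (s + q)); apply/andP; split.
  rewrite /pl; have h0 : Num.min 0 (p / p' * s) <= 0 by rewrite ge_min lexx.
  have h1 : Num.min 0 (p / p' * s) <= p / p' * s by rewrite ge_min lexx orbT.
  have hp := le_trans h0 (ltW p0); have hq := le_trans hp (ltW pq).
  rewrite (min_idPl hp) (max_idPr hp) (min_idPl (ltW pq)) (max_idPr hq) !subrr.
  rewrite mulr0 !addr0; apply: le_trans (ler_wpM2l (ltW k1) h1) _.
  by rewrite mulrA mulrA mulfVK ?gt_eqF// divff ?mul1r ?gt_eqF.
have h0 : q <= Num.max q (s + q) by rewrite le_max lexx.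
have h1 : s + q <= Num.max q (s + q) by rewrite le_max lexx orbT.
have hp := le_trans (ltW pq) h0.
rewrite /pl (min_idPr hp) (max_idPl hp) (min_idPr h0) (max_idPl h0).
rewrite !divfK ?gt_eqF ?subr_gt0//. have := lt_trans p'0 pq'; move: h1; move: (Num.max _ _) => M h1 q0; lra.
Qed.
End PiecewiseLinear.

(** A continuous family of increasing homeomorphisms of the line fixing 0,
    parametrized by [A].  Negative heights are included so that the inverse
    family can be treated without a special case at 0. *)
Definition fibre_map (A : set V3) (lam : V3 * R -> R) :=
  cont_on [set p | A p.1] lam /\ forall u, A u ->
  [/\ lam (u, 0) = 0, forall r s, r < s -> lam (u, r) < lam (u, s) &
      forall s, exists r r', lam (u, r) <= s <= lam (u, r')].

Lemma fibre_map_inj A lam u r s : fibre_map A lam -> A u ->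
  lam (u, r) = lam (u, s) -> r = s.
Proof.
move=> [_ h] Au e; have [_ mono _] := h u Au.
by case: (ltgtP r s) => // /mono; rewrite e ltxx.
Qed.

Lemma fibre_map_onto A lam u s : fibre_map A lam -> A u ->
  exists r, lam (u, r) = s.
Proof.
move=> [lc h] Au; have [_ mono unb] := h u Au.
have [r [r' /andP[h1 h2]]] := unb s.
have rr : r <= r'.
  by rewrite leNgt; apply/negP => /mono; rewrite ltNge (le_trans h1).
have lcu : {within `[r, r'], continuous (fun t => lam (u, t))}.
  by apply/cont_onP; apply: (cont_on_comp (f:=fun t => (u, t)) lc); [cts|].
have [] := @IVT R (fun t => lam (u, t)) r r' s rr lcu.
  by rewrite minEle maxEle (le_trans h1 h2) h1 h2.
by move=> t _ <-; exists t.
Qed.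

(** [P u r] is to be read as: the link has a point at height [r] over [u]. *)
Definition heights (P : V3 -> R -> Prop) (c C : R) :=
  [/\ 0 < c, c <= C, closed [set p | S2 p.1 /\ P p.1 p.2] &
      forall u r, S2 u -> P u r -> c <= r <= C].

Definition split_at P (m : R) u :=
  (forall r s, P u r -> P u s -> r < m -> s < m -> r = s) /\
  (forall r s, P u r -> P u s -> m < r -> m < s -> r = s).

(** The strands passing below [m1] for [P1] and below [m2] for [P2] have the same
    projection near [u0], and so do those passing above. *)
Definition locally_matched P1 P2 u0 := exists m1 m2 : R,
  [/\ 0 < m1, 0 < m2, ~ P1 u0 m1, ~ P2 u0 m2 & \forall u \near u0, S2 u ->
  [/\ split_at P1 m1 u, split_at P2 m2 u,
     (exists2 r, P1 u r & r < m1) <-> (exists2 r, P2 u r & r < m2) &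
     (exists2 r, P1 u r & m1 < r) <-> (exists2 r, P2 u r & m2 < r)]].

Section Branch.
Variables (P : V3 -> R -> Prop) (c C : R) (u0 : V3) (m : R).
Hypotheses (Ph : heights P c C) (m0 : 0 < m) (Pm : ~ P u0 m).

(** As the relation is closed, it has no height close to [m] over a neighborhood of
    [u0]; its parts below and above [m] are then closed as well, and
    [height_function] applies to each of them. *)
Lemma height_branches : (\forall u \near u0, S2 u -> split_at P m u) ->
  exists f g : V3 -> R, [/\ continuous f /\ continuous g,
    forall u, [/\ 0 < f u, f u < m & m < g u] &
    \forall u \near u0, S2 u -> ~ P u m /\
      forall r, P u r -> (r < m -> f u = r) /\ (m < r -> g u = r)].
Proof.
move=> sp; have [c0 cC Pcl Pb] := Ph.
have : \forall u \near u0 & r \near m, S2 u -> ~ P u r.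
  have : open_nbhs (u0, m) (~` [set p | S2 p.1 /\ P p.1 p.2]).
    by split; [rewrite openC|move=> [_ /=]].
  by move=> /open_nbhs_nbhs; apply: filterS => -[u r] /= h Su Pu; apply: h.
move=> [[U V] /= [Uu Vm] UV].
have /nbhs_ballP[d /= d0 dU] : nbhs u0 (U `&` [set u | S2 u -> split_at P m u]).
  exact: filterI.
have /nbhs_ballP[e' /= e'0 e'V] := Vm.
(* [e <= m / 2] keeps the lower branch positive *)
pose e := Num.min (e' / 2) (m / 2).
have e0 : 0 < e by rewrite lt_min !divr_gt0.
have em : e <= m / 2 by rewrite ge_min lexx orbT.
have eV r : `|m - r| <= e -> V r.
  move=> h; apply: e'V; rewrite /ball /=; apply: le_lt_trans h _.
  by rewrite gt_min; apply/orP; left; lra.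
pose B : set V3 := [set u | `|u0 - u| <= d / 2].
have Bcl : closed B.
  apply: (@closed_preimage_cont _ _ (fun u : V3 => `|u0 - u|) [set x | x <= d / 2]).
    by apply: cont_on_norm; cts.
  exact: closed_le.
have BU u : B u -> U u /\ (S2 u -> split_at P m u).
  move=> h; apply: dU; rewrite -ball_normE /=; apply: le_lt_trans h _; lra.
have Bm u r : B u -> S2 u -> P u r -> e < `|m - r|.
  move=> Bu Su Pu; rewrite ltNge; apply/negP => /eV Vr.
  have [Uu' _] := BU u Bu; exact: (UV (u, r) (conj Uu' Vr) Su Pu).
pose K0 : set (V3 * R) := [set p | S2 p.1 /\ P p.1 p.2] `&` [set p | B p.1].
have K0cl : closed K0.
  by apply: closedI => //; apply: (@closed_preimage_cont _ _ fst B) => //; cts.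
pose K1 := K0 `&` [set p | p.2 <= m].
pose K2 := K0 `&` [set p | m <= p.2].
have K1cl : closed K1.
  apply: closedI => //; apply: (@closed_preimage_cont _ _ snd [set x | x <= m]).
    by cts.
  exact: closed_le.
have K2cl : closed K2.
  apply: closedI => //; apply: (@closed_preimage_cont _ _ snd [set x | m <= x]).
    by cts.
  exact: closed_ge.
have K1lt u r : K1 (u, r) -> r <= m - e.
  move=> [[[/= Su Pu] Bu] rm]; have := Bm u r Bu Su Pu.
  by rewrite ger0_norm ?subr_ge0//; lra.
have K2lt u r : K2 (u, r) -> m + e <= r.
  move=> [[[/= Su Pu] Bu] rm]; have := Bm u r Bu Su Pu.
  by rewrite ler0_norm ?subr_le0//; lra.
have [f [fc fb fK]] : exists f : V3 -> R, [/\ continuous f,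
    forall u, Num.min c (m / 2) <= f u <= m - e & forall u r, K1 (u, r) -> f u = r].
  apply: height_function => //.
  - by rewrite ge_min; apply/orP; right; lra.
  - move=> [u r] h /=; rewrite (K1lt u r h) andbT.
    by have [[[/= Su Pu] _] _] := h; rewrite ge_min; have /andP[-> _] := Pb u r Su Pu.
  - move=> u r r' h h'; have := K1lt _ _ h; have := K1lt _ _ h'.
    have [[[/= Su Pu] Bu] _] := h; have [[[/= _ Pu'] _] _] := h' => l l'.
    have [_ /(_ Su) [sl _]] := BU u Bu; apply: sl => //; lra.
have [g [gc gb gK]] : exists g : V3 -> R, [/\ continuous g,
    forall u, m + e <= g u <= Num.max C (m + e) & forall u r, K2 (u, r) -> g u = r].
  apply: height_function => //.
  - by rewrite le_max lexx orbT.
  - move=> [u r] h /=; rewrite (K2lt u r h) /=.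
    by have [[[/= Su Pu] _] _] := h; rewrite le_max; have /andP[_ ->] := Pb u r Su Pu.
  - move=> u r r' h h'; have := K2lt _ _ h; have := K2lt _ _ h'.
    have [[[/= Su Pu] Bu] _] := h; have [[[/= _ Pu'] _] _] := h' => l l'.
    have [_ /(_ Su) [_ sl]] := BU u Bu; apply: sl => //; lra.
exists f, g; split => //.
  move=> u; have /andP[f1 f2] := fb u; have /andP[g1 _] := gb u; split; [|lra|lra].
  by apply: lt_le_trans f1; rewrite lt_min c0/=; lra.
apply/nbhs_ballP; exists (d / 2) => /=; first by rewrite divr_gt0.
move=> u; rewrite -ball_normE /= => /ltW Bu Su; split.
  by move=> Pu; have := Bm u m Bu Su Pu; rewrite subrr normr0 ltNge ltW.
by move=> r Pu; split => [/ltW rm|/ltW rm]; [apply: fK|apply: gK].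
Qed.
End Branch.

Definition matches P1 P2 (lam : V3 * R -> R) u :=
  forall r, P1 u r <-> P2 u (lam (u, r)).

(** The lower and upper branches of [P1] are sent to those of [P2] by a piecewise
    linear map. *)
Lemma local_matching P1 P2 c C c' C' u0 : heights P1 c C -> heights P2 c' C' ->
  S2 u0 -> locally_matched P1 P2 u0 ->
  exists2 lam, fibre_map setT lam &
    \forall u \near u0, S2 u -> matches P1 P2 lam u.
Proof.
move=> h1 h2 Su0 [m1 [m2 [m10 m20 n1 n2 lm]]].
have [|f1 [g1 [[f1c g1c] b1 br1]]] := height_branches h1 m10 n1.
  by apply: filterS lm => u h /h[].
have [|f2 [g2 [[f2c g2c] b2 br2]]] := height_branches h2 m20 n2.
  by apply: filterS lm => u h /h[].
pose lam (p : V3 * R) := pl (f1 p.1) (g1 p.1) (f2 p.1) (g2 p.1) p.2.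
have fm : fibre_map setT lam.
  split.
    have cc (f : V3 -> R) : continuous f -> cont_on setT (fun p : V3 * R => f p.1).
      by move=> fc; apply: (cont_onT_comp (f:=fst) fc); cts.
    rewrite (_ : [set p | setT p.1] = setT); last exact/seteqP.
    rewrite /lam /pl; cts; try exact: cc.
      by move=> p _; have [? _ _] := b1 p.1; rewrite gt_eqF.
    by move=> p _; have [_ l l'] := b1 p.1; rewrite subr_eq0 gt_eqF//; exact: lt_trans l l'.
  move=> u _; have [? a a'] := b1 u; have [? b b'] := b2 u.
  have l1 : f1 u < g1 u by exact: lt_trans a a'.
  have l2 : f2 u < g2 u by exact: lt_trans b b'.
  split; rewrite /lam /=; [exact: pl0|by move=> r s; exact: pl_lt|].
  by move=> s; exact: pl_unbounded.
exists lam => //; near=> u => Su.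
have [nm1 hb1] : ~ P1 u m1 /\
   forall r, P1 u r -> (r < m1 -> f1 u = r) /\ (m1 < r -> g1 u = r).
  by have := near br1 u; apply.
have [nm2 hb2] : ~ P2 u m2 /\
   forall r, P2 u r -> (r < m2 -> f2 u = r) /\ (m2 < r -> g2 u = r).
  by have := near br2 u; apply.
have [_ _ lo up] : [/\ split_at P1 m1 u, split_at P2 m2 u,
     (exists2 r, P1 u r & r < m1) <-> (exists2 r, P2 u r & r < m2) &
     (exists2 r, P1 u r & m1 < r) <-> (exists2 r, P2 u r & m2 < r)].
  by have := near lm u; apply.
have [p1 p2 p3] := b1 u; have [q1 q2 q3] := b2 u.
have l1 : f1 u < g1 u by exact: lt_trans p2 p3.
have l2 : f2 u < g2 u by exact: lt_trans q2 q3.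
have lamf : lam (u, f1 u) = f2 u by exact: pl_lower.
have lamg : lam (u, g1 u) = g2 u by exact: pl_upper.
move=> r; split.
  move=> Pr; have [hl hu] := hb1 r Pr; case: (ltgtP r m1) => rm.
  - have [|s Ps sm] := lo.1; first by exists r.
    have [hs _] := hb2 s Ps.
    by rewrite -(hl rm) lamf hs.
  - have [|s Ps sm] := up.1; first by exists r.
    have [_ hs] := hb2 s Ps.
    by rewrite -(hu rm) lamg hs.
  - by move: Pr; rewrite rm.
move=> Ps; have [hl hu] := hb2 _ Ps; case: (ltgtP (lam (u, r)) m2) => sm.
- have [|s Pr rm] := lo.2; first by exists (lam (u, r)).
  have [hs _] := hb1 s Pr; suff -> : r = s by [].
  apply: (fibre_map_inj fm (I : setT u)).
  by rewrite -(hs rm) lamf hl.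
- have [|s Pr rm] := up.2; first by exists (lam (u, r)).
  have [_ hs] := hb1 s Pr; suff -> : r = s by [].
  apply: (fibre_map_inj fm (I : setT u)).
  by rewrite -(hs rm) lamg hu.
- by move: Ps; rewrite sm.
Unshelve. all: by end_near. Qed.

(** If [a] were smaller than [b] at [r], then [P2] would have three heights over
    [u]: the values of [a] and [b] at [r], and that of [a] at the point sent by [b]
    to [a (u, r)]. *)
Lemma matching_unique P1 P2 A (a b : V3 * R -> R) u (m : R) r : A u ->
  fibre_map A a -> fibre_map A b -> split_at P2 m u -> ~ P2 u m ->
  matches P1 P2 a u -> matches P1 P2 b u -> P1 u r -> a (u, r) = b (u, r).
Proof.
move=> Au.
suff half (f g : V3 * R -> R) : fibre_map A f -> fibre_map A g ->
    split_at P2 m u -> ~ P2 u m -> matches P1 P2 f u -> matches P1 P2 g u ->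
    P1 u r -> ~ f (u, r) < g (u, r).
  move=> fa fb sp nm ma mb Pr.
  by case: (ltgtP (a (u, r)) (b (u, r))) => // /half h; exfalso; exact: h.
move=> ff fg [sl su] nm mf mg Pr lt.
have [r1 e] := fibre_map_onto (f (u, r)) fg Au.
have [_ /(_ u Au) [_ monog _]] := fg; have [_ /(_ u Au) [_ monof _]] := ff.
have r1r : r1 < r.
  rewrite ltNge; apply/negP; rewrite le_eqVlt => /orP[/eqP rr|/monog].
    by move: lt; rewrite -e rr ltxx.
  by rewrite e ltNge (ltW lt).
have P2f : P2 u (f (u, r)) by exact/mf.
have P2g : P2 u (g (u, r)) by exact/mg.
have P1r1 : P1 u r1 by apply/mg; rewrite e.
have P2f1 : P2 u (f (u, r1)) by exact/mf.
have lt1 := monof _ _ r1r.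
case: (ltgtP (f (u, r)) m) => h.
- have := sl _ _ P2f1 P2f (lt_trans lt1 h) h => e1; by rewrite e1 ltxx in lt1.
- have := su _ _ P2f P2g h (lt_trans h lt) => e1; by rewrite e1 ltxx in lt.
- by apply: nm; rewrite -h.
Qed.

Section WeightedSums.
Context {I : eqType}.
Variables (s : seq I) (chi : I -> R).
Hypothesis chi0 : forall i, 0 <= chi i.
Hypothesis chis : 0 < \sum_(i <- s) chi i.

Lemma weighted_lt (a b : I -> R) : (forall i, a i < b i) ->
  \sum_(i <- s) chi i * a i < \sum_(i <- s) chi i * b i.
Proof.
move=> ab; rewrite lt_neqAle; apply/andP; split; last first.
  by apply: ler_sum => i _; apply: ler_wpM2l => //; exact: ltW.
apply/eqP => e; have : \sum_(i <- s) chi i * (b i - a i) == 0.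
  by rewrite (eq_bigr _ (fun i _ => mulrBr _ _ _)) sumrB e subrr.
rewrite psumr_eq0; last by move=> i _; rewrite mulr_ge0// subr_ge0 ltW.
move=> /allP h; suff : \sum_(i <- s) chi i = 0.
  by move=> h0; have := chis; rewrite h0 ltxx.
rewrite big_seq big1// => i si; have := h i si; rewrite /= mulf_eq0.
by rewrite subr_eq0 (gt_eqF (ab i)) orbF => /eqP.
Qed.

Lemma weighted_le (a b : I -> R) : (forall i, i \in s -> a i <= b i) ->
  \sum_(i <- s) chi i * a i <= \sum_(i <- s) chi i * b i.
Proof.
move=> ab; rewrite big_seq [leRHS]big_seq; apply: ler_sum => i si.
by apply: ler_wpM2l => //; exact: ab.
Qed.

Lemma weighted_cst (a : I -> R) (v : R) :
  (forall i, i \in s -> 0 < chi i -> a i = v) ->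
  \sum_(i <- s) chi i * a i = (\sum_(i <- s) chi i) * v.
Proof.
move=> av; rewrite mulr_suml big_seq [RHS]big_seq; apply: eq_bigr => i si.
have := chi0 i; rewrite le_eqVlt => /orP[/eqP <-|h]; first by rewrite !mul0r.
by rewrite (av i).
Qed.
End WeightedSums.

(** Increasing maps matching the heights form a convex set, since a matching
    is unique over each point; local matchings are glued by an average. *)
Lemma global_matching P1 P2 c C c' C' : heights P1 c C -> heights P2 c' C' ->
  (forall u, S2 u -> locally_matched P1 P2 u) ->
  exists2 lam, fibre_map S2 lam & forall u, S2 u -> matches P1 P2 lam u.
Proof.
move=> h1 h2 lm.
have fsnd : fibre_map setT snd.
  split; first by cts.
  by move=> u _; split => // t; exists t, t; rewrite /= lexx.
have /choice [lam0 lam0P] : forall u0, exists p : (V3 * R -> R) * R,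
    fibre_map setT p.1 /\ (S2 u0 -> 0 < p.2 /\
      forall u, `|u0 - u| < p.2 -> S2 u -> matches P1 P2 p.1 u).
  move=> u0; have [Su0|nS] := pselect (S2 u0); last by exists (snd, 0).
  have [lam fl /nbhs_ballP[d /= d0 hd]] := local_matching h1 h2 Su0 (lm u0 Su0).
  exists (lam, d); split => // _; split => // u du; apply: hd.
  by rewrite -ball_normE.
pose lam_ u := (lam0 u).1; pose d_ u := (lam0 u).2.
have [DF DS Dcov] : exists2 D : {fset V3}, {subset D <= S2} &
    S2 `<=` cover [set` D] (fun u0 => ball u0 (d_ u0)).
  have := @compact_sphere R 3; rewrite compact_cover; apply.
    by move=> u0 Su0; apply: ball_open; have [_ /(_ Su0)[]] := lam0P u0.
  by move=> u Su; exists u => //; apply: ballxx; have [_ /(_ Su)[]] := lam0P u.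
pose s := enum_fset DF.
have sS i : i \in s -> S2 i by move=> /DS; rewrite inE.
pose chi i (u : V3) := Num.max 0 (d_ i - `|i - u|).
have chi0 u i : 0 <= chi i u by rewrite le_max lexx.
have chi_ball i u : 0 < chi i u -> `|i - u| < d_ i.
  by rewrite lt_max ltxx subr_gt0.
pose den u := \sum_(i <- s) chi i u.
have den_i u : S2 u -> exists2 i, i \in s & 0 < chi i u.
  move=> /Dcov [i /= iD]; rewrite -ball_normE /= => h; exists i => //.
  by rewrite lt_max subr_gt0 h orbT.
have den0 u : S2 u -> 0 < den u.
  move=> /den_i [i si ci]; rewrite /den (big_rem i)//=.
  by rewrite ltr_pwDl// sumr_ge0.
have lamF i : fibre_map setT (lam_ i) by have [] := lam0P i.
have lamM i u : i \in s -> 0 < chi i u -> S2 u -> matches P1 P2 (lam_ i) u.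
  move=> /sS Si /chi_ball ci Su; have [_ /(_ Si)[_]] := lam0P i; exact.
pose lam (p : V3 * R) := (\sum_(i <- s) chi i p.1 * lam_ i p) / den p.1.
have lamm u r i j : S2 u -> P1 u r -> i \in s -> j \in s -> 0 < chi i u ->
    0 < chi j u -> lam_ i (u, r) = lam_ j (u, r).
  move=> Su Pr si sj ci cj.
  have [m [nm sp]] : exists m, ~ P2 u m /\ split_at P2 m u.
    have [m1 [m2 [_ _ _ nm2 /nbhs_singleton /(_ Su) [_ sp _ _]]]] := lm u Su.
    by exists m2.
  apply: (@matching_unique P1 P2 setT _ _ u m r) => //; exact: lamM.
have lamE u r i : S2 u -> P1 u r -> i \in s -> 0 < chi i u ->
    lam (u, r) = lam_ i (u, r).
  move=> Su Pr si ci; rewrite /lam /= (weighted_cst (v:=lam_ i (u, r)) (chi0 u)).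
    by rewrite mulrC mulKf// gt_eqF// den0.
  by move=> j sj cj; exact: lamm.
have fm : fibre_map S2 lam.
  have chic i : cont_on [set p : V3 * R | S2 p.1] (fun p => chi i p.1).
    by rewrite /chi; cts; apply: cont_on_norm; cts.
  split.
    rewrite /lam; apply: cont_onM; last apply: cont_onV.
    - apply: cont_on_sum => i; apply: cont_onM; first exact: chic.
      by have [lc _] := lamF i; apply: cont_onW lc => p _.
    - by move=> p /= /den0 h; rewrite gt_eqF.
    - by apply: cont_on_sum => i; exact: chic.
  move=> u Su; have d0 := den0 u Su; split.
  - rewrite /lam big1 ?mul0r// => i _.
    by have [_ /(_ u I) [-> _ _]] := lamF i; rewrite mulr0.
  - move=> r r' rr; rewrite /lam /= ltr_pM2r ?invr_gt0//.
    apply: weighted_lt => // i.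
    by have [_ /(_ u I) [_ mono _]] := lamF i; exact: mono.
  - move=> v; have bounds (t : seq V3) : exists r r', forall i, i \in t ->
        lam_ i (u, r) <= v <= lam_ i (u, r').
      elim: t => [|i t [r [r' rr]]]; first by exists 0, 0.
      have [_ /(_ u I) [_ mono /(_ v) [q [q' /andP[q1 q2]]]]] := lamF i.
      have wmono j a b : a <= b -> lam_ j (u, a) <= lam_ j (u, b).
        have [_ /(_ u I) [_ mj _]] := lamF j.
        by rewrite le_eqVlt => /orP[/eqP ->//|/mj/ltW].
      exists (Num.min q r), (Num.max q' r') => j; rewrite inE => /orP[/eqP ->|/rr].
        apply/andP; split; [apply: le_trans q1|apply: le_trans q2 _].
          by apply: wmono; rewrite ge_min lexx.
        by apply: wmono; rewrite le_max lexx.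
      move=> /andP[r1 r2]; apply/andP; split.
        by apply: le_trans r1; apply: wmono; rewrite ge_min lexx orbT.
      by apply: le_trans r2 _; apply: wmono; rewrite le_max lexx orbT.
    have [r [r' rr]] := bounds s; exists r, r'; rewrite /lam /=.
    rewrite ler_pdivrMr// ler_pdivlMr// mulrC /den.
    rewrite -(weighted_cst (chi0 u) (a := fun=> v)) //.
    by apply/andP; split; apply: weighted_le => // i /rr /andP[].
exists lam => // u Su r; have [i si ci] := den_i u Su.
have mi := lamM i u si ci Su.
split=> [Pr|Ps]; first by rewrite (lamE u r i)//; exact/mi.
have [r1 e] := fibre_map_onto (lam (u, r)) (lamF i) (I : setT u).
have Pr1 : P1 u r1 by apply/mi; rewrite e.
suff -> : r = r1 by [].
by apply: (fibre_map_inj fm Su); rewrite [RHS](lamE u r1 i).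
Qed.
End Matching.

(** * Polar homeomorphisms of space *)

Section Polar.
Context {R : realType}.
Notation V3 := 'rV[R]_3.
Notation S2 := (sphere R 3).
Implicit Types (x y u : V3) (r s : R) (th ti : V3 -> V3) (lam : V3 * R -> R).

Definition enorm x : R := Num.sqrt (dot x x).

Definition dir x : V3 := (enorm x)^-1 *: x.

Lemma enorm_gt0 x : (0 < enorm x) = (x != 0).
Proof. by rewrite sqrtr_gt0 dot_gt0. Qed.

Lemma enormZ r u : S2 u -> 0 <= r -> enorm (r *: u) = r.
Proof.
move=> Su r0; rewrite /enorm dotZl dotZr (Su : dot u u = 1) mulr1 -expr2.
by rewrite sqrtr_sqr ger0_norm.
Qed.

Lemma dirZ r u : S2 u -> 0 < r -> dir (r *: u) = u.
Proof.
by move=> Su r0; rewrite /dir enormZ ?ltW// scalerA mulVf ?scale1r// gt_eqF.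
Qed.

Lemma enorm_dir x : x = enorm x *: dir x.
Proof.
have [->|x0] := eqVneq x 0; first by rewrite /dir !scaler0.
by rewrite /dir scalerA divff ?scale1r// gt_eqF// enorm_gt0.
Qed.

Lemma dir_sphere x : x != 0 -> S2 (dir x).
Proof.
move=> x0; have ss : dot x x = enorm x ^+ 2 by rewrite sqr_sqrtr ?dot_ge0.
rewrite /sphere /= /dir dotZl dotZr ss; field.
by rewrite gt_eqF// enorm_gt0.
Qed.

Lemma cont_on_enorm (A : set V3) : cont_on A enorm.
Proof. by rewrite /enorm; cts. Qed.

Lemma cont_on_dir : cont_on [set x : V3 | x != 0] dir.
Proof.
rewrite /dir; cts; last exact: cont_on_enorm.
by move=> x /= x0; rewrite gt_eqF// enorm_gt0.
Qed.

Definition polar th lam x : V3 :=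
  if x == 0 then 0 else lam (dir x, enorm x) *: th (dir x).

Lemma polarZ th lam u r : S2 u -> 0 < r ->
  polar th lam (r *: u) = lam (u, r) *: th u.
Proof.
move=> Su r0; rewrite /polar scaler_eq0 gt_eqF//= (negbTE (sphere_neq0 Su)).
by rewrite dirZ// enormZ// ltW.
Qed.

Lemma fibre_map_gt0 (A : set V3) lam u r : fibre_map A lam -> A u -> (0 < lam (u, r)) = (0 < r).
Proof.
move=> [_ h] Au; have [l0 mono _] := h u Au.
case: (ltgtP 0 r) => [/mono|/mono|<-]; rewrite l0 ?ltxx// => h1.
by rewrite ltNge (ltW h1).
Qed.

(** Near the origin the heights are uniformly small, by compactness of the
    sphere. *)
Lemma continuous_polar th lam : cont_on S2 th -> (forall u, S2 u -> S2 (th u)) ->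
  fibre_map S2 lam -> continuous (polar th lam).
Proof.
move=> thc thS [lc lh] x.
have [->|x0] := eqVneq x 0.
  move=> W; rewrite {1}/polar eqxx => /nbhs_ballP[e /= e0 eW].
  rewrite nbhs_simpl /=.
  have /compact_near_coveringP cS := @compact_sphere R 3.
  have := cS R (nbhs (0 : R)) (fun r u => S2 u -> `|lam (u, r)| < e) _ _.
  have : forall u, S2 u -> \forall u' \near u & r \near (0 : R),
      S2 u' -> `|lam (u', r)| < e.
    move=> u Su; have [l0 _ _] := lh u Su.
    have : \forall p \near (u, 0 : R), S2 p.1 -> ball (0 : R) e (lam p).
      by have := lc (u, 0) Su (ball (0 : R) e); rewrite l0; apply; exact: nbhsx_ballx.
    apply: filterS => -[u' r] /= h Su'.
    by have := h Su'; rewrite -ball_normE /= sub0r normrN.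
  move=> nc /(_ _ nc) => nl.
  have ec : continuous enorm.
    exact/continuous_subspace_setT/cont_onP/cont_on_enorm.
  have e00 : enorm 0 = 0 by rewrite /enorm /dot mul0mx mxE sqrtr0.
  have : \forall y \near (0 : V3), forall u, S2 u -> S2 u -> `|lam (u, enorm y)| < e.
    suff nh : nbhs (enorm (0 : V3)) (fun r => forall u, S2 u -> S2 u -> `|lam (u, r)| < e).
      exact: (ec (0 : V3) _ nh).
    by rewrite e00.
  apply: filterS => y hy.
  apply: eW; rewrite -ball_normE /= sub0r normrN /polar; case: eqP => [_|/eqP y0]; first by rewrite normr0.
  have Sy := dir_sphere y0; rewrite normrZ.
  have h1 := hy (dir y) Sy Sy; apply: le_lt_trans h1.
  rewrite -[leRHS]mulr1 ler_wpM2l// -(@ler_pXn2r _ 2)// ?nnegrE// expr1n.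
  by apply: le_trans (mx_norm_le_dot _) _; rewrite (thS _ Sy : dot _ _ = 1).
have pc : cont_on [set x : V3 | x != 0] (fun x => lam (dir x, enorm x) *: th (dir x)).
  cts.
    apply: (cont_on_comp (f:=fun x => (dir x, enorm x)) lc); last first.
      by move=> y /= /dir_sphere.
    by cts; [exact: cont_on_dir|exact: cont_on_enorm].
  by apply: (cont_on_comp (f:=dir) thc); [exact: cont_on_dir|exact: dir_sphere].
have op : open [set x : V3 | x != 0].
  have -> : [set x : V3 | x != 0] = ~` [set 0].
    by apply/seteqP; split => z /= /eqP.
  rewrite openC; apply: (compact_closed (@norm_hausdorff _ _)).
  exact: compact_set1.
have : cont_on [set x : V3 | x != 0] (polar th lam).
  by apply: cont_on_eq pc => y /= y0; rewrite /polar (negbTE y0).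
move=> /cont_onP; rewrite continuous_open_subspace// => h; apply: h.
by rewrite inE.
Qed.

(** Continuity of the inverse: a strict inequality between two of the increasing
    maps persists near a point. *)
Lemma fibre_map_inverse ti lam : cont_on S2 ti ->
  (forall u, S2 u -> S2 (ti u)) ->
  fibre_map S2 lam -> exists2 mu, fibre_map S2 mu &
    forall u s, S2 u -> lam (ti u, mu (u, s)) = s.
Proof.
move=> tic tiS lf; have [lc lh] := lf.
have /choice [mu muP] : forall p : V3 * R, exists r, S2 p.1 -> lam (ti p.1, r) = p.2.
  move=> [u s]; have [Su|nS] := pselect (S2 u); last by exists 0.
  by have [r e] := fibre_map_onto s lf (tiS _ Su); exists r.
have muK u s : S2 u -> lam (ti u, mu (u, s)) = s by exact: (muP (u, s)).
have lK u r : S2 u -> mu (u, lam (ti u, r)) = r.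
  by move=> Su; apply: (fibre_map_inj lf (tiS _ Su)); rewrite muK.
exists mu => //; split; last first.
  move=> u Su; have [l0 mono unb] := lh _ (tiS _ Su); split.
  - by rewrite -l0 lK.
  - have wmono a b : a <= b -> lam (ti u, a) <= lam (ti u, b).
      by rewrite le_eqVlt => /orP[/eqP ->//|/mono/ltW].
    move=> r s rs; rewrite ltNge; apply/negP => /wmono.
    by rewrite !muK// leNgt rs.
  - by move=> r; exists (lam (ti u, r)), (lam (ti u, r)); rewrite lK// lexx.
move=> [u0 s0] /= Su0 W /nbhs_ballP [e /= e0 eW].
have [_ mono _] := lh _ (tiS _ Su0).
set r0 := mu (u0, s0) in eW.
have l1 : lam (ti u0, r0 - e) < s0.
  by rewrite -[ltRHS](muK u0 s0 Su0); apply: mono; rewrite -/r0; lra.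
have l2 : s0 < lam (ti u0, r0 + e).
  by rewrite -[ltLHS](muK u0 s0 Su0); apply: mono; rewrite -/r0; lra.
have cc r : cont_on [set p : V3 * R | S2 p.1] (fun p => lam (ti p.1, r) - p.2).
  cts; apply: (cont_on_comp (f:=fun p : V3 * R => (ti p.1, r)) lc).
    by cts; apply: (cont_on_comp (f:=fst) tic) => //; cts.
  by move=> p /= /tiS.
have n1 : lam (ti u0, r0 - e) - s0 < 0 by rewrite subr_lt0.
have n2 : 0 < lam (ti u0, r0 + e) - s0 by rewrite subr_gt0.
have h1 := cc (r0 - e) (u0, s0) Su0 _ (lt_nbhsl n1).
have h2 := cc (r0 + e) (u0, s0) Su0 _ (lt_nbhsr n2).
rewrite /= !nbhs_simpl /= in h1 h2 *.
rewrite /within /= in h1 h2 *; near=> p => Sp.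
have g1 : lam (ti p.1, r0 - e) - p.2 < 0 by have := near h1 p; apply.
have g2 : 0 < lam (ti p.1, r0 + e) - p.2 by have := near h2 p; apply.
have [_ monop _] := lh _ (tiS _ Sp).
have wmono a b : a <= b -> lam (ti p.1, a) <= lam (ti p.1, b).
  by rewrite le_eqVlt => /orP[/eqP ->//|/monop/ltW].
apply: eW; rewrite /ball /= ltr_distlC.
have e1 := muP p Sp; apply/andP; split; rewrite ltNge; apply/negP => /wmono;
  rewrite e1; lra.
Unshelve. all: by end_near. Qed.

Lemma polar_homeo th ti lam : cont_on S2 th -> cont_on S2 ti ->
  (forall u, S2 u -> S2 (th u)) -> (forall u, S2 u -> S2 (ti u)) ->
  (forall u, S2 u -> ti (th u) = u) -> (forall u, S2 u -> th (ti u) = u) ->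
  fibre_map S2 lam ->
  continuous (polar th lam) /\ exists g, [/\ continuous g,
    cancel (polar th lam) g & cancel g (polar th lam)].
Proof.
move=> thc tic thS tiS thK tiK lf; split; first exact: continuous_polar.
have [mu mf muK] := fibre_map_inverse tic tiS lf.
exists (polar ti mu); split; first exact: continuous_polar.
- move=> x; have [->|x0] := eqVneq x 0.
    by rewrite /polar eqxx eqxx.
  have Sx := dir_sphere x0; have ex : 0 < enorm x by rewrite enorm_gt0.
  rewrite {1}(enorm_dir x) polarZ// polarZ//; last 2 first.
    exact: thS.
    by rewrite (fibre_map_gt0 _ lf).
  rewrite thK// [RHS](enorm_dir x); congr (_ *: _).
  apply: (fibre_map_inj lf Sx).
  by rewrite -{1}(thK _ Sx) muK//; exact: thS.
- move=> x; have [->|x0] := eqVneq x 0.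
    by rewrite /polar eqxx eqxx.
  have Sx := dir_sphere x0; have ex : 0 < enorm x by rewrite enorm_gt0.
  rewrite {1}(enorm_dir x) polarZ// polarZ//; last 2 first.
    exact: tiS.
    by rewrite (fibre_map_gt0 _ mf).
  by rewrite tiK// muK// -enorm_dir.
Qed.

(** * Orientation of space homeomorphisms *)

(** Concatenation at time 1/2: one of [H (a t, u)], [K (b t, u)] is equal to the
    common middle value, which is subtracted. *)
Lemma homotopic_concat n (f g k : 'rV[R]_n -> 'rV[R]_n) (B : set 'rV[R]_n) :
  homotopic_in B f g -> homotopic_in B g k -> homotopic_in B f k.
Proof.
move=> [H [Hc HB H0 H1]] [K [Kc KB K0 K1]].
pose a (t : R) : R := Num.min 1 (2 * t); pose b (t : R) : R := Num.max 0 (2 * t - 1).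
have a01 (t : R) : 0 <= t <= 1 -> 0 <= a t <= 1.
  by move=> /andP[t0 t1]; rewrite /a le_min ler01 ge_min lexx; lra.
have b01 (t : R) : 0 <= t <= 1 -> 0 <= b t <= 1.
  by move=> /andP[t0 t1]; rewrite /b ge_max le_max lexx ler01; lra.
exists (fun p => H (a p.1, p.2) + K (b p.1, p.2) - H (1, p.2)).
have in01 (p : R * 'rV[R]_n) : cylinder R n p -> 0 <= p.1 <= 1 /\ sphere R n p.2.
  by move=> []; rewrite /= in_itv.
have a1 (t : R) : 2^-1 <= t -> a t = 1.
  by move=> t1; rewrite /a (min_idPl _)//; lra.
have b1 (t : R) : t <= 2^-1 -> b t = 0.
  by move=> t1; rewrite /b (max_idPl _)//; lra.
have HK (t : R) (w : 'rV[R]_n) : sphere R n w -> 0 <= t <= 1 ->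
    H (a t, w) + K (b t, w) - H (1, w) =
    if t <= 2^-1 then H (a t, w) else K (b t, w).
  move=> Sw t01; case: ifPn => [h|].
    by rewrite (b1 _ h) K0// -H1// addrK.
  by rewrite -ltNge => /ltW h; rewrite (a1 _ h) addrC addKr.
split.
- have ac : cont_on (cylinder R n) (fun p => a p.1) by rewrite /a; cts.
  have bc : cont_on (cylinder R n) (fun p => b p.1) by rewrite /b; cts.
  cts.
  + apply: (cont_on_comp (f:=fun p => (a p.1, p.2)) Hc); first by cts.
    by move=> p /in01[t01 Sp]; split => //=; rewrite in_itv; exact: a01.
  + apply: (cont_on_comp (f:=fun p => (b p.1, p.2)) Kc); first by cts.
    by move=> p /in01[t01 Sp]; split => //=; rewrite in_itv; exact: b01.
  + apply: (cont_on_comp (f:=fun p : R * _ => (1 : R, p.2)) Hc); first by cts.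
    by move=> p /in01[t01 Sp]; split => //=; rewrite in_itv /= ler01 lexx.
- by move=> t w t01 Sw /=; rewrite HK//; case: ifP => _;
    [apply: HB|apply: KB] => //; [exact: a01|exact: b01].
- move=> w Sw /=; rewrite HK//; last by rewrite lexx ler01.
  by rewrite invr_ge0 ler0n /a mulr0 (min_idPr ler01) H0.
- move=> w Sw /=; rewrite HK//; last by rewrite lexx ler01.
  rewrite ifF; last by apply/negbTE; rewrite -ltNge; lra.
  rewrite /b (max_idPr _) ?mulr1; last by lra.
  by rewrite (_ : 2 - 1 = 1) ?K1//; ring.
Qed.


Lemma reflectionK : involutive (@reflection R).
Proof. by move=> x; apply: eq_rV3; rewrite !mxE /= ?mxE /= ?opprK. Qed.

Lemma cont_on_reflection (T : topologicalType) (A : set T) (f : T -> V3) :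
  cont_on A f -> cont_on A (fun t => reflection (f t)).
Proof.
move=> fc; apply: cont_on_row; elim/ord3P.
- by apply: (@cont_on_eq _ _ _ (fun t => f t 0 0)); [move=> t _; rewrite mxE|cts].
- by apply: (@cont_on_eq _ _ _ (fun t => f t 0 1)); [move=> t _; rewrite mxE|cts].
- by apply: (@cont_on_eq _ _ _ (fun t => - f t 0 2)); [move=> t _; rewrite mxE|cts].
Qed.

Lemma reflection_eq0 x : (reflection x == 0) = (x == 0).
Proof.
have r0 : reflection (0 : V3) = 0.
  by apply: eq_rV3; rewrite !mxE /= ?mxE ?oppr0.
by rewrite -[in LHS]r0 (inj_eq (inv_inj reflectionK)).
Qed.

(** A fixed point free map of the sphere is homotopic to the antipodal map,
    and the antipodal map followed by a reflection is a half-turn. *)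
Lemma polar_orientation th lam : cont_on S2 th -> (forall u, S2 u -> S2 (th u)) ->
  (forall u, S2 u -> th u != u) -> fibre_map S2 lam ->
  continuous (polar th lam) -> injective (polar th lam) ->
  orientation_preserving (fun x => reflection (polar th lam x)).
Proof.
move=> thc thS thn lf hc hi p.
pose h x := reflection (polar th lam x).
have [lc lh] := lf.
have h0 : h 0 = 0 by apply/eqP; rewrite /h reflection_eq0 /polar eqxx.
have hinj x y : h x = h y -> x = y by move=> /(inv_inj reflectionK)/hi.
have in01 (q : R * V3) : cylinder R 3 q -> 0 <= q.1 <= 1 /\ S2 q.2.
  by move=> []; rewrite /= in_itv.
have hcont (A : set (R * V3)) (f : R * V3 -> V3) :
    cont_on A f -> cont_on A (fun q => h (f q)).
  move=> fc; apply: cont_on_reflection; exact: (cont_onT_comp (f:=f) hc fc).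
suff : homotopic_in [set z : V3 | z != 0] id (fun u => h (p + u) - h p).
  move=> [H [Hc Hn H0 H1]]; exists H; split => //.
  exact/cont_onP.
apply: (@homotopic_concat _ _ (fun u => reflection (- u))).
  exists (fun q : R * V3 => pt3 (cos (q.1 * pi) * q.2 0 0 - sin (q.1 * pi) * q.2 0 1)
    (sin (q.1 * pi) * q.2 0 0 + cos (q.1 * pi) * q.2 0 1) (q.2 0 2)); split.
  - apply: cont_on_row; elim/ord3P.
    + by apply: (@cont_on_eq _ _ _ (fun q : R * V3 =>
        cos (q.1 * pi) * q.2 0 0 - sin (q.1 * pi) * q.2 0 1));
        [move=> t _; rewrite mxE|cts].
    + by apply: (@cont_on_eq _ _ _ (fun q : R * V3 =>
        sin (q.1 * pi) * q.2 0 0 + cos (q.1 * pi) * q.2 0 1));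
        [move=> t _; rewrite mxE|cts].
    + by apply: (@cont_on_eq _ _ _ (fun q : R * V3 => q.2 0 2));
        [move=> t _; rewrite mxE|cts].
  - move=> t u _ Su /=; rewrite -dot_eq0 dot3E !mxE /=.
    have cs := cos2Dsin2 (t * pi); move: (cos _) (sin _) cs => a b ab.
    have : dot u u = 1 by []; rewrite dot3E => uu.
    have -> : (a * u 0 0 - b * u 0 1) * (a * u 0 0 - b * u 0 1) +
      (b * u 0 0 + a * u 0 1) * (b * u 0 0 + a * u 0 1) + u 0 2 * u 0 2 =
      (a ^+ 2 + b ^+ 2) * (u 0 0 * u 0 0 + u 0 1 * u 0 1) + u 0 2 * u 0 2.
      by ring.
    by rewrite ab mul1r uu oner_eq0.
  - move=> u _ /=; rewrite mul0r cos0 sin0.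
    by apply: eq_rV3; rewrite !mxE /=; ring.
  - move=> u _ /=; rewrite mul1r cospi sinpi.
    by apply: eq_rV3; rewrite !mxE /= ?mxE; ring.
apply: (@homotopic_concat _ _ h).
  exists (fun q : R * V3 => reflection ((1 - q.1) *: - q.2 + (q.1 * lam (q.2, 1)) *: th q.2)).
  split.
  - apply: cont_on_reflection; cts.
      apply: (cont_on_comp (f:=fun q : R * V3 => (q.2, 1 : R)) lc); first by cts.
      by move=> q /in01[].
    by apply: (cont_on_comp (f:=snd) thc); [cts|move=> q /in01[]].
  - move=> t u /andP[t0 t1] Su /=; rewrite reflection_eq0.
    have l0 : 0 < lam (u, 1) by rewrite (fibre_map_gt0 _ lf).
    apply/eqP => e; have {}e : (1 - t) *: u = (t * lam (u, 1)) *: th u.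
      by apply/esym/eqP; rewrite -subr_eq0 addrC -scalerN; apply/eqP.
    have [t1E|tn] := eqVneq t 1.
      move: e; rewrite t1E subrr scale0r mul1r => /esym/eqP.
      by rewrite scaler_eq0 gt_eqF//= (negbTE (sphere_neq0 (thS u Su))).
    have /eqP := thn u Su; apply; apply/esym.
    apply: (sphere_ray Su (thS u Su) _ _ e).
    + by rewrite subr_ge0.
    + by rewrite mulr_ge0// ltW.
    + by rewrite subr_eq0 eq_sym.
  - by move=> u _ /=; rewrite subr0 scale1r mul0r scale0r addr0.
  - move=> u Su /=; rewrite subrr scale0r add0r mul1r /h.
    by rewrite -[u in polar th lam u]scale1r polarZ.
exists (fun q : R * V3 => h (q.1 *: p + q.2) - h (q.1 *: p)); split.
- by cts; apply: hcont; cts.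
- move=> t u _ Su /=; rewrite subr_eq0; apply/eqP => /hinj /eqP.
  by rewrite -[X in _ == X]addr0 (inj_eq (addrI _)) (negbTE (sphere_neq0 Su)).
- by move=> u _ /=; rewrite scale0r add0r h0 subr0.
- by move=> u _ /=; rewrite scale1r.
Qed.
End Polar.

(** * Heights of a link *)

Section Heights.
Context {R : realType}.
Notation V2 := 'rV[R]_2.
Notation V3 := 'rV[R]_3.
Notation S2 := (sphere R 3).
Implicit Types (u v : V3) (r s : R) (L : set V3).

Lemma closed_cont_on (T U : topologicalType) (A : set T) (B : set U)
    (f : T -> U) : closed A -> cont_on A f -> closed B ->
  closed (A `&` f @^-1` B).
Proof.
move=> Ac /cont_onP/continuous_closedP fc /fc /closed_subspaceP [W Wc e].
by rewrite setIC -e; exact: closedI.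
Qed.

Lemma link_compact L : is_link L -> compact L.
Proof.
move=> [n [c [cc _ ->]]].
rewrite -bigsetU_fset_set; last exact: finite_finset.
apply: bigsetU_compact => i _; apply: continuous_compact; first exact: cc.
exact: compact_sphere.
Qed.

Definition ray_heights L u r := 0 < r /\ L (r *: u).

Lemma link_heights L : compact L -> ~ L 0 ->
  exists c C, heights (ray_heights L) c C.
Proof.
move=> Lc L0.
have Lcl : closed L by exact: compact_closed (@norm_hausdorff _ _) Lc.
have /nbhs_ballP[e /= e0 eL] : nbhs (0 : V3) (~` L).
  by apply: open_nbhs_nbhs; split => //; rewrite openC.
have ec : continuous (@enorm R).
  exact/continuous_subspace_setT/cont_onP/cont_on_enorm.
have /compact_bounded [M [_ hM]] : compact (@enorm R @` L).
  by apply: continuous_compact => //; exact: continuous_subspaceT.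
have lo u r : S2 u -> ray_heights L u r -> e <= r.
  move=> Su [r0 Lr]; rewrite leNgt; apply/negP => re; apply: (eL (r *: u)) => //.
  rewrite -ball_normE /= sub0r normrN.
  suff : `|r *: u| <= r by move=> /le_lt_trans; apply.
  rewrite -(@ler_pXn2r _ 2)// ?nnegrE ?normr_ge0 ?(ltW r0)//.
  apply: le_trans (mx_norm_le_dot _) _.
  by rewrite dotZl dotZr (Su : dot u u = 1) mulr1 expr2.
pose M' := Num.max 0 M + 1.
have hi u r : S2 u -> ray_heights L u r -> r <= M'.
  move=> Su [r0 Lr]; have := hM M'; rewrite /M' => /(_ _) h.
  have : `|enorm (r *: u)| <= Num.max 0 M + 1.
    apply: h; last by exists (r *: u).
    by rewrite ltr_pwDr// le_max lexx orbT.
  by rewrite (enormZ Su (ltW r0)) (ger0_norm (ltW r0)).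
exists e, (Num.max e M'); split => //.
- by rewrite le_max lexx.
- rewrite (_ : [set p | _] = [set p : V3 * R | S2 p.1] `&`
    ([set p | e <= p.2] `&` (fun p : V3 * R => p.2 *: p.1) @^-1` L)).
    apply: closedI; last apply: closedI.
    + by apply: (@closed_preimage_cont _ _ fst S2); [cts|exact: closed_sphere].
    + by apply: (@closed_preimage_cont _ _ snd [set x | e <= x]); [cts|exact: closed_ge].
    + by apply: closed_preimage_cont => //; cts.
  apply/seteqP; split => -[u r] /= [Su].
    by move=> h; split => //; split; [exact: lo h|case: h].
  by move=> [er Lr]; split => //; split => //; exact: lt_le_trans er.
- by move=> u r Su h; rewrite (lo u r Su h) le_max (hi u r Su h) orbT.
Qed.

Lemma heights_comp P (c C : R) (psi : V3 -> V3) : heights P c C ->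
  cont_on S2 psi -> (forall u, S2 u -> S2 (psi u)) ->
  heights (fun u r => P (psi u) r) c C.
Proof.
move=> [c0 cC Pcl Pb] pc pS; split => //; last first.
  by move=> u r Su; apply: Pb; exact: pS.
have Acl : closed [set p : V3 * R | S2 p.1].
  by apply: (@closed_preimage_cont _ _ fst S2); [cts|exact: closed_sphere].
have fc : cont_on [set p : V3 * R | S2 p.1] (fun p => (psi p.1, p.2)).
  by cts; apply: (cont_on_comp (f:=fst) pc) => //; cts.
have := closed_cont_on Acl fc Pcl.
congr closed; apply/seteqP; split => -[u r] /= [Su].
  by move=> [].
by move=> h; split => //; split => //; exact: pS.
Qed.

Lemma polar_image (psi : V3 -> V3) lam L : (forall u, S2 u -> S2 (psi u)) ->
  fibre_map S2 lam ->
  (forall x, exists y, polar psi lam y = x) -> ~ L 0 ->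
  (forall u, S2 u -> matches (ray_heights L)
     (fun u r => ray_heights L (psi u) r) lam u) ->
  polar psi lam @` L = L.
Proof.
move=> pS lf onto L0 m; apply/seteqP; split => [y [x Lx <-]|y Ly].
  have x0 : x != 0 by apply/eqP => x0; apply: L0; rewrite -x0.
  have Sx := dir_sphere x0; have e0 : 0 < enorm x by rewrite enorm_gt0.
  rewrite (enorm_dir x) polarZ//.
  have [_] := (m _ Sx (enorm x)).1 (conj e0 (eq_ind _ L Lx _ (enorm_dir x))).
  by [].
have [x xy] := onto y; exists x => //; move: Ly; rewrite -xy.
have [->|x0] := eqVneq x 0; first by rewrite /polar eqxx.
have Sx := dir_sphere x0; have e0 : 0 < enorm x by rewrite enorm_gt0.
rewrite {1}(enorm_dir x) polarZ// => Lx.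
have [_] := (m _ Sx (enorm x)).2 (conj (etrans (fibre_map_gt0 _ lf Sx) e0) Lx).
by rewrite -enorm_dir.
Qed.

(** The two strands are above the axes of the chart [phi]; [al] and [al'] are the
    heights of [P1] and [P2] over the axis where the coordinate [i] vanishes, [be]
    and [be'] over the other one.  The middles of the two heights at [v] separate
    the strands near [v]. *)
Lemma vertex_locally_matched (P1 P2 : V3 -> R -> Prop) (v : V3)
    (phi : V2 -> V3) (e0 : R) (i j : 'I_2) (al be al' be' : V2 -> R) :
  homeo (@disc R) (phi @` @disc R) phi -> phi 0 = v ->
  nbhs v [set x | S2 x -> (phi @` @disc R) x] ->
  0 < e0 <= 1 ->
  cont_on (bdisc e0) al -> cont_on (bdisc e0) be ->
  cont_on (bdisc e0) al' -> cont_on (bdisc e0) be' ->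
  (forall z, bdisc e0 z -> z 0 i = 0 ->
     P1 (phi z) (al z) /\ P2 (phi z) (al' z)) ->
  (forall z, bdisc e0 z -> z 0 j = 0 ->
     P1 (phi z) (be z) /\ P2 (phi z) (be' z)) ->
  (forall r, P1 v r -> r = al 0 \/ r = be 0) ->
  (forall r, P2 v r -> r = al' 0 \/ r = be' 0) ->
  (forall z, bdisc e0 z -> z 0 j * z 0 i != 0 ->
     forall r, ~ P1 (phi z) r /\ ~ P2 (phi z) r) ->
  (\forall u \near v, S2 u -> u != v -> forall r s,
     (P1 u r -> P1 u s -> r = s) /\ (P2 u r -> P2 u s -> r = s)) ->
  (forall r, P1 v r \/ P2 v r -> 0 < r) ->
  al 0 < be 0 -> al' 0 < be' 0 -> locally_matched P1 P2 v.
Proof.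
move=> ph phi0 phn e01 alc bec al'c be'c Pal Pbe P1v P2v Pn Pu P0 ab ab'.
have [e_0 e_1] := andP e01.
have b0 : bdisc e0 (0 : V2) by exact: bdisc0.
have z00 : (0 : V2) 0 j = 0 by rewrite mxE.
have z01 : (0 : V2) 0 i = 0 by rewrite mxE.
have [p1 p2] := Pal 0 b0 z01; have [q1 q2] := Pbe 0 b0 z00.
rewrite phi0 in p1 p2 q1 q2.
have alp := P0 _ (or_introl p1); have alp' := P0 _ (or_intror p2).
pose m1 := (al 0 + be 0) / 2; pose m2 := (al' 0 + be' 0) / 2.
exists m1, m2; split.
- by rewrite /m1; lra.
- by rewrite /m2; lra.
- by move=> /P1v [] h; have : m1 = (al 0 + be 0) / 2 by []; rewrite h; lra.
- by move=> /P2v [] h; have : m2 = (al' 0 + be' 0) / 2 by []; rewrite h; lra.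
have near0 (f : V2 -> R) : cont_on (bdisc e0) f -> 0 < f 0 ->
    \forall z \near (0 : V2), bdisc e0 z -> 0 < f z.
  by move=> fc f0; exact: (fc 0 b0 _ (lt_nbhsr f0)).
have n1 : \forall z \near (0 : V2), bdisc e0 z -> 0 < m1 - al z.
  by apply: near0; [cts|rewrite /m1; lra].
have n2 : \forall z \near (0 : V2), bdisc e0 z -> 0 < be z - m1.
  by apply: near0; [cts|rewrite /m1; lra].
have n3 : \forall z \near (0 : V2), bdisc e0 z -> 0 < m2 - al' z.
  by apply: near0; [cts|rewrite /m2; lra].
have n4 : \forall z \near (0 : V2), bdisc e0 z -> 0 < be' z - m2.
  by apply: near0; [cts|rewrite /m2; lra].
have nb : \forall z \near (0 : V2), bdisc e0 z.
  have dc : continuous (fun z : V2 => e0 ^+ 2 - dot z z).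
    by apply/continuous_subspace_setT/cont_onP; cts.
  have d0 : 0 < e0 ^+ 2 - dot (0 : V2) 0.
    by rewrite /dot mul0mx mxE subr0 exprn_gt0.
  have : \forall z \near (0 : V2), 0 < e0 ^+ 2 - dot z z.
    exact: (dc 0 _ (lt_nbhsr d0)).
  by apply: filterS => z; rewrite subr_gt0 => /ltW.
have [phii [phiic phiK phiD phiiK]] := homeo_inverse ph.
have Dv : (phi @` @disc R) v by exists 0 => //; rewrite /disc /= /dot mul0mx mxE ler01.
have phiv : phii v = 0.
  by rewrite -phi0 phiK//; rewrite /disc /= /dot mul0mx mxE ler01.
have nz (Q : V2 -> Prop) : (\forall z \near (0 : V2), Q z) ->
    \forall u \near v, S2 u -> exists2 z, phi z = u & Q z.
  move=> Q0; have Q0' : nbhs (phii v) Q by rewrite phiv.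
  have h : \forall u \near v, (phi @` @disc R) u -> Q (phii u).
    exact: (phiic v Dv _ Q0').
  near=> u => Su; have Du : (phi @` @disc R) u by have := near phn u; apply.
  by exists (phii u); [exact: phiiK|have := near h u; apply].
have N : \forall u \near v, S2 u -> exists2 z, phi z = u &
    [/\ bdisc e0 z, al z < m1, m1 < be z, al' z < m2 & m2 < be' z].
  apply: nz; near=> z.
  have ze : bdisc e0 z by near: z.
  by split=> //; rewrite -subr_gt0; move: ze; near: z.
near=> u => Su.
have Pu' : S2 u -> u != v -> forall r s,
    (P1 u r -> P1 u s -> r = s) /\ (P2 u r -> P2 u s -> r = s).
  by near: u.
have [z zu [ze h1 h2 h3 h4]] : exists2 z, phi z = u &
    [/\ bdisc e0 z, al z < m1, m1 < be z, al' z < m2 & m2 < be' z].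
  by move: Su; near: u.
have [uv|uv] := eqVneq u v.
  rewrite uv.
  have lo1 r : P1 v r -> r < m1 -> r = al 0.
    by move=> /P1v [//|->]; rewrite /m1; lra.
  have hi1 r : P1 v r -> m1 < r -> r = be 0.
    by move=> /P1v [->|//]; rewrite /m1; lra.
  have lo2 r : P2 v r -> r < m2 -> r = al' 0.
    by move=> /P2v [//|->]; rewrite /m2; lra.
  have hi2 r : P2 v r -> m2 < r -> r = be' 0.
    by move=> /P2v [->|//]; rewrite /m2; lra.
  split.
  - by split=> r s hr hs r1 s1;
      [rewrite (lo1 r)// (lo1 s)|rewrite (hi1 r)// (hi1 s)].
  - by split=> r s hr hs r1 s1;
      [rewrite (lo2 r)// (lo2 s)|rewrite (hi2 r)// (hi2 s)].
  - by split=> _; [exists (al' 0)|exists (al 0)]; rewrite // /m1 /m2; lra.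
  - by split=> _; [exists (be' 0)|exists (be 0)]; rewrite // /m1 /m2; lra.
have u1 r s : P1 u r -> P1 u s -> r = s by have [] : (P1 u r -> P1 u s -> r = s) /\ (P2 u r -> P2 u s -> r = s) by exact: Pu'.
have u2 r s : P2 u r -> P2 u s -> r = s by have [] : (P1 u r -> P1 u s -> r = s) /\ (P2 u r -> P2 u s -> r = s) by exact: Pu'.
have sp : split_at P1 m1 u /\ split_at P2 m2 u.
  by split; split => r s hr hs _ _; [exact: u1|exact: u1|exact: u2|exact: u2].
have [sp1 sp2] := sp; split => //.
  have [zz|zz] := eqVneq (z 0 j * z 0 i) 0; last first.
    by split=> -[r Pr _]; have [] := Pn z ze zz r; rewrite zu.
  have [z1|z1] := eqVneq (z 0 i) 0.
    have [a1 a2] := Pal z ze z1; rewrite zu in a1 a2.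
    by split=> _; [exists (al' z)|exists (al z)].
  have z0 : z 0 j = 0.
    by move/eqP: zz; rewrite mulf_eq0 (negbTE z1) orbF => /eqP.
  have [a1 a2] := Pbe z ze z0; rewrite zu in a1 a2.
  split=> -[r Pr rm].
    by move: rm; rewrite (u1 _ _ Pr a1) ltNge (ltW h2).
  by move: rm; rewrite (u2 _ _ Pr a2) ltNge (ltW h4).
have [zz|zz] := eqVneq (z 0 j * z 0 i) 0; last first.
  by split=> -[r Pr _]; have [] := Pn z ze zz r; rewrite zu.
have [z1|z1] := eqVneq (z 0 i) 0.
  have [a1 a2] := Pal z ze z1; rewrite zu in a1 a2.
  split=> -[r Pr rm].
    by move: rm; rewrite (u1 _ _ Pr a1) ltNge (ltW h1).
  by move: rm; rewrite (u2 _ _ Pr a2) ltNge (ltW h3).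
have z0 : z 0 j = 0.
  by move/eqP: zz; rewrite mulf_eq0 (negbTE z1) orbF => /eqP.
have [a1 a2] := Pbe z ze z0; rewrite zu in a1 a2.
by split=> _; [exists (be' z)|exists (be z)].
Unshelve. all: by end_near. Qed.
Lemma mul_coords (z : V2) i j : i != j -> z 0 j * z 0 i = z 0 0 * z 0 1.
Proof.
have h (k : 'I_2) : k = 0 \/ k = 1.
  by case: k => -[|[|//]] ?; [left|right]; exact: val_inj.
by case: (h i) (h j) => -> [] -> //; rewrite mulrC.
Qed.

Lemma disc_itv (z : V2) i : disc z -> -1 <= z 0 i <= 1.
Proof.
move=> dz; have : z 0 i ^+ 2 <= 1.
  apply: le_trans dz; rewrite dotE (bigD1 i)//= expr2 lerDl.
  by apply: sumr_ge0 => j _; rewrite -expr2 sqr_ge0.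
by move=> h; apply/andP; split; nra.
Qed.

Lemma cont_strand (e0 : R) (c : R -> R) (f : V2 -> V2) i :
  {within `[-1, 1], continuous c} -> cont_on (bdisc e0) f ->
  (forall z, bdisc e0 z -> disc (f z)) ->
  cont_on (bdisc e0) (fun z => c (f z 0 i)).
Proof.
move=> /cont_onP cc fc fd; apply: (cont_on_comp (f:=fun z => f z 0 i) cc).
  by cts.
by move=> z /fd/(disc_itv i); rewrite /= in_itv.
Qed.
End Heights.

(** * The antipodal symmetry transported to the link diagram *)

Section Symmetry.
Context {R : realType}.
Notation V2 := 'rV[R]_2.
Notation V3 := 'rV[R]_3.
Notation S2 := (sphere R 3).
Variables (G M : smap R) (S : set V3 -> bool) (L : set V3) (g : V3 -> V3).
Hypothesis mapM : is_map M.
Hypothesis repr : represents G M S L.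
Hypothesis anti : antipodal_drawing M g.

Variable gi : V3 -> V3.
Hypotheses (gic : cont_on S2 gi) (giK : forall x, S2 x -> gi (g x) = x).
Hypotheses (giS : forall x, S2 x -> S2 (gi x)) (gK : forall x, S2 x -> g (gi x) = x).

Let gc : cont_on S2 g. Proof. by have [[? _ _] _] := anti; exact/cont_onP. Qed.
Let gS x : S2 x -> S2 (g x).
Proof. by have [[_ [h _ _] _] _] := anti; exact: h. Qed.

Let V := vertices M.
Let D := drawing M.

Let DS x : D x -> S2 x. Proof. by have [_ _ [h _] _ _] := mapM; exact: h. Qed.
Let VD x : V x -> D x. Proof. by left. Qed.
Let VS x : V x -> S2 x. Proof. by move=> /VD/DS. Qed.

(** The antipodal map in the original drawing of the map. *)
Definition sym (x : V3) : V3 := gi (- g x).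

Let symS x : S2 x -> S2 (sym x).
Proof. by move=> Sx; apply/giS/sphereN/gS. Qed.

Let g_sym x : S2 x -> g (sym x) = - g x.
Proof. by move=> Sx; rewrite gK//; exact/sphereN/gS. Qed.

Let symK x : S2 x -> sym (sym x) = x.
Proof. by move=> Sx; rewrite {1}/sym g_sym// opprK giK. Qed.

Let symc : cont_on S2 sym.
Proof.
rewrite /sym; apply: (cont_on_comp (f:=fun x => - g x) gic); first by cts; exact: gc.
by move=> x Sx; exact/sphereN/gS.
Qed.

Let sym_neq x : S2 x -> sym x != x.
Proof.
move=> Sx; apply/eqP => /(congr1 g); rewrite g_sym// => /eqP.
by rewrite eq_sym -addr_eq0 -mulr2n -scaler_nat scaler_eq0 pnatr_eq0 /=
  (negbTE (sphere_neq0 (gS Sx))).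
Qed.

Let imgV : (@antipode R) @` (g @` V) = g @` V.
Proof. by have [_ [h _]] := anti. Qed.

Let imgE : (fun e => (@antipode R) @` e) @` ((fun e => g @` e) @` edges M) =
  (fun e => g @` e) @` edges M.
Proof. by have [_ [_ h]] := anti. Qed.

Let symV x : V x -> V (sym x).
Proof.
move=> Vx; have : (g @` V) (- g x).
  by rewrite -imgV; exists (g x) => //; exists x.
move=> [w Vw gw]; suff -> : sym x = w by [].
by rewrite /sym -gw giK//; exact: VS.
Qed.

Let symD x : D x -> D (sym x).
Proof.
move=> [Vx|[e Ee ex]]; first by left; exact: symV.
have : ((fun e => g @` e) @` edges M) ((@antipode R) @` (g @` e)).
  by rewrite -imgE; exists (g @` e) => //; exists e.
move=> [e' Ee' ee']; right; exists e' => //.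
have : (g @` e') (- g x) by rewrite ee'; exists (g x) => //; exists x.
move=> [w ew gw]; suff -> : sym x = w by [].
by rewrite /sym -gw giK//; apply: DS; right; exists e'.
Qed.

Let symV_iff x : S2 x -> V (sym x) <-> V x.
Proof.
by move=> Sx; split => [/symV|/symV//]; rewrite symK.
Qed.

Let symD_iff x : S2 x -> D (sym x) <-> D x.
Proof.
by move=> Sx; split => [/symD|/symD//]; rewrite symK.
Qed.

(** ** Faces *)

Let face_at x f : faces M f -> f x -> f = connected_component (S2 `\` D) x.
Proof.
by move=> [y Ay <-] fx; apply: same_connected_component.
Qed.

Let at_face x : S2 x -> ~ D x -> faces M (connected_component (S2 `\` D) x).
Proof. by move=> Sx nDx; exists x. Qed.

Let sym_face x t : S2 x -> ~ D x ->
  connected_component (S2 `\` D) x t -> connected_component (S2 `\` D) (sym x) (sym t).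
Proof.
move=> Sx nDx xt.
have AA : connected_component (S2 `\` D) x `<=` S2 `\` D.
  exact: connected_component_sub.
have Ax : (S2 `\` D) x by [].
have sub : sym @` connected_component (S2 `\` D) x `<=`
    connected_component (S2 `\` D) (sym x).
  apply: connected_component_max.
  - by exists x => //; exact: connected_component_refl.
  - move=> _ [s xs <-]; have [Ss nDs] := AA s xs.
    by split; [exact: symS|move/(symD_iff Ss)].
  - apply: connected_continuous_connected; first exact: component_connected.
    by apply/cont_onP; apply: cont_onW symc => s /AA[].
by apply: sub; exists t.
Qed.

Let face_image x : S2 x -> ~ D x ->
  (@antipode R) @` (g @` connected_component (S2 `\` D) x) =
  g @` connected_component (S2 `\` D) (sym x).
Proof.
move=> Sx nDx.
have sub y : connected_component (S2 `\` D) y `<=` S2.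
  by move=> t /connected_component_sub[].
apply/seteqP; split=> [_ [_ [t xt <-] <-]|_ [t xt <-]].
  exists (sym t); first exact: sym_face.
  by rewrite g_sym//; exact: sub xt.
have St : S2 t := sub _ _ xt.
have Ssx := symS Sx; have nDsx : ~ D (sym x) by move/(symD_iff Sx).
exists (g (sym t)); last by rewrite /antipode g_sym// opprK.
exists (sym t) => //; have := sym_face Ssx nDsx xt.
by rewrite symK.
Qed.

Let blackF x := black G (connected_component (S2 `\` D) x).

Let blackF_preserving x : color_preserving G M g -> S2 x -> ~ D x ->
  blackF x <-> blackF (sym x).
Proof.
move=> h Sx nDx; apply: h; [exact: at_face| |exact: face_image].
by apply: at_face; [exact: symS|move/(symD_iff Sx)].
Qed.

Let blackF_reversing x : color_reversing G M g -> S2 x -> ~ D x ->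
  blackF x <-> ~ blackF (sym x).
Proof.
move=> h Sx nDx; apply: h; [exact: at_face| |exact: face_image].
by apply: at_face; [exact: symS|move/(symD_iff Sx)].
Qed.

(** ** Heights over the edges and the faces *)

Let P1 := ray_heights L.
Let P2 u r := P1 (sym u) r.

Let heightD u r : S2 u -> P1 u r -> D u.
Proof. by have [_ h _ _] := repr; move=> Su [r0 Lr]; exact: h Su r0 Lr. Qed.

Let height_edge u : D u -> ~ V u -> exists r, P1 u r /\ forall s, P1 u s -> r = s.
Proof.
have [_ _ h _] := repr; move=> [//|[e Ee eu]] _.
by have [r [Pr Pu]] := h e u Ee eu; exists r; split => // s; exact: Pu.
Qed.

Let height_unique u r s : S2 u -> ~ V u -> P1 u r -> P1 u s -> r = s.
Proof.
move=> Su nV Pr Ps; have [t [_ h]] := height_edge (heightD Su Pr) nV.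
by rewrite -(h r)// -(h s).
Qed.

Let nearV u : (\forall x \near u, x != u -> ~ V x).
Proof.
have Vfin : finite_set V by have [[? _] _ _ _ _] := mapM.
have : closed (V `\ u).
  apply: (compact_closed (@norm_hausdorff _ _)).
  apply: finite_compact => //; exact: finite_setD.
rewrite -openC => op.
have : nbhs u (~` (V `\ u)) by apply: open_nbhs_nbhs; split => // -[_]; apply.
by apply: filterS => x h /eqP xu Vx; apply: h.
Qed.

(** ** The strands at a crossing *)

Section Crossing.
Variable v : V3.
Hypothesis Vv : V v.
Variables (phi phi' : V2 -> V3) (a b a' b' : R -> R).
Let w := sym v.
Hypothesis chart : ccw_chart v phi.
Hypothesis chart' : ccw_chart w phi'.

Definition quadrants_colored (ph : V2 -> V3) := forall x y, disc (pt2 x y) ->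
  [/\ drawing M (ph (pt2 x y)) <-> x * y = 0,
      0 < x * y -> exists f, [/\ faces M f, black G f & f (ph (pt2 x y))] &
      x * y < 0 -> exists f, [/\ faces M f, ~ black G f & f (ph (pt2 x y))]].

Hypothesis quad : quadrants_colored phi.
Hypothesis quad' : quadrants_colored phi'.

Let Sv : S2 v. Proof. exact: VS. Qed.
Let Sw : S2 w. Proof. exact: symS. Qed.

Let phiS z : disc z -> S2 (phi z).
Proof. by have [_ _ h _ _] := chart; move=> /h[]. Qed.
Let phiS' z : disc z -> S2 (phi' z).
Proof. by have [_ _ h _ _] := chart'; move=> /h[]. Qed.

Let quadD z : disc z -> D (phi z) <-> z 0 0 * z 0 1 = 0.
Proof. by move=> dz; have := @quad (z 0 0) (z 0 1); rewrite pt2_eta => /(_ dz)[]. Qed.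

Let quadD' z : disc z -> D (phi' z) <-> z 0 0 * z 0 1 = 0.
Proof. by move=> dz; have := @quad' (z 0 0) (z 0 1); rewrite pt2_eta => /(_ dz)[]. Qed.

Let quad_black ph z : quadrants_colored ph -> disc z -> 0 < z 0 0 * z 0 1 ->
  blackF (ph z).
Proof.
move=> q dz zz; have := @q (z 0 0) (z 0 1); rewrite pt2_eta => /(_ dz)[_ /(_ zz) + _].
by move=> [f [Ff bf fz]]; rewrite /blackF -(face_at Ff fz).
Qed.

Let quad_white ph z : quadrants_colored ph -> disc z -> z 0 0 * z 0 1 < 0 ->
  ~ blackF (ph z).
Proof.
move=> q dz zz; have := @q (z 0 0) (z 0 1); rewrite pt2_eta => /(_ dz)[_ _ /(_ zz)].
by move=> [f [Ff bf fz]]; rewrite /blackF -(face_at Ff fz).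
Qed.

(** The involution read in the charts at [v] and [sym v] preserves the union of
    the axes, which is the trace of the medial map. *)
Lemma crossing_transition : exists e0 (tau : V2 -> V2), [/\ 0 < e0 <= 1,
  axes_map e0 tau, forall z, bdisc e0 z -> disc (tau z) &
  forall z, bdisc e0 z -> phi' (tau z) = sym (phi z)].
Proof.
have [ph phi0 _ _ _] := chart; have [ph' phi0' _ phn' _] := chart'.
have [phii [phiic phiK phiD phiiK]] := homeo_inverse ph'.
have [/cont_onP phic [_ phinj _] _] := ph.
have disc0 : @disc R 0 by rewrite /disc /= /dot mul0mx mxE ler01.
have sc : cont_on (@disc R) (fun z => sym (phi z)).
  exact: (cont_on_comp (f:=phi) symc).
have : \forall z \near (0 : V2), disc z -> S2 (sym (phi z)) ->
    (phi' @` @disc R) (sym (phi z)).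
  have nw : nbhs (sym (phi 0)) [set x | S2 x -> (phi' @` @disc R) x].
    by rewrite phi0.
  exact: (sc 0 disc0 _ nw).
move=> /nbhs0_bdisc[e0 e01 he]; exists e0, (fun z => phii (sym (phi z))).
have ed z : bdisc e0 z -> disc z.
  by rewrite -disc_bdisc; apply: bdisc_le; case/andP: e01 => /ltW -> ->.
have im z : bdisc e0 z -> (phi' @` @disc R) (sym (phi z)).
  by move=> ze; apply: he => //; [exact: ed|exact/symS/phiS/ed].
have td z : bdisc e0 z -> disc (phii (sym (phi z))) by move=> /im/phiD.
have te z : bdisc e0 z -> phi' (phii (sym (phi z))) = sym (phi z).
  by move=> /im/phiiK.
split => //; split.
- apply: (cont_on_comp (f:=fun z => sym (phi z)) phiic) => //.
  by apply: cont_onW sc => z /ed.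
- by rewrite phi0 -/w -phi0' phiK.
- move=> z z' ze ze' h; apply: phinj; rewrite ?inE; [exact: ed|exact: ed|].
  have := te z ze; rewrite h te// => h'.
  by rewrite -(symK (phiS (ed z ze))) -h' symK//; exact/phiS/ed.
- move=> z ze; apply/eqP/eqP.
    move=> /(quadD' (td z ze)); rewrite te// => /(symD_iff (phiS (ed z ze))).
    by move/(quadD (ed z ze)).
  move=> /(quadD (ed z ze)) h; apply/(quadD' (td z ze)); rewrite te//.
  exact: symD.
Qed.

Variables (e0 : R) (tau : V2 -> V2).
Hypothesis e01 : 0 < e0 <= 1.
Hypothesis taux : axes_map e0 tau.
Hypothesis taud : forall z, bdisc e0 z -> disc (tau z).
Hypothesis taue : forall z, bdisc e0 z -> phi' (tau z) = sym (phi z).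

Let ed z : bdisc e0 z -> disc z.
Proof. by rewrite -disc_bdisc; apply: bdisc_le; case/andP: e01 => /ltW -> ->. Qed.

Let tau_neq0 z : bdisc e0 z -> z 0 0 * z 0 1 != 0 -> tau z 0 0 * tau z 0 1 != 0.
Proof. by have [_ _ _ h] := taux; move=> ze; rewrite h. Qed.

Let not_on_D z : disc z -> z 0 0 * z 0 1 != 0 -> ~ D (phi z).
Proof. by move=> dz /eqP zz /(quadD dz). Qed.

Let preserving_signs : color_preserving G M g -> axes_signs e0 1 tau.
Proof.
move=> col z ze; have dz := ed ze; have dt := taud ze.
have key := fun n => blackF_preserving col (phiS dz) (not_on_D dz n).
split => zz; have n : z 0 0 * z 0 1 != 0 by apply/eqP => h; move: zz; rewrite h ltxx.
  rewrite mul1r lt_neqAle eq_sym tau_neq0//= leNgt; apply/negP => tt.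
  apply: (quad_white quad' dt tt); rewrite taue//; apply/key => //.
  exact: quad_black.
rewrite mul1r lt_neqAle tau_neq0//= leNgt; apply/negP => tt.
apply: (quad_white quad dz zz); apply/key => //; rewrite -taue//.
exact: quad_black.
Qed.

Let reversing_signs : color_reversing G M g -> axes_signs e0 (-1) tau.
Proof.
move=> col z ze; have dz := ed ze; have dt := taud ze.
have key := fun n => blackF_reversing col (phiS dz) (not_on_D dz n).
split => zz; have n : z 0 0 * z 0 1 != 0 by apply/eqP => h; move: zz; rewrite h ltxx.
  rewrite mulN1r oppr_gt0 lt_neqAle tau_neq0//= leNgt; apply/negP => tt.
  have : blackF (phi z) by exact: quad_black.
  by move/key => /(_ n); apply; rewrite -taue//; exact: quad_black.
rewrite mulN1r oppr_lt0 lt_neqAle eq_sym tau_neq0//= leNgt; apply/negP => tt.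
apply: (quad_white quad dz zz); apply/key => //; rewrite -taue//.
exact: quad_white.
Qed.

Let no_rotation : ~ exists2 kap : V2, sphere R 2 kap &
    forall z (t : R), bdisc e0 z -> z != 0 -> 0 <= t <= 1 ->
      (1 - t) *: tau z + t *: cmul kap z != 0.
Proof.
move=> [kap kap1 kapt]; have [tc t0 _ _] := taux; have [gh _] := anti.
apply: (@antipodal_no_rotation R g v w phi phi' tau kap e0) => //.
  by rewrite g_sym.
by move=> z ze; rewrite taue// g_sym//; exact/phiS/ed.
Qed.

(** Preserving colors, the symmetry exchanges the strands seen on the left and
    on the right from a black face, since it reverses the orientation. *)
Lemma color_preserving_swaps : color_preserving G M g ->
  forall z, bdisc e0 z -> (tau z 0 0 == 0) = (z 0 1 == 0) /\
                          (tau z 0 1 == 0) = (z 0 0 == 0).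
Proof.
move=> col; have e00 : 0 < e0 by case/andP: e01.
have [ax|//] := axes_preserved_or_swapped e00 taux.
exfalso; apply: no_rotation; apply: (rotation_pattern e00 taux); left.
by split => //; exact: preserving_signs.
Qed.

(** Reversing colors, the quadrants are exchanged, and the strands are not, for the
    same reason. *)
Lemma color_reversing_preserves : color_reversing G M g ->
  forall z, bdisc e0 z -> (tau z 0 0 == 0) = (z 0 0 == 0) /\
                          (tau z 0 1 == 0) = (z 0 1 == 0).
Proof.
move=> col; have e00 : 0 < e0 by case/andP: e01.
have [//|ax] := axes_preserved_or_swapped e00 taux.
exfalso; apply: no_rotation; apply: (rotation_pattern e00 taux); right.
by split => //; exact: reversing_signs.
Qed.

(** Since the involution preserves the vertices and the edges of the medial map,
    the heights are unique near [v] except over [v]. *)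
Lemma crossing_matched (i j : 'I_2) (al be al' be' : V2 -> R) : i != j ->
  cont_on (bdisc e0) al -> cont_on (bdisc e0) be ->
  cont_on (bdisc e0) al' -> cont_on (bdisc e0) be' ->
  (forall z, bdisc e0 z -> z 0 i = 0 ->
     P1 (phi z) (al z) /\ P2 (phi z) (al' z)) ->
  (forall z, bdisc e0 z -> z 0 j = 0 ->
     P1 (phi z) (be z) /\ P2 (phi z) (be' z)) ->
  (forall r, P1 v r -> r = al 0 \/ r = be 0) ->
  (forall r, P2 v r -> r = al' 0 \/ r = be' 0) ->
  al 0 < be 0 -> al' 0 < be' 0 -> locally_matched P1 P2 v.
Proof.
move=> ij alc bec al'c be'c hal hbe hv hv' ab ab'.
have [ph phi0 _ phn _] := chart.
apply: (vertex_locally_matched (i:=i) (j:=j) ph phi0 phn e01 alc bec al'c be'c) => //.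
- move=> z ze zz r; have dz := ed ze.
  have nD : ~ D (phi z) by apply: (not_on_D dz); rewrite -(mul_coords z ij).
  split=> [/(heightD (phiS dz))//|/(heightD (symS (phiS dz)))].
  by move/(symD_iff (phiS dz)).
- have := nearV v; apply: filterS => u nV Su uv r s; split; apply: height_unique => //.
  + exact: nV.
  + exact: symS.
  + by move/(symV_iff Su); exact: nV.
- by move=> r [] [].
Qed.
End Crossing.

(** In both cases a strand passing over is sent to a strand passing over: either
    the axes are exchanged and the sign changes, or none of the two happens. *)
Lemma vertex_matched v : V v ->
  (color_preserving G M g /\ sign_reversing G M S g) \/
  (color_reversing G M g /\ sign_preserving G M S g) ->
  locally_matched P1 P2 v.
Proof.
move=> Vv hyp; have [_ _ _ cr] := repr.
have [phi [a [b [ch quad [ac bc] hab [hv hs]]]]] := cr v Vv.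
have [phi' [a' [b' [ch' quad' [a'c b'c] hab' [hv' hs']]]]] := cr _ (symV Vv).
have [e0 [tau [e01 taux taud taue]]] := crossing_transition ch ch' quad quad'.
have Sv := VS Vv; have e00 : 0 < e0 by case/andP: e01.
have ed z : bdisc e0 z -> disc z.
  by rewrite -disc_bdisc; apply: bdisc_le; case/andP: e01 => /ltW -> ->.
have dI (z : V2) i : disc z -> -1 <= z 0 i <= 1 by exact: disc_itv.
have idc : cont_on (bdisc e0) (fun z : V2 => z) by cts.
have [tc t0 _ _] := taux.
have cs c f i := @cont_strand R e0 c f i.
have t00 : tau 0 0 0 = 0 by rewrite t0 mxE.
have t01 : tau 0 0 1 = 0 by rewrite t0 mxE.
have z00 : (0 : V2) 0 0 = 0 by rewrite mxE.
have z01 : (0 : V2) 0 1 = 0 by rewrite mxE.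
have onx z : disc z -> z 0 1 = 0 -> P1 (phi z) (a (z 0 0)).
  move=> dz z1; have [p _ l _] := hab _ (dI z 0 dz); split => //.
  by rewrite -(pt2_eta z) z1 pt2E0.
have ony z : disc z -> z 0 0 = 0 -> P1 (phi z) (b (z 0 1)).
  move=> dz z0; have [_ p _ l] := hab _ (dI z 1 dz); split => //.
  by rewrite -(pt2_eta z) z0 pt2E1.
have onx' z : bdisc e0 z -> tau z 0 1 = 0 -> P2 (phi z) (a' (tau z 0 0)).
  move=> ze z1; have [p _ l _] := hab' _ (dI _ 0 (taud z ze)); split => //.
  by rewrite -taue// -[in phi' _](pt2_eta (tau z)) z1.
have ony' z : bdisc e0 z -> tau z 0 0 = 0 -> P2 (phi z) (b' (tau z 0 1)).
  move=> ze z0; have [_ p _ l] := hab' _ (dI _ 1 (taud z ze)); split => //.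
  by rewrite -taue// -[in phi' _](pt2_eta (tau z)) z0.
have hv1 r : P1 v r -> r = a 0 \/ r = b 0 by move=> [r0 /(hv r r0)].
have hv2 r : P2 v r -> r = a' 0 \/ r = b' 0 by move=> [r0 /(hv' r r0)].
have sgv : g (sym v) = antipode (g v) by rewrite g_sym.
have ac' := cs a id 0 ac idc ed; have bc' := cs b id 1 bc idc ed.
have a'0 := cs a' tau 0 a'c tc taud; have b'1 := cs b' tau 1 b'c tc taud.
case: hyp => -[col sgn].
  have sw := color_preserving_swaps Vv ch ch' quad quad' e01 taux taud taue col.
  have := sgn v _ Vv (symV Vv) (esym sgv) => sE.
  have tx z : bdisc e0 z -> z 0 1 = 0 -> tau z 0 0 = 0.
    by move=> ze z1; apply/eqP; have [-> _] := sw z ze; rewrite z1.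
  have ty z : bdisc e0 z -> z 0 0 = 0 -> tau z 0 1 = 0.
    by move=> ze z0; apply/eqP; have [_ ->] := sw z ze; rewrite z0.
  have hx z : bdisc e0 z -> z 0 1 = 0 ->
      P1 (phi z) (a (z 0 0)) /\ P2 (phi z) (b' (tau z 0 1)).
    by move=> ze z1; split; [exact/onx/z1/ed|exact/ony'/tx].
  have hy z : bdisc e0 z -> z 0 0 = 0 ->
      P1 (phi z) (b (z 0 1)) /\ P2 (phi z) (a' (tau z 0 0)).
    by move=> ze z1; split; [exact/ony/z1/ed|exact/onx'/ty].
  have hv2' r : P2 v r -> r = b' (tau 0 0 1) \/ r = a' (tau 0 0 0).
    by rewrite t00 t01 => /hv2[]; [right|left].
  have hv1' r : P1 v r -> r = a ((0 : V2) 0 0) \/ r = b ((0 : V2) 0 1).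
    by rewrite z00 z01 => /hv1.
  move: hs hs'; rewrite sE; case: (vsign G S (sym v)) => /= lt lt'.
    apply: (@crossing_matched v phi ch quad e0 e01 1 0 (fun z => a (z 0 0))
      (fun z => b (z 0 1)) (fun z => b' (tau z 0 1)) (fun z => a' (tau z 0 0))) => //.
      by rewrite z00 z01.
    by rewrite t00 t01.
  apply: (@crossing_matched v phi ch quad e0 e01 0 1 (fun z => b (z 0 1))
    (fun z => a (z 0 0)) (fun z => a' (tau z 0 0)) (fun z => b' (tau z 0 1))) => //.
  - by move=> r /hv1'[]; [right|left].
  - by move=> r /hv2'[]; [right|left].
  - by rewrite z00 z01.
  - by rewrite t00 t01.
have sw := color_reversing_preserves Vv ch ch' quad quad' e01 taux taud taue col.
have := sgn v _ Vv (symV Vv) (esym sgv) => sE.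
have tx z : bdisc e0 z -> z 0 1 = 0 -> tau z 0 1 = 0.
  by move=> ze z1; apply/eqP; have [_ ->] := sw z ze; rewrite z1.
have ty z : bdisc e0 z -> z 0 0 = 0 -> tau z 0 0 = 0.
  by move=> ze z0; apply/eqP; have [-> _] := sw z ze; rewrite z0.
have hx z : bdisc e0 z -> z 0 1 = 0 ->
    P1 (phi z) (a (z 0 0)) /\ P2 (phi z) (a' (tau z 0 0)).
  by move=> ze z1; split; [exact/onx/z1/ed|exact/onx'/tx].
have hy z : bdisc e0 z -> z 0 0 = 0 ->
    P1 (phi z) (b (z 0 1)) /\ P2 (phi z) (b' (tau z 0 1)).
  by move=> ze z1; split; [exact/ony/z1/ed|exact/ony'/ty].
have hv2' r : P2 v r -> r = a' (tau 0 0 0) \/ r = b' (tau 0 0 1).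
  by rewrite t00 t01 => /hv2.
have hv1' r : P1 v r -> r = a ((0 : V2) 0 0) \/ r = b ((0 : V2) 0 1).
  by rewrite z00 z01 => /hv1.
move: hs hs'; rewrite sE; case: (vsign G S (sym v)) => /= lt lt'.
  apply: (@crossing_matched v phi ch quad e0 e01 0 1 (fun z => b (z 0 1))
    (fun z => a (z 0 0)) (fun z => b' (tau z 0 1)) (fun z => a' (tau z 0 0))) => //.
  - by move=> r /hv1'[]; [right|left].
  - by move=> r /hv2'[]; [right|left].
  - by rewrite z00 z01.
  - by rewrite t00 t01.
apply: (@crossing_matched v phi ch quad e0 e01 1 0 (fun z => a (z 0 0))
  (fun z => b (z 0 1)) (fun z => a' (tau z 0 0)) (fun z => b' (tau z 0 1))) => //.
  by rewrite z00 z01.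
by rewrite t00 t01.
Qed.

(** Away from the vertices there is at most one height, so that any height above
    the link splits it. *)
Lemma all_matched u :
  (color_preserving G M g /\ sign_reversing G M S g) \/
  (color_reversing G M g /\ sign_preserving G M S g) ->
  (exists c C, heights P1 c C) -> S2 u -> locally_matched P1 P2 u.
Proof.
move=> hyp [c [C [c0 cC _ Pb]]] Su.
have [Vu|nVu] := pselect (V u); first exact: vertex_matched.
have C1 x r : S2 x -> P1 x r -> r < C + 1.
  by move=> Sx /(Pb x r Sx)/andP[_]; lra.
have C2 x r : S2 x -> P2 x r -> r < C + 1 by move=> /symS; exact: C1.
have m0 : 0 < C + 1 by lra.
exists (C + 1), (C + 1); split => //.
- by move=> /(C1 _ _ Su); rewrite ltxx.
- by move=> /(C2 _ _ Su); rewrite ltxx.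
have nV : \forall x \near u, ~ V x.
  have := nearV u; apply: filterS => x h.
  by have [->//|] := eqVneq x u.
apply: filterS nV => x nVx Sx.
have nVx' : ~ V (sym x) by move/(symV_iff Sx).
split.
- split=> r s hr hs; first by move=> _ _; exact: (height_unique Sx nVx).
  by have := C1 _ _ Sx hr => h1 h2; have := lt_trans h1 h2; rewrite ltxx.
- split=> r s hr hs; first by move=> _ _; exact: (height_unique (symS Sx) nVx').
  by have := C2 _ _ Sx hr => h1 h2; have := lt_trans h1 h2; rewrite ltxx.
- split=> -[r Pr _].
    have [s [Ps _]] := height_edge (symD (heightD Sx Pr)) nVx'.
    by exists s => //; exact: C2 Ps.
  have Dx : D x by apply/(symD_iff Sx); exact: heightD (symS Sx) Pr.
  have [s [Ps _]] := height_edge Dx nVx.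
  by exists s => //; exact: C1 Ps.
- split=> -[r Pr h].
    by have := lt_trans (C1 _ _ Sx Pr) h; rewrite ltxx.
  by have := lt_trans (C2 _ _ Sx Pr) h; rewrite ltxx.
Qed.

(** The radial extension of the involution, corrected along the rays, preserves
    the link; it remains to reflect. *)
Lemma antipodal_amphichiral :
  (color_preserving G M g /\ sign_reversing G M S g) \/
  (color_reversing G M g /\ sign_preserving G M S g) -> amphichiral L.
Proof.
move=> hyp; have [[Llink L0] _ _ _] := repr.
have [c [C hP1]] := link_heights (link_compact Llink) L0.
have hP2 := heights_comp hP1 symc symS.
have [lam lf lm] : exists2 lam, fibre_map S2 lam &
    forall u, S2 u -> matches P1 P2 lam u.
  apply: (global_matching hP1 hP2) => u Su.
  by apply: all_matched => //; exists c, C.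
have [pc [p' [p'c pK p'K]]] := polar_homeo symc symc symS symS symK symK lf.
exists (fun x => reflection (polar sym lam x)); split.
- split.
  + apply/cont_onP/cont_on_reflection; exact: cont_on_continuous.
  + split=> // [x y _ _ /(inv_inj reflectionK)/(can_inj pK)//|y _].
    by exists (p' (reflection y)); rewrite // p'K reflectionK.
  + exists (fun y => p' (reflection y)); split.
      apply/cont_onP; apply: (cont_onT_comp (f:=@reflection R) p'c).
      by apply: (cont_on_reflection (f:=fun y => y)); cts.
    by move=> x _; rewrite reflectionK pK.
- exact: polar_orientation (can_inj pK).
- rewrite /mirror -[in RHS](polar_image symS lf _ L0 lm).
    by rewrite -image_comp.
  by move=> x; exists (p' x).
Qed.
End Symmetry.

Theorem corollary1 (R : realType) (G : smap R) (S : set 'rV[R]_3 -> bool)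
    (M : smap R) (L : set 'rV[R]_3) (g : 'rV[R]_3 -> 'rV[R]_3) :
  is_map G ->
  is_medial G M ->
  represents G M S L ->
  antipodal_drawing M g ->
  (color_preserving G M g /\ sign_reversing G M S g) \/
  (color_reversing G M g /\ sign_preserving G M S g) ->
  amphichiral L.
Proof.
move=> _ [_ [_ [mapM _] _ _ _]] repr anti.
have [gh _] := anti; have [gi [gic giK giS gK]] := homeo_inverse gh.
exact: (antipodal_amphichiral mapM repr anti gic giK giS gK).
Qed.
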